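(* Let $h:I\to J$ be a homeomorphism between two compact intervals $I$ and $J$ of the real line, and let $\mathcal G_\Omega=\{I^n_\beta:n\ge1,\ 1\le\beta\le\Omega(n)\}$ be a grid of $I$. Let $0<\alpha\le1$. All constants and functions below are independent of $n$ and $\beta$. (i) Each of the following equivalences holds, where the bounds are required for all $n\ge1$ and all $1\le\beta<\Omega(n)$: - $h$ is quasisymmetric if and only if $|lrd(I^n_\beta,I^n_{\beta+1})|\le O(1)$; - $h$ is (uaa) if and only if $|lrd(I^n_\beta,I^n_{\beta+1})|\le o(|I^n_\beta|)\,|I^n_\beta|^{-1}$; - $h$ is $C^{1+\alpha}$ with $dh(x)\ne0$ for all $x\in I$ if and only if $|lrd(I^n_\beta,I^n_{\beta+1})|\le O(|I^n_\beta|^\alpha)$; - $h$ is $C^{1+Lipschitz}$ with $dh(x)\ne0$ for all $x\in I$ if and only if $|lrd(I^n_\beta,I^n_{\beta+1})|\le O(|I^n_\beta|)$; - $h$ is affine with $dh(x)\neq 0$ for all $x\in I$ if and only if $|lrd(I^n_\beta,I^n_{\beta+1})|\le o(|I^n_\beta|)$. (ii) Consider the following pairs (degree of smoothness; bound), where the bounds are required for all $n\ge1$ and all $1\le\beta<\Omega(n)-1$: - quasisymmetric; $|crd(I^n_\beta,I^n_{\beta+1},I^n_{\beta+2})|\le O(1)$; - (uaa); $|crd(I^n_\beta,I^n_{\beta+1},I^n_{\beta+2})|\le o(|I^n_\beta|)\,|I^n_\beta|^{-1}$; - $C^{1+\alpha}$; $|crd(I^n_\beta,I^n_{\beta+1},I^n_{\beta+2})|\le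 O(|I^n_\beta|^{\alpha})$; - $C^{2+\alpha}$; $|crd(I^n_\beta,I^n_{\beta+1},I^n_{\beta+2})|\le O(|I^n_\beta|^{1+\alpha})$; - $C^{2+Lipschitz}$; $|crd(I^n_\beta,I^n_{\beta+1},I^n_{\beta+2})|\le O(|I^n_\beta|^{2})$. For each pair: if $h$ has the degree of smoothness, and (except in the quasisymmetric and (uaa) cases) $dh(x)\ne0$ for all $x\in I$, then the bound holds. Conversely, if the bound holds, then for every closed interval $K$ contained in the interior of $I$, the restriction $h|K$ has the degree of smoothness, and (except in the quasisymmetric and (uaa) cases) $dh(x)\ne0$ for all $x\in I$.
   Context: Grids. Given $B\ge1$, $M>1$ and $\Omega:\mathbb{N}\to\mathbb{N}$, a $(B,M)$ grid $\mathcal G_\Omega=\{I^n_\beta\subset I:n\ge1,\ \beta=1,\ldots,\Omega(n)\}$ of a closed interval $I$ is a collection of closed intervals such that: for every $n$, $\bigcup_\beta I^n_\beta=I$; distinct $I^n_\beta$ at the same level $n$ have disjoint interiors; for $1\le\beta<\Omega(n)$, $I^n_\beta\cap I^n_{\beta+1}$ is exactly a common endpoint; the endpoints of level-$n$ intervals are endpoints of level-$(n+1)$ intervals; $B^{-1}\le|I^n_{\beta+1}|/|I^n_\beta|\le B$ for $1\le\beta<\Omega(n)$; each $I^n_\beta$ contains at least two and at most $M$ grid intervals of level $n+1$. A grid is a $(B,M)$ grid for some $B,M$. Distortions. $lrd(I_\beta,I_{\beta'})=\log\left(\frac{|I_\beta|}{|I_{\beta'}|}\frac{|h(I_{\beta'})|}{|h(I_\beta)|}\right)$.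 For intervals with $I_\beta$ adjacent to $I_{\beta'}$ and $I_{\beta'}$ adjacent to $I_{\beta''}$, $cr(I_\beta,I_{\beta'},I_{\beta''})=\log\left(1+\frac{|I_{\beta'}|}{|I_\beta|}\frac{|I_\beta|+|I_{\beta'}|+|I_{\beta''}|}{|I_{\beta''}|}\right)$ and $crd(I_\beta,I_{\beta'},I_{\beta''})=cr(h(I_\beta),h(I_{\beta'}),h(I_{\beta''}))-cr(I_\beta,I_{\beta'},I_{\beta''})$. Smoothness. $h$ is quasisymmetric if for every $d\ge1$ there is $k_d\ge1$ with $\left|\log\frac{h(x+\delta_2)-h(x)}{h(x)-h(x-\delta_1)}\frac{\delta_1}{\delta_2}\right|\le\log k_d$ for all $x-\delta_1,x,x+\delta_2\in I$ with $\delta_1,\delta_2>0$, $d^{-1}\le\delta_2/\delta_1\le d$. $h$ is (uaa) (uniformly asymptotically affine) if for every $d\ge1$ there is a continuous $\epsilon_d:\mathbb{R}^+_0\to\mathbb{R}^+_0$ with $\epsilon_d(0)=0$ such that the left side above is $\le\epsilon_d(\delta_1+\delta_2)$ for all $x-\delta_1,x,x+\delta_2\in I$ with $\delta_1,\delta_2>0$, $d^{-1}<\delta_2/\delta_1<d$. For $0<\alpha\le1$, $h$ is $C^{1+\alpha}$ if it is differentiable with $\alpha$-Hölder first derivative $dh$, and $C^{1+Lipschitz}$ if $dh$ is Lipschitz (the case $\alpha=1$); $h$ is $C^{2+\alpha}$ (resp. $C^{2+Lipschitz}$) if it is twice differentiable with $\alpha$-Hölder (resp. Lipschitz) second derivative.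 Order notation. $\phi\le O(\psi)$ means $|\phi|\le c|\psi|$ for a constant $c$; $\phi\le o(\psi)$ means $|\phi|\le\epsilon(|\psi|)|\psi|$ for a continuous $\epsilon:\mathbb{R}^+_0\to\mathbb{R}^+_0$ with $\epsilon(0)=0$; thus $o(|I|)|I|^{-1}$ means a bound of the form $\epsilon(|I|)$.
   Formalization: In (ii), pair (C^{1+α}; O(|I|^α)), the converse conclusion that h|K is C^{1+α} is claimed only for α<1: at α=1 it is false, since the bound gives only a Zygmund condition on dh; dh≠0 on I is still claimed for α=1. *)

(* Defs.v *)
From HB Require Import structures.
From mathcomp Require Import all_boot all_order all_algebra.
From mathcomp Require Import all_classical all_reals all_analysis.
Set Implicit Arguments.
Unset Strict Implicit.
Unset Printing Implicit Defensive.
Import Order.TTheory GRing.Theory Num.Theory.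
Import numFieldNormedType.Exports.
Local Open Scope classical_set_scope.
Local Open Scope ring_scope.

Definition closed_itv (R : realType) (A : set R) : Prop :=
  exists u v : R, u < v /\ A = `[u, v]%classic.

(* |A|, used only for bounded intervals A (grid intervals and their images
   under a homeomorphism). *)
Definition len (R : realType) (A : set R) : R := sup A - inf A.

Definition endpoints (R : realType) (A : set R) : set R := [set inf A; sup A].

(* Maps defined on an interval are represented by total functions of which
   only the values on that interval matter. *)
Definition homeo (R : realType) (I J : set R) (h : R -> R) : Prop :=
  exists g : R -> R,
    [/\ {within I, continuous h} /\ {within J, continuous g},
        h @` I `<=` J /\ g @` J `<=` I,
        forall x, I x -> g (h x) = x
      & forall y, J y -> h (g y) = y].

(* G n b is the b-th interval of level n, for 1 <= n and 1 <= b <= Omega n;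
   the other values of G are irrelevant. *)
Record BM_grid (R : realType) (B M : R) (I : set R) (Omega : nat -> nat)
    (G : nat -> nat -> set R) : Prop := {
  grid_itv : forall n b, (1 <= n)%N -> (1 <= b <= Omega n)%N ->
    closed_itv (G n b);
  grid_cover : forall n, (1 <= n)%N ->
    \bigcup_(b in [set b | (1 <= b <= Omega n)%N]) G n b = I;
  grid_disjoint : forall n b c, (1 <= n)%N ->
    (1 <= b <= Omega n)%N -> (1 <= c <= Omega n)%N -> b <> c ->
    (G n b)^° `&` (G n c)^° = set0;
  grid_adjacent : forall n b, (1 <= n)%N -> (1 <= b < Omega n)%N ->
    exists x, [/\ G n b `&` G n b.+1 = [set x],
      endpoints (G n b) x & endpoints (G n b.+1) x];
  grid_endpoints : forall n b x, (1 <= n)%N -> (1 <= b <= Omega n)%N ->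
    endpoints (G n b) x ->
    exists2 c, (1 <= c <= Omega n.+1)%N & endpoints (G n.+1 c) x;
  grid_ratio : forall n b, (1 <= n)%N -> (1 <= b < Omega n)%N ->
    B^-1 <= len (G n b.+1) / len (G n b) <= B;
  grid_children : forall n b, (1 <= n)%N -> (1 <= b <= Omega n)%N ->
    let k := count (fun c => `[< G n.+1 c `<=` G n b >])
                   (iota 1 (Omega n.+1)) in
    (2 <= k)%N /\ k%:R <= M
}.

Definition is_grid (R : realType) (I : set R) (Omega : nat -> nat)
    (G : nat -> nat -> set R) : Prop :=
  exists B M : R, [/\ 1 <= B, 1 < M & BM_grid B M I Omega G].

Definition lrd (R : realType) (h : R -> R) (A A' : set R) : R :=
  ln ((len A / len A') * (len (h @` A') / len (h @` A))).

Definition cr (R : realType) (A A' A'' : set R) : R :=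
  ln (1 + (len A' / len A) * ((len A + len A' + len A'') / len A'')).

Definition crd (R : realType) (h : R -> R) (A A' A'' : set R) : R :=
  cr (h @` A) (h @` A') (h @` A'') - cr A A' A''.

Definition grid_len (R : realType) (G : nat -> nat -> set R) (n b : nat) : R :=
  len (G n b).

Definition grid_lrd (R : realType) (h : R -> R) (G : nat -> nat -> set R)
    (n b : nat) : R := lrd h (G n b) (G n b.+1).

Definition grid_crd (R : realType) (h : R -> R) (G : nat -> nat -> set R)
    (n b : nat) : R := crd h (G n b) (G n b.+1) (G n b.+2).

Definition pairs (Omega : nat -> nat) (n b : nat) : Prop :=
  (1 <= n)%N /\ (1 <= b < Omega n)%N.

(* 1 <= b < Omega n - 1, written without truncated subtraction. *)
Definition triples (Omega : nat -> nat) (n b : nat) : Prop :=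
  (1 <= n)%N /\ (1 <= b)%N /\ (b.+1 < Omega n)%N.

Definition modulus (R : realType) (e : R -> R) : Prop :=
  [/\ {within `[0, +oo[%classic, continuous e}, forall t, 0 <= t -> 0 <= e t
    & e 0 = 0].

(* phi <= O(psi) over the indices in D *)
Definition le_O (R : realType) (D : nat -> nat -> Prop)
    (phi psi : nat -> nat -> R) : Prop :=
  exists c : R, forall n b, D n b -> `|phi n b| <= c * `|psi n b|.

(* phi <= o(psi) over the indices in D *)
Definition le_o (R : realType) (D : nat -> nat -> Prop)
    (phi psi : nat -> nat -> R) : Prop :=
  exists2 e : R -> R, modulus e
    & forall n b, D n b -> `|phi n b| <= e `|psi n b| * `|psi n b|.

(* phi <= o(psi) psi^-1 over the indices in D *)
Definition le_o_div (R : realType) (D : nat -> nat -> Prop)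
    (phi psi : nat -> nat -> R) : Prop :=
  exists2 e : R -> R, modulus e
    & forall n b, D n b -> `|phi n b| <= e `|psi n b|.

Definition three_point_log (R : realType) (h : R -> R) (x d1 d2 : R) : R :=
  ln ((h (x + d2) - h x) / (h x - h (x - d1)) * (d1 / d2)).

Definition quasisymmetric (R : realType) (I : set R) (h : R -> R) : Prop :=
  forall d : R, 1 <= d -> exists2 k : R, 1 <= k &
    forall x d1 d2, I (x - d1) -> I x -> I (x + d2) -> 0 < d1 -> 0 < d2 ->
      d^-1 <= d2 / d1 <= d -> `|three_point_log h x d1 d2| <= ln k.

Definition uaa (R : realType) (I : set R) (h : R -> R) : Prop :=
  forall d : R, 1 <= d -> exists2 e : R -> R, modulus e &
    forall x d1 d2, I (x - d1) -> I x -> I (x + d2) -> 0 < d1 -> 0 < d2 ->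
      d^-1 < d2 / d1 < d -> `|three_point_log h x d1 d2| <= e (d1 + d2).

(* Derivatives are taken relative to the interval I, hence are one-sided at
   its endpoints. *)
Definition diff_quotient (R : realType) (h : R -> R) (x y : R) : R :=
  (h y - h x) / (y - x).

Definition derivable_in (R : realType) (I : set R) (h : R -> R) (x : R) : Prop :=
  cvg (diff_quotient h x @ within I x^').

Definition derive_in (R : realType) (I : set R) (h : R -> R) (x : R) : R :=
  lim (diff_quotient h x @ within I x^').

Definition derive_neq0 (R : realType) (I : set R) (h : R -> R) : Prop :=
  forall x, I x -> derivable_in I h x /\ derive_in I h x <> 0.

Definition holder_on (R : realType) (alpha : R) (I : set R) (f : R -> R) : Prop :=
  exists c : R, forall x y, I x -> I y -> `|f x - f y| <= c * `|x - y| `^ alpha.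

Definition C1_holder (R : realType) (alpha : R) (I : set R) (h : R -> R) : Prop :=
  (forall x, I x -> derivable_in I h x) /\ holder_on alpha I (derive_in I h).

Definition C1_lipschitz (R : realType) (I : set R) (h : R -> R) : Prop :=
  (forall x, I x -> derivable_in I h x) /\
  [lipschitz derive_in I h x | x in I].

Definition C2_holder (R : realType) (alpha : R) (I : set R) (h : R -> R) : Prop :=
  [/\ forall x, I x -> derivable_in I h x,
      forall x, I x -> derivable_in I (derive_in I h) x
    & holder_on alpha I (derive_in I (derive_in I h))].

Definition C2_lipschitz (R : realType) (I : set R) (h : R -> R) : Prop :=
  [/\ forall x, I x -> derivable_in I h x,
      forall x, I x -> derivable_in I (derive_in I h) x
    & [lipschitz derive_in I (derive_in I h) x | x in I]].

Definition affine_on (R : realType) (I : set R) (h : R -> R) : Prop :=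
  exists p q : R, forall x, I x -> h x = p * x + q.

Definition on_interior_itvs (R : realType) (I : set R) (P : set R -> Prop) : Prop :=
  forall K : set R, closed_itv K -> K `<=` I^° -> P K.

(* Main.v *)
Require Import Defs.
From HB Require Import structures.
From mathcomp Require Import all_boot all_order all_algebra.
From mathcomp Require Import all_classical all_reals all_analysis.
From mathcomp Require Import zify ring lra.
Set Implicit Arguments.
Unset Strict Implicit.
Unset Printing Implicit Defensive.
Import Order.TTheory GRing.Theory Num.Theory.
Import numFieldNormedType.Exports.
Local Open Scope classical_set_scope.
Local Open Scope ring_scope.

(** Everything is read off from the cells of the grid and from the slopes of [h]
    on them. A node is a pair of adjacent cells of one level; its ratio
    distortion [lr] is the logarithm of the quotient of the two slopes, hence
    about [w / 2] times the logarithmic derivative of the derivative of [h],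
    where [w] is the total length of the pair. Three consecutive cells carry the
    cross-ratio distortion [cd]. A level of the grid is first listed from left
    to right; a decreasing [h] is replaced by [- h].

    Smoothness gives the bounds by the mean value theorem. The bound on [cd], which is
    at most the sum of two ratio distortions ([cd_le_lr]), gains one order when
    [h] is twice differentiable, since the first-order terms of the secants cancel
    ([cd_of_C2]).

    From [lr] to smoothness: the logarithms of the slopes of cells form a
    function on the tree of nodes whose oscillation from a node to its children
    is controlled by [lr]. As lengths shrink by a fixed factor from each level to
    the next, a Holder bound on this oscillation sums up to a Holder bound on the
    slopes inside an arbitrary interval ([node_osc], [slopes_holder]), so that the
    secants of [h] converge to a Holder derivative that is bounded away from 0
    ([secant_holder_deriv]). If only bounds, or bounds tending to 0, are known,
    two adjacent intervals of comparable length are instead approximated by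
    unions of a bounded number of cells ([three_point_bound]).

    From [cd] to [lr]: cross-ratios are invariant under Mobius maps, and sending
    an endpoint to infinity turns small cross-ratio distortion into slowly
    varying slopes. So inside a node whose finer cells have [cd] at most [eps],
    the map [h] follows a Mobius map up to [O(eps)], and the ratio distortion of a
    child is determined by that of its parent ([mobius_slope_ratio]): it shrinks
    at the rate of the lengths, with an error [O(eps)] ([child_excess]). Iterating
    this over the levels,
    - if [cd] tends to 0, so does [lr] ([node_lr_small]);
    - if [cd = O(w^g)] with [g < 1], then [lr = O(w^g)] ([node_lr_holder]); for
      [g = 1] the two rates are equal and the sum diverges, which is the
      Zygmund case;
    - if [cd = O(w^(1 + a))], then [lr = O(w)], and the quotient [lr / w] changes
      by [O(w^a)] from a node to its children; its limit is half of the
      logarithmic derivative of [h'], which is thus Holder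
      ([node_lr_lipschitz], [node_curvature_holder],
      [secant_holder_of_curvature]).

    All these estimates reach the ends of [I], so the derivative exists and does
    not vanish on all of [I]. A mere bound on [cd] only bounds the slope of a
    cell by those of its two neighbours ([middle_slope]). This leaves the slopes
    of the first and the last cell of a level unbounded, but suffices away from
    the ends. *)

(** * Tactics for long contexts *)

(** [lia] and [lra] translate every hypothesis in sight and unfold local definitions.
    In the long arguments below, first removing what cannot bear on the goal saves
    most of their time. *)
Ltac index_lia := solve [
  repeat match goal with H : ?T |- _ =>
    lazymatch T with
    | nat => fail
    | is_true (leq _ _) => fail
    | is_true (leq _ _ && leq _ _) => fail
    | is_true (negb _) => fail
    | @eq ?A _ _ => tryif unify A nat then fail else clear H
    | not _ => fail
    | _ \/ _ => fail
    | _ => clear H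
    end
  end; lia].

Ltac order_lra :=
  repeat match goal with x := _ : ?T |- _ =>
    lazymatch type of T with Prop => fail | _ => clearbody x end
  end;
  repeat match goal with H : ?T |- _ =>
    lazymatch type of T with
    | Prop =>
      lazymatch T with
      | is_true (Order.le _ _) => fail
      | is_true (Order.lt _ _) => fail
      | is_true (andb (Order.le _ _) _) => fail
      | is_true (andb (Order.lt _ _) _) => fail
      | _ /\ _ => fail
      | @eq nat _ _ => clear H
      | @eq _ _ _ => fail
      | _ => clear H
      end
    | _ => fail
    end
  end; lra.

(** * Multiplicative closeness and slopes *)

Section Close.
Context {R : realType}.
Implicit Types (a b c s t u v eta : R).

(** This is [|ln s - ln t| <= eta] ([logcloseW]), written without logarithms because
    the two inequalities are compatible with sums as well as with products. *)
Definition logclose eta s t := s <= expR eta * t /\ t <= expR eta * s.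

Lemma logclose_refl eta s : 0 <= eta -> 0 <= s -> logclose eta s s.
Proof.
by move=> e0 s0; split; rewrite ler_peMl// -[leLHS]expR0 ler_expR.
Qed.

Lemma logclose_sym eta s t : logclose eta s t -> logclose eta t s.
Proof. by case. Qed.

Lemma logclose_trans a b s t u : logclose a s t -> logclose b t u -> logclose (a + b) s u.
Proof.
move=> [st ts] [tu ut]; split; rewrite expRD.
  by rewrite -mulrA (le_trans st)// ler_wpM2l// expR_ge0.
by rewrite [expR a * _]mulrC -mulrA (le_trans ut)// ler_wpM2l// expR_ge0.
Qed.

Lemma logclose_le a b s t : a <= b -> 0 <= s -> 0 <= t -> logclose a s t -> logclose b s t.
Proof.
move=> ab s0 t0 [st ts]; split.
  by rewrite (le_trans st)// ler_wpM2r// ler_expR.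
by rewrite (le_trans ts)// ler_wpM2r// ler_expR.
Qed.

Lemma logcloseM a b s t u v : 0 <= s -> 0 <= t -> 0 <= u -> 0 <= v ->
  logclose a s t -> logclose b u v -> logclose (a + b) (s * u) (t * v).
Proof.
move=> s0 t0 u0 v0 [st ts] [uv vu]; split; rewrite expRD mulrACA; exact: ler_pM.
Qed.

Lemma logcloseV a s t : 0 < s -> 0 < t -> logclose a s t -> logclose a s^-1 t^-1.
Proof.
move=> s0 t0 [st ts]; split.
  by rewrite -[leLHS]mul1r ler_pdivrMr// mulrAC ler_pdivlMr// mul1r.
by rewrite -[leLHS]mul1r ler_pdivrMr// mulrAC ler_pdivlMr// mul1r.
Qed.

Lemma logcloseMl a s t u : 0 <= u -> logclose a s t -> logclose a (u * s) (u * t).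
Proof.
by move=> u0 [st ts]; split; rewrite mulrCA ler_wpM2l.
Qed.

Lemma logcloseD a s t u v : logclose a s t -> logclose a u v -> logclose a (s + u) (t + v).
Proof.
by move=> [st ts] [uv vu]; split; rewrite mulrDr lerD.
Qed.

Lemma logcloseW a s t : 0 < s -> 0 < t -> logclose a s t <-> `|ln s - ln t| <= a.
Proof.
move=> s0 t0; rewrite /logclose.
have H (x y : R) : 0 < x -> 0 < y -> (x <= expR a * y) = (ln x - ln y <= a).
  move=> x0 y0.
  rewrite -ler_pdivrMr// -[X in X / _](lnK (x := x)) ?posrE//.
  by rewrite -[X in _ / X](lnK (x := y)) ?posrE// -expRB ler_expR.
rewrite H// H// ler_norml; split.
  by move=> [h1 h2]; apply/andP; split => //; lra.
by move=> /andP[h1 h2]; split; lra.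
Qed.

Lemma ln_ratio_le s t m : 0 < m -> m <= s -> m <= t ->
  `|ln (s / t)| <= `|s - t| / m.
Proof.
move=> m0 ms mt; have s0 : 0 < s by lra. have t0 : 0 < t by lra.
have H (x y : R) : m <= x -> m <= y -> ln (x / y) <= `|x - y| / m.
  move=> mx my; have y0 : 0 < y by lra. have x0 : 0 < x by lra.
  have -> : x / y = 1 + (x - y) / y by rewrite mulrBl divff ?gt_eqF//; ring.
  apply: (@le_trans _ _ ((x - y) / y)).
    apply: le_ln1Dx; rewrite mulrBl divff ?gt_eqF//.
    by rewrite -subr_gt0 opprK subrK divr_gt0.
  apply: (@le_trans _ _ (`|x - y| / y)).
    by rewrite ler_wpM2r ?ler_norm// invr_ge0 ltW.
  by rewrite ler_wpM2l// lef_pV2 ?posrE.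
rewrite ler_norml; apply/andP; split; last exact: H.
rewrite lerNl -lnV ?posrE ?divr_gt0// invf_div distrC; exact: H.
Qed.

Lemma expR_le1D2x a : 0 <= a -> a <= 2^-1 -> expR a <= 1 + 2 * a.
Proof.
move=> a0 a1.
have h : 1 - a <= expR (- a) by have := expR_ge1Dx (- a).
have e0 := expR_gt0 a.
rewrite expRN in h.
have : (1 - a) * expR a <= 1 by rewrite -ler_pdivlMr// mul1r.
set e := expR a in e0 *; nra.
Qed.

End Close.

Section Slopes.
Context {R : realType}.
Implicit Types (z H : nat -> R).

Definition slope z H i j := (H j - H i) / (z j - z i).

Definition increasing_upto (K : nat) z := forall i, (i < K)%N -> z i < z i.+1.

Lemma inc_le K z : increasing_upto K z ->
  forall i j, (i <= j)%N -> (j <= K)%N -> z i <= z j.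
Proof.
move=> zi i j; elim: j => [|j IH]; first by rewrite leqn0 => /eqP->.
rewrite leq_eqVlt => /predU1P[->//|]; rewrite ltnS => ij jK.
exact: le_trans (IH ij (ltnW jK)) (ltW (zi _ jK)).
Qed.

Lemma inc_lt K z : increasing_upto K z ->
  forall i j, (i < j)%N -> (j <= K)%N -> z i < z j.
Proof.
move=> zi i j ij jK; apply: lt_le_trans (zi i _) _; first exact: leq_trans ij jK.
exact: inc_le zi _ _ ij jK.
Qed.

Lemma slope_gt0 K z H : increasing_upto K z -> increasing_upto K H ->
  forall i j, (i < j)%N -> (j <= K)%N -> 0 < slope z H i j.
Proof.
by move=> zi Hi i j ij jK; rewrite divr_gt0// subr_gt0; [exact: inc_lt Hi _ _ _ _|exact: inc_lt zi _ _ _ _].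
Qed.

Lemma slope_mul K z H : increasing_upto K z ->
  forall i j, (i < j)%N -> (j <= K)%N -> slope z H i j * (z j - z i) = H j - H i.
Proof.
by move=> zi i j ij jK; rewrite divfK// subr_eq0 gt_eqF//; exact: inc_lt zi _ _ _ _.
Qed.

(** The increment over a union of cells is the sum of the increments over them. *)
Lemma increment_between z H (s1 s2 : R) i j : (i <= j)%N ->
  (forall l, (i <= l < j)%N -> z l < z l.+1) ->
  (forall l, (i <= l < j)%N -> s1 <= slope z H l l.+1 <= s2) ->
  s1 * (z j - z i) <= H j - H i <= s2 * (z j - z i).
Proof.
move=> ij zi Hs; elim: j zi Hs ij => [|j IH] zi Hs.
  by rewrite leqn0 => /eqP->; rewrite !subrr !mulr0 lexx.
rewrite leq_eqVlt => /predU1P[->|]; first by rewrite !subrr !mulr0 lexx.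
rewrite ltnS => ij.
have /andP[h1 h2] : s1 * (z j - z i) <= H j - H i <= s2 * (z j - z i).
  by apply: IH => // l /andP[il lj]; [apply: zi|apply: Hs]; rewrite il ltnW.
have zj : z j < z j.+1 by apply: zi; rewrite ij /=.
have := Hs j; rewrite ij ltnSn => /(_ isT)/andP[].
rewrite ler_pdivlMr ?subr_gt0// ler_pdivrMr ?subr_gt0// => h3 h4.
by apply/andP; split; nra.
Qed.

Lemma slope_between K z H (s1 s2 : R) i j : increasing_upto K z ->
  (i < j)%N -> (j <= K)%N ->
  (forall l, (i <= l < j)%N -> s1 <= slope z H l l.+1 <= s2) ->
  s1 <= slope z H i j <= s2.
Proof.
move=> zi ij jK Hs.
have zij := inc_lt zi ij jK.
rewrite [slope z H i j]/slope ler_pdivlMr ?subr_gt0// ler_pdivrMr ?subr_gt0//.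
apply: increment_between => //; first exact: ltnW.
by move=> l /andP[_ lj]; apply: zi; exact: leq_trans lj jK.
Qed.

(** Slopes of consecutive cells drift by at most a factor [expR rho] per step,
    and the slope of a union of cells lies between those of its cells. *)
Lemma slopes_logclose K z H (rho : R) :
  increasing_upto K z -> increasing_upto K H -> 0 <= rho ->
  (forall l, (l.+1 < K)%N ->
    logclose rho (slope z H l l.+1) (slope z H l.+1 l.+2)) ->
  forall i j i' j', (i < j <= K)%N -> (i' < j' <= K)%N ->
    logclose (K%:R * rho) (slope z H i j) (slope z H i' j').
Proof.
move=> zi Hi rho0 Hr.
have sl0 := slope_gt0 zi Hi.
have drift l d : (l + d < K)%N ->
    logclose (d%:R * rho) (slope z H l l.+1) (slope z H (l + d) (l + d).+1).
  elim: d => [|d IH] ldK.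
    by rewrite addn0 mul0r; apply: logclose_refl => //; apply/ltW/sl0 => //; lia.
  rewrite -addn1 natrD mulrDl mul1r addn1 !addnS.
  by apply: logclose_trans (IH _) (Hr _ _); lia.
have cells l l' : (l < K)%N -> (l' < K)%N ->
    logclose (K%:R * rho) (slope z H l l.+1) (slope z H l' l'.+1).
  move=> lK l'K.
  wlog ll' : l l' lK l'K / (l <= l')%N.
    by move=> W; case: (leqP l l') => h; [exact: W|apply/logclose_sym/W => //; exact: ltnW].
  have := drift l (l' - l)%N; rewrite subnKC// => /(_ l'K).
  apply: logclose_le; rewrite ?ler_wpM2r ?ler_nat//; first by lia.
    by apply/ltW/sl0.
  by apply/ltW/sl0.
have halfs i j (t e : R) : (i < j <= K)%N -> 0 < e ->
    (forall l, (i <= l < j)%N -> slope z H l l.+1 <= e * t /\ t <= e * slope z H l l.+1) ->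
    slope z H i j <= e * t /\ t <= e * slope z H i j.
  move=> /andP[ij jK] e0 Hl.
  have /andP[h1 h2] : t / e <= slope z H i j <= e * t.
    apply: (slope_between zi ij jK) => l /Hl[h1 h2].
    by rewrite h1 andbT ler_pdivrMr// mulrC.
  by split=> //; rewrite mulrC -ler_pdivrMr.
move=> i j i' j' hij hij'.
apply: (halfs) => //; first exact: expR_gt0.
move=> l hl; apply: logclose_sym.
apply: (halfs) => //; first exact: expR_gt0.
by move=> l' hl'; apply: cells; lia.
Qed.

End Slopes.

(** * Cross-ratios and inversion *)

Section Inversion.
Context {R : realType}.
Implicit Types (z H : nat -> R) (a b c t eta eps : R).

(** In the notation of cross-ratios this is the distortion by [z l |-> H l] of the
    cross-ratio of four consecutive points: with cells of lengths [a], [b], [c], the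
    argument of the logarithm in the cross-ratio is [(a + b) (b + c) / (a c)]. *)
Definition cross z H l :=
  ln (slope z H l l.+2 * slope z H l.+1 l.+3 /
      (slope z H l l.+1 * slope z H l.+2 l.+3)).

Lemma slope_split K z H : increasing_upto K z ->
  forall i j k, (i < j)%N -> (j < k)%N -> (k <= K)%N ->
  slope z H i k * (z k - z i) =
  slope z H i j * (z j - z i) + slope z H j k * (z k - z j).
Proof.
move=> zi i j k ij jk kK; rewrite !(slope_mul H zi)//; try lia.
by ring.
Qed.

(** A slope is recovered from an average in which its weight [b] is not negligible
    against [c]. *)
Lemma avg_logclose b c t2 t3 d kap : 0 < b -> 0 < c -> 0 < t2 -> 0 < t3 ->
  0 <= kap -> c <= kap * b -> 0 <= d -> 4 * (1 + kap) * d <= 1 ->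
  logclose d (b * t2 + c * t3) ((b + c) * t3) -> logclose (4 * (1 + kap) * d) t2 t3.
Proof.
move=> b0 c0 t20 t30 k0 cb d0 dk [h1 h2].
have d2 : d <= 2^-1 by nra.
have e1 : 1 <= expR d by rewrite -[leLHS]expR0 ler_expR.
have e2 := expR_le1D2x d0 d2.
set e := expR d in h1 h2 e1 e2.
have E : 1 + 4 * (1 + kap) * d <= expR (4 * (1 + kap) * d) := expR_ge1Dx _.
have kd : 0 <= kap * d by exact: mulr_ge0.
split.
  apply: (@le_trans _ _ ((1 + 4 * (1 + kap) * d) * t3)); last by rewrite ler_pM2r.
  rewrite -(ler_pM2l b0).
  have : b * t2 <= (b * e + c * (e - 1)) * t3 by lra.
  move=> /le_trans; apply; rewrite mulrA ler_pM2r//.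
  have : c * (e - 1) <= kap * b * (e - 1) by rewrite ler_wpM2r// subr_ge0.
  have : kap * b * (e - 1) <= kap * b * (2 * d).
    by apply: ler_wpM2l; [rewrite mulr_ge0// ltW | lra].
  have : b * e <= b * (1 + 2 * d) by rewrite ler_pM2l.
  have : 0 <= b * (kap * d) by rewrite mulr_ge0// ltW.
  have : 0 <= b * d by rewrite mulr_ge0// ltW.
  by nra.
apply: (@le_trans _ _ ((1 + 4 * (1 + kap) * d) * t2)); last by rewrite ler_pM2r.
have {h2} : (b - c * (e - 1)) * t3 <= b * e * t2 by lra.
have cc : c * (e - 1) <= b * (kap * (2 * d)).
  apply: (@le_trans _ _ (kap * b * (e - 1))).
    by rewrite ler_wpM2r// subr_ge0.
  by rewrite [kap * b]mulrC -mulrA ler_pM2l// ler_wpM2l//; lra.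
have h3 : (b - b * (kap * (2 * d))) * t3 <= (b - c * (e - 1)) * t3.
  by rewrite ler_pM2r//; lra.
move=> /(le_trans h3) h4.
have h5 : (1 - kap * (2 * d)) * t3 <= (1 + 2 * d) * t2.
  apply: (@le_trans _ _ (e * t2)); last by apply: ler_wpM2r => //; exact: ltW.
  by rewrite -(ler_pM2l b0); lra.
set x := kap * d in kd.
have x4 : x <= 4^-1 by rewrite /x; lra.
rewrite -(ler_pM2l (_ : 0 < 1 - kap * (2 * d))); last by rewrite mulrCA -/x; lra.
apply: (le_trans h5); rewrite [leRHS]mulrA ler_pM2r// mulrCA -/x.
have -> : 4 * (1 + kap) * d = 4 * d + 4 * x by rewrite /x; ring.
have : x * d <= 4^-1 * d by rewrite ler_wpM2r.
have : x * x <= 4^-1 * x by rewrite ler_wpM2r.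
by lra.
Qed.

Lemma logclose_avg a b t1 t2 eta : 0 < a -> 0 < b -> 0 < t1 -> 0 <= eta ->
  logclose eta t1 t2 -> logclose eta (a * t1 + b * t2) ((a + b) * t1).
Proof.
move=> a0 b0 t10 e0 /logclose_sym tt; rewrite mulrDl; apply: logcloseD.
  by apply: logcloseMl; [exact: ltW|exact/logclose_refl/ltW].
by apply: logcloseMl => //; exact: ltW.
Qed.

Lemma logclose_cancel a t1 t2 u : 0 < u -> logclose a (u * t1) (u * t2) -> logclose a t1 t2.
Proof.
by move=> u0 [h1 h2]; split; rewrite -(ler_pM2l u0) mulrCA.
Qed.

(** Slopes [t1], [t2], [t3] on three consecutive cells: a small cross-ratio
    distortion carries the closeness of the first two slopes over to the last
    two, with a loss by a constant factor. *)
Lemma cross_step a b c t1 t2 t3 eta eps kap :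
  0 < a -> 0 < b -> 0 < c -> 0 < t1 -> 0 < t2 -> 0 < t3 ->
  0 <= kap -> c <= kap * b -> 0 <= eta -> 0 <= eps ->
  4 * (1 + kap) * (eta + eps) <= 1 ->
  logclose eta t1 t2 ->
  logclose eps ((a * t1 + b * t2) * (b * t2 + c * t3))
            (((a + b) * t1) * ((b + c) * t3)) ->
  logclose (4 * (1 + kap) * (eta + eps)) t2 t3.
Proof.
move=> a0 b0 c0 t10 t20 t30 k0 cb e0 p0 small tt cr.
apply: (avg_logclose (b := b) (c := c)) => //; first exact: addr_ge0.
apply: (@logclose_cancel _ _ _ ((a + b) * t1)); first by rewrite mulr_gt0// addr_gt0.
apply: logclose_trans cr.
rewrite ![_ * (b * t2 + _)]mulrC; apply: logcloseMl.
  by rewrite addr_ge0// mulr_ge0// ltW.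
by apply/logclose_sym/logclose_avg.
Qed.

Lemma logclose_cross K z H : increasing_upto K z -> increasing_upto K H ->
  forall l eps, (l.+3 <= K)%N -> `|cross z H l| <= eps ->
  logclose eps (slope z H l l.+2 * slope z H l.+1 l.+3)
            (slope z H l l.+1 * slope z H l.+2 l.+3).
Proof.
move=> zi Hi l eps lK; have s0 := slope_gt0 zi Hi.
have p1 : 0 < slope z H l l.+2 * slope z H l.+1 l.+3 by rewrite mulr_gt0// s0//; lia.
have p2 : 0 < slope z H l l.+1 * slope z H l.+2 l.+3 by rewrite mulr_gt0// s0//; lia.
by rewrite /cross ln_div ?posrE// logcloseW.
Qed.

(** The inversion that sends [z 0] to infinity. *)
Definition at_infty z : nat -> R := fun j => - (z j.+1 - z 0%N)^-1.

Lemma at_infty_inc K z : increasing_upto K z -> increasing_upto K.-1 (at_infty z).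
Proof.
move=> zi i iK; rewrite /at_infty ltrN2 ltf_pV2 ?posrE ?subr_gt0.
- by rewrite ltrD2r; apply: zi; lia.
- by apply: (inc_lt zi) => //; lia.
- by apply: (inc_lt zi) => //; lia.
Qed.

(** Quotients of products of these slopes in which every index occurs equally
    often above and below do not see the denominators: this is the Mobius
    invariance of the cross-ratio. *)
Lemma slope_at_infty K z H : increasing_upto K z -> increasing_upto K H ->
  forall i j, (i < j)%N -> (j < K)%N ->
  slope (at_infty z) (at_infty H) i j =
  slope z H i.+1 j.+1 / (slope z H 0 i.+1 * slope z H 0 j.+1).
Proof.
move=> zi Hi i j ij jK; rewrite /slope /at_infty.
have z1 : z 0%N < z i.+1 by apply: (inc_lt zi) => //; lia.
have z2 : z i.+1 < z j.+1 by apply: (inc_lt zi) => //; lia.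
have H1 : H 0%N < H i.+1 by apply: (inc_lt Hi) => //; lia.
have H2 : H i.+1 < H j.+1 by apply: (inc_lt Hi) => //; lia.
move: (z 0%N) (z i.+1) (z j.+1) (H 0%N) (H i.+1) (H j.+1) z1 z2 H1 H2 => z0 zI zJ h0 hI hJ *.
have e1 : zI - z0 != 0 by rewrite subr_eq0 gt_eqF.
have e2 : zJ - z0 != 0 by rewrite subr_eq0 gt_eqF// (lt_trans _ (_ : zI < zJ)).
have e3 : hI - h0 != 0 by rewrite subr_eq0 gt_eqF.
have e4 : hJ - h0 != 0 by rewrite subr_eq0 gt_eqF// (lt_trans _ (_ : hI < hJ)).
have e5 : zJ - zI != 0 by rewrite subr_eq0 gt_eqF.
have -> : - (hJ - h0)^-1 - - (hI - h0)^-1 = (hJ - hI) / ((hI - h0) * (hJ - h0)).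
  by field; rewrite e3 e4.
have -> : - (zJ - z0)^-1 - - (zI - z0)^-1 = (zJ - zI) / ((zI - z0) * (zJ - z0)).
  by field; rewrite e1 e2.
by field; rewrite e1 e2 e3 e4 e5.
Qed.

End Inversion.

Section Shadow.
Context {R : realType}.
Implicit Types (z H : nat -> R) (B eps : R).

Definition ratio_upto B K z := forall l, (l.+2 <= K)%N ->
  z l.+2 - z l.+1 <= B * (z l.+1 - z l) /\ z l.+1 - z l <= B * (z l.+2 - z l.+1).

Lemma at_infty_ratio B K z : 0 <= B -> increasing_upto K z -> ratio_upto B K z ->
  forall j, (j.+2 < K)%N ->
  at_infty z j.+2 - at_infty z j.+1 <= B * (at_infty z j.+1 - at_infty z j).
Proof.
move=> B0 zi zB j jK; rewrite /at_infty.
have z1 : z 0%N < z j.+1 by apply: (inc_lt zi) => //; index_lia.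
have z2 : z j.+1 < z j.+2 by apply: (inc_lt zi) => //; index_lia.
have z3 : z j.+2 < z j.+3 by apply: (inc_lt zi) => //; index_lia.
have [zb _] := zB j.+1 jK.
move: (z 0%N) (z j.+1) (z j.+2) (z j.+3) z1 z2 z3 zb => z0 a b c za ab bc h.
have e1 : 0 < a - z0 by rewrite subr_gt0.
have e2 : 0 < b - z0 by lra.
have e3 : 0 < c - z0 by lra.
have -> : - (c - z0)^-1 - - (b - z0)^-1 = (c - b) / ((b - z0) * (c - z0)).
  by field; rewrite !gt_eqF.
have -> : - (b - z0)^-1 - - (a - z0)^-1 = (b - a) / ((a - z0) * (b - z0)).
  by field; rewrite !gt_eqF.
rewrite mulrA; apply: ler_pM => //; first by lra.
  by rewrite invr_ge0 mulr_ge0// ltW.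
by rewrite lef_pV2 ?posrE ?mulr_gt0// mulrC ler_pM2l//; lra.
Qed.

(** With [z 0] at infinity the cross-ratio of the first four points is a plain
    ratio of lengths, so its distortion compares the first two inverted slopes;
    by Mobius invariance the other cross-ratios then carry this closeness from
    each pair of slopes to the next ([cross_step]). The number of points is
    bounded, so the growing constants do no harm. *)
Lemma at_infty_slopes_logclose B K z H eps : 1 <= B -> increasing_upto K z ->
  increasing_upto K H -> ratio_upto B K z -> 0 <= eps ->
  (8 * (1 + B)) ^+ K.+1 * eps <= 1 ->
  (forall l, (l.+3 <= K)%N -> `|cross z H l| <= eps) ->
  forall j, (j.+2 < K)%N -> logclose ((8 * (1 + B)) ^+ j.+1 * eps)
    (slope (at_infty z) (at_infty H) j j.+1)
    (slope (at_infty z) (at_infty H) j.+1 j.+2).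
Proof.
move=> B1 zi Hi zB e0 small cr.
set v := at_infty z; set V := at_infty H; set A := 8 * (1 + B).
have vi : increasing_upto K.-1 v by exact: at_infty_inc.
have Vi : increasing_upto K.-1 V by exact: at_infty_inc.
have s0 := slope_gt0 zi Hi; have t0 := slope_gt0 vi Vi.
have A1 : 1 <= A by rewrite /A; lra.
have Ap j : 1 <= A ^+ j by exact: exprn_ege1.
have smallj j : (j <= K.+1)%N -> A ^+ j * eps <= 1.
  by move=> jK; apply: le_trans small; rewrite ler_wpM2r// ler_weXn2l.
have bb j : (j.+2 < K)%N -> v j.+2 - v j.+1 <= B * (v j.+1 - v j).
  by apply: at_infty_ratio => //; lra.
have vg j : (j.+1 < K)%N -> 0 < v j.+1 - v j by move=> jK; rewrite subr_gt0 vi//; index_lia.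
have tg j : (j.+1 < K)%N -> 0 < slope v V j j.+1 by move=> jK; apply: t0; index_lia.
elim=> [|j IH] jK.
  have H1 : logclose eps ((v 1%N - v 0%N) * slope v V 0 1 + (v 2%N - v 1%N) * slope v V 1 2)
      (((v 1%N - v 0%N) + (v 2%N - v 1%N)) * slope v V 1 2).
    have := logclose_cross zi Hi jK (cr _ jK).
    have -> : (v 1%N - v 0%N) * slope v V 0 1 + (v 2%N - v 1%N) * slope v V 1 2 =
       (v 2%N - v 0%N) * slope v V 0 2.
      by rewrite [RHS]mulrC (slope_split V vi (j := 1%N))//; [ring|index_lia].
    have -> : v 1%N - v 0%N + (v 2%N - v 1%N) = v 2%N - v 0%N by ring.
    move=> H2; apply: logcloseMl; first by rewrite subr_ge0 (inc_le vi)//; index_lia.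
    rewrite /v /V !(slope_at_infty zi Hi)//; try index_lia.
    have p i : (0 < i)%N -> (i <= K)%N -> 0 < slope z H 0 i by exact: s0.
    have p1 := p 1%N isT ltac:(index_lia); have p2 := p 2%N isT ltac:(index_lia).
    have p3 := p 3%N isT ltac:(index_lia).
    move: (slope z H 0 1) (slope z H 0 2) (slope z H 0 3) p1 p2 p3 H2
      => q1 q2 q3 p1 p2 p3 H2.
    have q0 : 0 <= (q1 * q2 * q3)^-1 by rewrite invr_ge0 !mulr_ge0// ltW.
    have -> : slope z H 1 3 / (q1 * q3) = (q1 * q2 * q3)^-1 * (q2 * slope z H 1 3).
      by field; rewrite !gt_eqF.
    have -> : slope z H 2 3 / (q2 * q3) = (q1 * q2 * q3)^-1 * (q1 * slope z H 2 3).
      by field; rewrite !gt_eqF.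
    exact: logcloseMl H2.
  have sm := smallj 1%N isT; rewrite expr1 in sm *.
  apply: (@logclose_le _ (4 * (1 + B) * eps)).
  - by rewrite ler_wpM2r// /A; lra.
  - by apply/ltW/tg; index_lia.
  - by apply/ltW/tg; index_lia.
  apply: (@avg_logclose _ (v 1%N - v 0%N) (v 2%N - v 1%N)) => //.
  - by apply: vg; index_lia.
  - by apply: vg; index_lia.
  - by apply: tg; index_lia.
  - by apply: tg; index_lia.
  - by lra.
  - exact: bb.
  - by apply: le_trans sm; rewrite ler_wpM2r// /A; lra.
have {}IH := IH (ltnW jK).
have sm := smallj j.+2 (ltac:(index_lia)).
have Aeps : eps <= A ^+ j.+1 * eps by rewrite ler_peMl.
have const : 4 * (1 + B) * (A ^+ j.+1 * eps + eps) <= A ^+ j.+2 * eps.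
  rewrite [A ^+ j.+2]exprS -mulrA {2}/A.
  have := ler_wpM2l (_ : 0 <= 4 * (1 + B)) Aeps.
  by move=> /(_ ltac:(lra)); lra.
apply: (@logclose_le _ (4 * (1 + B) * (A ^+ j.+1 * eps + eps))) => //.
  by apply/ltW/tg; index_lia.
  by apply/ltW/tg; index_lia.
apply: (@cross_step _ (v j.+1 - v j) (v j.+2 - v j.+1) (v j.+3 - v j.+2)
   (slope v V j j.+1)) => //.
- by apply: vg; index_lia.
- by apply: vg; index_lia.
- by apply: vg; index_lia.
- by apply: tg; index_lia.
- by apply: tg; index_lia.
- by apply: tg; index_lia.
- by lra.
- exact: bb.
- by rewrite mulr_ge0// exprn_ge0//; lra.
- exact: le_trans const sm.
have := logclose_cross zi Hi jK (cr _ jK).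
have -> : (v j.+1 - v j) * slope v V j j.+1 + (v j.+2 - v j.+1) * slope v V j.+1 j.+2 =
   (v j.+2 - v j) * slope v V j j.+2.
  by rewrite [RHS]mulrC (slope_split V vi (j := j.+1))//; [ring|index_lia].
have -> : (v j.+2 - v j.+1) * slope v V j.+1 j.+2 + (v j.+3 - v j.+2) * slope v V j.+2 j.+3 =
   (v j.+3 - v j.+1) * slope v V j.+1 j.+3.
  by rewrite [RHS]mulrC (slope_split V vi (j := j.+2))//; [ring|index_lia].
have -> : v j.+1 - v j + (v j.+2 - v j.+1) = v j.+2 - v j by ring.
have -> : v j.+2 - v j.+1 + (v j.+3 - v j.+2) = v j.+3 - v j.+1 by ring.
move=> H2; rewrite mulrACA [X in logclose _ _ X]mulrACA.
apply: logcloseMl; first by rewrite mulr_ge0// subr_ge0 (inc_le vi)//; index_lia.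
rewrite /v /V !(slope_at_infty zi Hi)//; try index_lia.
have p i : (0 < i)%N -> (i <= K)%N -> 0 < slope z H 0 i by exact: s0.
have p1 := p j.+1 isT ltac:(index_lia); have p2 := p j.+2 isT ltac:(index_lia).
have p3 := p j.+3 isT ltac:(index_lia); have p4 := p j.+4 isT ltac:(index_lia).
move: (slope z H 0 j.+1) (slope z H 0 j.+2) (slope z H 0 j.+3) (slope z H 0 j.+4)
  p1 p2 p3 p4 => q1 q2 q3 q4 p1 p2 p3 p4.
have q0 : 0 <= (q1 * q2 * q3 * q4)^-1 by rewrite invr_ge0 !mulr_ge0// ltW.
have -> : slope z H j.+1 j.+3 / (q1 * q3) * (slope z H j.+2 j.+4 / (q2 * q4)) =
  (q1 * q2 * q3 * q4)^-1 * (slope z H j.+1 j.+3 * slope z H j.+2 j.+4).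
  by field; rewrite !gt_eqF.
have -> : slope z H j.+1 j.+2 / (q1 * q2) * (slope z H j.+3 j.+4 / (q3 * q4)) =
  (q1 * q2 * q3 * q4)^-1 * (slope z H j.+1 j.+2 * slope z H j.+3 j.+4).
  by field; rewrite !gt_eqF.
exact: logcloseMl H2.
Qed.

End Shadow.

(** * Small cross-ratio distortion and Mobius maps *)

Section MobiusShadow.
Context {R : realType}.
Implicit Types (z H g : nat -> R) (B eps : R).

(** The map follows a Mobius map, up to [O(eps)]. For a Mobius map [m] and
    [g = m'^(-1/2)], the slope between [u] and [v] is [1 / (g u * g v)], and [g] is
    affine. The inverted slopes are nearly equal to a common value [g 0]; setting
    [g j] to the inverse of the slope from [z 0] to [z j], the first property (up to
    the factor [g 0]) is the formula for inverted slopes, and splitting the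
    increment from [z 0] to [z K] at [z l] gives the second one. *)
Lemma mobius_shadow B K0 : 1 <= B -> exists C e0 : R, [/\ 0 < C, 0 < e0 &
  forall K z H eps, (2 <= K <= K0)%N -> increasing_upto K z ->
    increasing_upto K H -> ratio_upto B K z -> 0 <= eps <= e0 ->
    (forall l, (l.+3 <= K)%N -> `|cross z H l| <= eps) ->
  exists g, [/\ forall j, (j <= K)%N -> 0 < g j,
    forall i j, (i < j <= K)%N ->
      logclose (C * eps) (slope z H i j * (g i * g j)) (g 0) &
    forall l, (l <= K)%N -> logclose (C * eps) (g l * (z K - z 0))
      ((z l - z 0) * g K + (z K - z l) * g 0)]].
Proof.
move=> B1; set A : R := 8 * (1 + B).
have A1 : 1 <= A by rewrite /A; lra.
have Ap j : 1 <= A ^+ j by exact: exprn_ege1.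
have Ap0 j : 0 < A ^+ j by exact: lt_le_trans (Ap j).
exists (K0.+1%:R * A ^+ K0.+1), (A ^+ K0.+1)^-1; split.
- by rewrite mulr_gt0.
- by rewrite invr_gt0.
move=> K z H eps /andP[K2 KK0] zi Hi zB /andP[e0 ee] cr.
have s0 := slope_gt0 zi Hi.
set v := at_infty z; set V := at_infty H.
have vi : increasing_upto K.-1 v by exact: at_infty_inc.
have Vi : increasing_upto K.-1 V by exact: at_infty_inc.
have t0 := slope_gt0 vi Vi.
have small : A ^+ K.+1 * eps <= 1.
  rewrite -(ler_pdivlMl _ _ (Ap0 _)) mulr1; apply: (le_trans ee).
  by rewrite lef_pV2 ?posrE// ler_weXn2l//; index_lia.
have C0 : 0 <= K0.+1%:R * A ^+ K0.+1 * eps by rewrite !mulr_ge0// ltW.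
have tau := at_infty_slopes_logclose B1 zi Hi zB e0 small cr.
have all i j : (i < j <= K.-1)%N ->
    logclose (K0.+1%:R * A ^+ K0.+1 * eps) (slope v V i j) (slope v V 0 1).
  move=> ij.
  apply: (@logclose_le _ (K.-1%:R * (A ^+ K0.+1 * eps))).
  - by rewrite -mulrA ler_wpM2r ?ler_nat ?mulr_ge0//; [exact: ltW|index_lia].
  - by apply/ltW/t0; index_lia.
  - by apply/ltW/t0; index_lia.
  apply: slopes_logclose => //; last by index_lia.
    by rewrite mulr_ge0// ltW.
  move=> l lK; apply: logclose_le (tau l _); last by index_lia.
  - by rewrite ler_wpM2r// ler_weXn2l//; index_lia.
  - by apply/ltW/t0; index_lia.
  - by apply/ltW/t0; index_lia.
set g := fun j => if j == 0%N then slope v V 0 1 else (slope z H 0 j)^-1.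
have g0 j : (j <= K)%N -> 0 < g j.
  by case: j => [|j] jK; rewrite /g/= ?invr_gt0 ?t0 ?s0//; index_lia.
have main i j : (i < j <= K)%N ->
    logclose (K0.+1%:R * A ^+ K0.+1 * eps) (slope z H i j * (g i * g j)) (g 0%N).
  case: j => [|j]; first by index_lia.
  case: i => [|i] ij.
    rewrite mulrCA {2}/g/= mulfV ?mulr1 ?gt_eqF ?s0//.
    by apply: logclose_refl => //; exact/ltW/g0.
  have := all i j; rewrite /v /V (slope_at_infty zi Hi); try index_lia.
  by rewrite /g /= -invfM => h; apply: h; index_lia.
exists g; split=> //.
case=> [|l] lK.
  rewrite subrr mul0r add0r [g _ * _]mulrC; apply: logclose_refl => //.
  by apply: mulr_ge0; [rewrite subr_ge0; apply: (inc_le zi); index_lia | apply/ltW/g0; index_lia].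
have [eK|nK] := eqVneq l.+1 K.
  rewrite eK subrr mul0r addr0 [g _ * _]mulrC; apply: logclose_refl => //.
  by apply: mulr_ge0; [rewrite subr_ge0; apply: (inc_le zi); index_lia | apply/ltW/g0; index_lia].
have {}lK : (l.+1 < K)%N by index_lia.
have gl := g0 l.+1 (ltnW lK); have gK := g0 K (leqnn _).
have -> : g l.+1 * (z K - z 0%N) = (z l.+1 - z 0%N) * g K +
    (z K - z l.+1) * (slope z H l.+1 K * (g l.+1 * g K)).
  have := slope_split H zi (ltn0Sn l) lK (leqnn K).
  have : slope z H 0 l.+1 * g l.+1 = 1 by rewrite /g/= mulfV ?gt_eqF ?s0//; index_lia.
  have : slope z H 0 K * g K = 1.
    by rewrite /g; case: eqP => [?|_]; [index_lia|rewrite mulfV ?gt_eqF ?s0//; index_lia].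
  move=> h1 h2 h3.
  transitivity (g l.+1 * g K * (slope z H 0 K * (z K - z 0%N))).
    by rewrite -[LHS]mulr1 -h1; ring.
  rewrite h3 mulrDr; congr (_ + _); last by ring.
  by rewrite -[RHS]mulr1 -h2; ring.
apply: logcloseD.
  apply: logclose_refl => //; rewrite mulr_ge0 ?subr_ge0//; last exact: ltW.
  by apply: (inc_le zi); index_lia.
apply: logcloseMl; last by apply: main; rewrite lK leqnn.
by rewrite subr_ge0; apply: (inc_le zi); index_lia.
Qed.

(** The affine function that is [rho] at [a] and [1] at [b]: up to a constant
    factor, it is the function [m'^(-1/2)] of a Mobius map [m] that has the quotient
    of these two values equal to [rho]. *)
Definition interp (a b rho w : R) := ((w - a) + (b - w) * rho) / (b - a).

Lemma interp_gt0 a b rho w : a < b -> a <= w <= b -> 0 < rho ->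
  0 < interp a b rho w.
Proof.
move=> ab /andP[aw wb] r0; rewrite /interp divr_gt0 ?subr_gt0//.
have [->|ne] := eqVneq w b; first by nra.
have wb' : w < b by rewrite lt_neqAle ne.
have : 0 < (b - w) * rho by rewrite mulr_gt0// subr_gt0.
by lra.
Qed.

(** The quotient of the coarse slopes on the two sides of [z k] determines the
    Mobius map that is followed up to composition with an affine map, hence every
    fine quotient of slopes. *)
Lemma mobius_slope_ratio B K0 : 1 <= B -> exists C e0 : R, [/\ 0 < C, 0 < e0 &
  forall K z H eps, (2 <= K <= K0)%N -> increasing_upto K z ->
    increasing_upto K H -> ratio_upto B K z -> 0 <= eps <= e0 ->
    (forall l, (l.+3 <= K)%N -> `|cross z H l| <= eps) ->
  forall k l, (0 < k < K)%N -> (l.+2 <= K)%N ->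
    let L := interp (z 0) (z K) (slope z H k K / slope z H 0 k) in
    `| ln (slope z H l.+1 l.+2 / slope z H l l.+1)
       - ln (L (z l) / L (z l.+2)) | <= C * eps].
Proof.
move=> B1; have [C [e0 [C0 e00 shadow]]] := mobius_shadow K0 B1.
exists (8 * C), e0; split=> //; first by rewrite mulr_gt0.
move=> K z H eps KK zi Hi zB /[dup] /andP[ee0 _] ee cr k l /andP[k0 kK] lK /=; set L := interp _ _ _.
have [g [g0 gs gi]] := shadow K z H eps KK zi Hi zB ee cr.
have s0 := slope_gt0 zi Hi.
set E := C * eps in gs gi *.
have E0 : 0 <= E by rewrite mulr_ge0// ltW.
have gp j : (j <= K)%N -> 0 < g j by exact: g0.
have zK : z 0%N < z K by apply: (inc_lt zi); index_lia.
have rho0 : 0 < slope z H k K / slope z H 0 k by rewrite divr_gt0 ?s0//; index_lia.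
have gs' i j : (i < j <= K)%N -> logclose E (slope z H i j) (g 0%N / (g i * g j)).
  move=> ij; apply: (@logclose_cancel _ _ _ _ (g i * g j)).
    by rewrite mulr_gt0 ?gp//; index_lia.
  have -> : g i * g j * (g 0%N / (g i * g j)) = g 0%N.
    by field; rewrite !gt_eqF ?gp//; index_lia.
  by rewrite [X in logclose _ X _]mulrC; exact: gs.
have gsl i j : (i < j <= K)%N -> 0 < g 0%N / (g i * g j).
  by move=> ij; rewrite divr_gt0 ?mulr_gt0 ?gp//; index_lia.
have rg : logclose (E + E) (slope z H k K / slope z H 0 k) (g 0%N / g K).
  have -> : g 0%N / g K = (g 0%N / (g k * g K)) * (g 0%N / (g 0%N * g k))^-1.
    by field; rewrite !gt_eqF ?gp//; index_lia.
  apply: logcloseM; rewrite ?invr_ge0; try (by apply/ltW/s0; index_lia);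
    try (by apply/ltW/gsl; index_lia); first by apply: gs'; index_lia.
  by apply: logcloseV; [apply: s0|apply: gsl|apply: gs']; index_lia.
have Lg j : (j <= K)%N -> logclose (E + E + E) (L (z j)) (g j / g K).
  move=> jK.
  have dz : 0 < z K - z 0%N by rewrite subr_gt0.
  have zj0 : 0 <= z j - z 0%N by rewrite subr_ge0; apply: (inc_le zi); index_lia.
  have zjK : 0 <= z K - z j by rewrite subr_ge0; apply: (inc_le zi); index_lia.
  have gK := gp K (leqnn _).
  apply: (@logclose_trans _ _ _ _ (((z j - z 0%N) + (z K - z j) * (g 0%N / g K)) / (z K - z 0%N))).
    rewrite /L /interp ![_ / (z K - z 0%N)]mulrC; apply: logcloseMl; first by rewrite invr_ge0 ltW.
    apply: logcloseD; first by apply: logclose_refl => //; lra.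
    exact: logcloseMl.
  have -> : ((z j - z 0%N) + (z K - z j) * (g 0%N / g K)) / (z K - z 0%N) =
    (g K * (z K - z 0%N))^-1 * ((z j - z 0%N) * g K + (z K - z j) * g 0%N).
    by field; rewrite !gt_eqF.
  have -> : g j / g K = (g K * (z K - z 0%N))^-1 * (g j * (z K - z 0%N)).
    by field; rewrite !gt_eqF.
  apply: logcloseMl; first by rewrite invr_ge0 mulr_ge0// ltW.
  exact/logclose_sym/gi.
have LL : logclose (E + E + E + (E + E + E)) (L (z l) / L (z l.+2)) (g l / g l.+2).
  have Lp j : (j <= K)%N -> 0 < L (z j).
    by move=> jK; apply: interp_gt0 => //; rewrite !(inc_le zi).
  have -> : g l / g l.+2 = (g l / g K) * (g l.+2 / g K)^-1.
    by field; rewrite !gt_eqF ?gp//; index_lia.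
  have gK j : (j <= K)%N -> 0 < g j / g K by move=> jK; rewrite divr_gt0 ?gp.
  apply: logcloseM; rewrite ?invr_ge0; try (by apply/ltW/Lp; index_lia);
    try (by apply/ltW/gK; index_lia); first by apply: Lg; index_lia.
  by apply: logcloseV; [apply: Lp|apply: gK|apply: Lg]; index_lia.
have rr : logclose (E + E) (slope z H l.+1 l.+2 / slope z H l l.+1) (g l / g l.+2).
  have -> : g l / g l.+2 = (g 0%N / (g l.+1 * g l.+2)) * (g 0%N / (g l * g l.+1))^-1.
    by field; rewrite !gt_eqF ?gp//; index_lia.
  apply: logcloseM; rewrite ?invr_ge0; try (by apply/ltW/s0; index_lia);
    try (by apply/ltW/gsl; index_lia); first by apply: gs'; index_lia.
  by apply: logcloseV; [apply: s0|apply: gsl|apply: gs']; index_lia.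
have Lp j : (j <= K)%N -> 0 < L (z j).
  by move=> jK; apply: interp_gt0 => //; rewrite !(inc_le zi).
have : logclose (E + E + (E + E + E + (E + E + E)))
    (slope z H l.+1 l.+2 / slope z H l l.+1) (L (z l) / L (z l.+2)).
  by apply: logclose_trans rr _; exact: logclose_sym.
have p1 : 0 < slope z H l.+1 l.+2 / slope z H l l.+1 by rewrite divr_gt0 ?s0//; index_lia.
have p2 : 0 < L (z l) / L (z l.+2) by rewrite divr_gt0 ?Lp//; index_lia.
move/(logcloseW _ p1 p2)/le_trans; apply.
by rewrite /E -mulrA; lra.
Qed.

End MobiusShadow.

Section Interp.
Context {R : realType}.
Implicit Types (a b u v rho r : R).

Lemma interp_affine a b rho w : a < b ->
  interp a b rho w = 1 + (rho - 1) * ((b - w) / (b - a)).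
Proof. by move=> ab; rewrite /interp; field; rewrite subr_eq0 gt_eqF. Qed.

Lemma expR_le_quad r : r <= 2^-1 -> expR r <= 1 + r + 2 * r ^+ 2.
Proof.
move=> rh; have e0 := expR_gt0 r.
have : 1 - r <= expR (- r) by have := expR_ge1Dx (- r).
rewrite expRN => h.
have h2 : (1 - r) * expR r <= 1 by rewrite -ler_pdivlMr// mul1r.
rewrite -(ler_pM2l (_ : 0 < 1 - r)); last by order_lra.
apply: (le_trans h2).
have : 0 <= (1 - 2 * r) * r ^+ 2 by rewrite mulr_ge0 ?sqr_ge0//; order_lra.
by order_lra.
Qed.

Lemma ln_ge_frac (x : R) : 0 < x -> 1 - x^-1 <= ln x.
Proof.
move=> x0; have xi : 0 < x^-1 by rewrite invr_gt0.
have h : ln (1 + (x^-1 - 1)) <= x^-1 - 1 by apply: le_ln1Dx; order_lra.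
rewrite (_ : 1 + (x^-1 - 1) = x^-1) in h; last by ring.
by rewrite lnV ?posrE// in h; order_lra.
Qed.

(** The ratio distortion of a Mobius map on a part of an interval, measured by
    [expR |.| - 1], is at most the fraction of the length times that of the whole
    interval. This form has no second-order term, so that it can be iterated
    without assuming that the distortion is small. *)
Lemma interp_ratio_le a b rho u v : a < b -> a <= u -> u < v -> v <= b -> 0 < rho ->
  expR `|ln (interp a b rho u / interp a b rho v)| <=
  1 + (v - u) / (b - a) * (expR `|ln rho| - 1).
Proof.
move=> ab au uv vb r0.
have Lu : 0 < interp a b rho u by apply: interp_gt0 => //; order_lra.
have Lv : 0 < interp a b rho v by apply: interp_gt0 => //; order_lra.
set th := (v - u) / (b - a).
have th0 : 0 < th by rewrite divr_gt0// subr_gt0.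
have E : interp a b rho u = interp a b rho v + (rho - 1) * th.
  by rewrite !interp_affine// /th; field; rewrite subr_eq0 gt_eqF.
have su : 0 <= (b - u) / (b - a) <= 1.
  by rewrite divr_ge0 ?ler_pdivrMr ?mul1r; order_lra.
have sv : 0 <= (b - v) / (b - a) <= 1.
  by rewrite divr_ge0 ?ler_pdivrMr ?mul1r; order_lra.
have Eu := interp_affine rho u ab; have Ev := interp_affine rho v ab.
have q0 := divr_gt0 Lu Lv; have q1 := divr_gt0 Lv Lu.
have eln (x : R) : 0 < x -> 1 <= x -> expR `|ln x| = x.
  by move=> x0 x1; rewrite ger0_norm ?ln_ge0// lnK.
move/andP: su => [su0 su1]; move/andP: sv => [sv0 sv1].
have [r1|r1] := leP 1 rho.
  have L1 : 1 <= interp a b rho v by rewrite Ev lerDl; apply: mulr_ge0 => //; order_lra.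
  have k0 : 0 <= (rho - 1) * th by apply: mulr_ge0; [order_lra|exact: ltW].
  rewrite [X in _ <= _ + _ * (X - 1)]eln// eln//; last first.
    by rewrite ler_pdivlMr// mul1r E; order_lra.
  rewrite ler_pdivrMr// E.
  by nra.
have invE (x : R) : 0 < x -> `|ln x| = `|ln x^-1| by move=> x0; rewrite lnV ?posrE// normrN.
have k0 : 0 <= (1 - rho) * th by apply: mulr_ge0; [order_lra|exact: ltW].
have Lr : rho <= interp a b rho u.
  have h : 0 <= (1 - rho) * (1 - (b - u) / (b - a)) by apply: mulr_ge0; order_lra.
  by rewrite Eu; order_lra.
rewrite [X in _ <= _ + _ * (expR X - 1)]invE// invE// invf_div.
rewrite [X in _ <= _ + _ * (X - 1)]eln ?invr_gt0 ?invf_ge1//; last exact: ltW.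
rewrite eln//; last by rewrite ler_pdivlMr// mul1r E; order_lra.
rewrite ler_pdivrMr//.
have -> : interp a b rho v = interp a b rho u + (1 - rho) * th by rewrite E; ring.
have -> : (1 + th * (rho^-1 - 1)) * interp a b rho u =
    interp a b rho u + (1 - rho) * th * (interp a b rho u / rho).
  by field; rewrite gt_eqF.
by rewrite lerD2l -[leLHS]mulr1 ler_wpM2l// ler_pdivlMr// mul1r.
Qed.

(** The sharper form, from which the limit of the quotient of distortion and length
    is obtained. *)
Lemma interp_ratio_lin a b rho u v : a < b -> a <= u -> u < v -> v <= b -> 0 < rho ->
  `|ln rho| <= 2^-1 ->
  `|ln (interp a b rho u / interp a b rho v) - (v - u) / (b - a) * ln rho| <=
  10 * ((v - u) / (b - a)) * `|ln rho| ^+ 2.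
Proof.
move=> ab au uv vb r0 rh.
have Lu : 0 < interp a b rho u by apply: interp_gt0 => //; order_lra.
have Lv : 0 < interp a b rho v by apply: interp_gt0 => //; order_lra.
set th := (v - u) / (b - a).
have th0 : 0 < th by rewrite divr_gt0// subr_gt0.
set d := rho - 1; set r := ln rho in rh *.
have E : interp a b rho u = interp a b rho v + d * th.
  by rewrite !interp_affine// /th /d; field; rewrite subr_eq0 gt_eqF.
have rr : `|r| ^+ 2 = r ^+ 2 by rewrite real_normK// num_real.
have /andP[rh1 rh2] : - 2^-1 <= r <= 2^-1 by rewrite -ler_norml.
have rhoE : rho = expR r by rewrite lnK.
have d1 : r <= d by rewrite /d rhoE; have := expR_ge1Dx r; order_lra.
have d2 : d <= r + 2 * r ^+ 2 by rewrite /d rhoE; have := expR_le_quad rh2; order_lra.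
have rho2 : 2^-1 <= rho by rewrite /d in d1; order_lra.
have dd : d ^+ 2 <= 4 * r ^+ 2.
  have h : `|d| <= 2 * `|r|.
    have := ler_norm r; have := ler_norm (- r); rewrite normrN => h1 h2.
    have : r ^+ 2 <= 2^-1 * `|r| by rewrite -rr expr2 ler_wpM2r.
    by rewrite ler_norml => h3; apply/andP; split; order_lra.
  have : `|d| ^+ 2 <= (2 * `|r|) ^+ 2 by rewrite lerXn2r// nnegrE// mulr_ge0.
  by rewrite real_normK ?num_real// exprMn rr; order_lra.
have su : 0 <= (b - u) / (b - a) <= 1.
  by rewrite divr_ge0 ?ler_pdivrMr ?mul1r; order_lra.
have sv : 0 <= (b - v) / (b - a) <= 1.
  by rewrite divr_ge0 ?ler_pdivrMr ?mul1r; order_lra.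
have key w : 0 <= (b - w) / (b - a) <= 1 -> `|d * th / interp a b rho w - d * th| <= 2 * d ^+ 2 * th.
  move=> /andP[s0 s1]; have Ew := interp_affine rho w ab.
  set L := interp a b rho w in Ew *; set s := (b - w) / (b - a) in Ew s0 s1.
  have L2 : 2^-1 <= L by rewrite Ew; nra.
  have L0 : 0 < L by order_lra.
  have -> : d * th / L - d * th = - (d ^+ 2 * th) * (s / L).
    have eL : 1 - L = - (d * s) by rewrite Ew -/d; ring.
    transitivity (d * th * (1 - L) / L); first by field; rewrite gt_eqF.
    by rewrite eL; ring.
  have k0 : 0 <= d ^+ 2 * th by rewrite mulr_ge0 ?sqr_ge0// ltW.
  rewrite normrM normrN (ger0_norm k0) ger0_norm; last by rewrite divr_ge0// ltW.
  rewrite -mulrA mulrC ler_wpM2r// ler_pdivrMr//; order_lra.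
have := key v sv; have := key u su => {key}.
move: (interp a b rho u) (interp a b rho v) Lu Lv E => x y x0 y0 E.
have nx := lt0r_neq0 x0; have ny := lt0r_neq0 y0.
have q0 : 0 < x / y by rewrite divr_gt0.
have e1 : x / y = 1 + d * th / y by rewrite E mulrDl divff.
have e2 : 1 - (x / y)^-1 = d * th / x.
  by rewrite invf_div (_ : y = x - d * th); [field|rewrite E; ring].
have up : ln (x / y) <= d * th / y by rewrite e1; apply: le_ln1Dx; order_lra.
have := ln_ge_frac q0; rewrite e2 => lo.
rewrite !ler_norml => /andP[k1 k2] /andP[k3 k4].
have k5 : 0 <= (d - r) * th by apply: mulr_ge0; [order_lra|exact: ltW].
have k6 : (d - r) * th <= 2 * r ^+ 2 * th by rewrite ler_pM2r//; order_lra.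
have k7 : d ^+ 2 * th <= 4 * r ^+ 2 * th by rewrite ler_pM2r.
rewrite rr; apply/andP; split; order_lra.
Qed.

End Interp.

(** * Refining subdivisions of an interval *)

(** One level of a grid as its increasing list of endpoints. Bounded geometry is
    kept as in the grid: neighbouring cells have comparable lengths and each cell
    is split into a bounded number, at least two, of cells of the next level. *)
Record cgrid (R : realType) (B : R) (M : nat) (p q : R) (N : nat -> nat)
    (x : nat -> nat -> R) : Prop := {
  cg_B : 1 <= B;
  cg_N : forall n, (2 <= N n)%N;
  cg_p : forall n, x n 0%N = p;
  cg_q : forall n, x n (N n) = q;
  cg_inc : forall n, increasing_upto (N n) (x n);
  cg_ratio : forall n, ratio_upto B (N n) (x n);
  cg_cell : forall n i, (i < N n)%N -> exists j k, [/\ (2 <= k <= M)%N,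
    (j + k <= N n.+1)%N, x n.+1 j = x n i & x n.+1 (j + k)%N = x n i.+1]
}.

Section Sequences.
Context {R : realType}.
Implicit Types (z : nat -> R).

Lemma inc_leE K z : increasing_upto K z ->
  forall i j, (i <= K)%N -> (j <= K)%N -> (z i <= z j) = (i <= j)%N.
Proof.
move=> zi i j iK jK; apply/idP/idP => [|ij]; last exact: inc_le zi _ _ ij jK.
by case: (leqP i j) => // ji; rewrite leNgt (inc_lt zi ji iK).
Qed.

Lemma inc_ltE K z : increasing_upto K z ->
  forall i j, (i <= K)%N -> (j <= K)%N -> (z i < z j) = (i < j)%N.
Proof. by move=> zi i j iK jK; rewrite ltNge (inc_leE zi)// -ltnNge. Qed.

Lemma inc_eq K z : increasing_upto K z ->
  forall i j, (i <= K)%N -> (j <= K)%N -> z i = z j -> i = j.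
Proof.
move=> zi i j iK jK e; apply/eqP; rewrite eqn_leq.
by rewrite -(inc_leE zi iK jK) -(inc_leE zi jK iK) e lexx.
Qed.

Lemma locate K z t : z 0%N <= t -> t < z K ->
  exists i, [/\ (i < K)%N, z i <= t & t < z i.+1].
Proof.
move=> t0; elim: K => [|K IH] tK; first by move: (le_lt_trans t0 tK); rewrite ltxx.
have [tK'|Kt] := ltP t (z K); last by exists K.
by have [i [iK h1 h2]] := IH tK'; exists i; split=> //; exact: ltnW.
Qed.

Lemma ratio_pow B K z : 1 <= B -> increasing_upto K z -> ratio_upto B K z ->
  forall l l' d, (l < K)%N -> (l' < K)%N -> (l <= l' + d)%N -> (l' <= l + d)%N ->
  z l.+1 - z l <= B ^+ d * (z l'.+1 - z l').
Proof.
move=> B1 zi zB l l' d lK l'K h1 h2.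
have B0 : 0 <= B by lra.
have gp i : (i < K)%N -> 0 < z i.+1 - z i by move=> iK; rewrite subr_gt0 zi.
have main d' : forall l l', (l < K)%N -> (l' < K)%N -> (l = l' + d' \/ l' = l + d')%N ->
    z l.+1 - z l <= B ^+ d' * (z l'.+1 - z l').
  elim: d' => [|d' IH] {h1 h2 lK l'K}l {}l' lK l'K h.
    have -> : l = l' by index_lia.
    by rewrite expr0 mul1r.
  rewrite exprS -mulrA; case: h => h.
    have [g1 _] := zB (l' + d')%N ltac:(index_lia).
    rewrite h addnS; apply: (le_trans g1); rewrite ler_wpM2l//.
    by apply: IH; index_lia.
  have [_ g2] := zB l ltac:(index_lia).
  apply: (le_trans g2); rewrite ler_wpM2l//.
  by apply: IH; index_lia.
pose d' := (maxn l l' - minn l l')%N.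
apply: (@le_trans _ _ (B ^+ d' * (z l'.+1 - z l'))).
  by apply: main => //; rewrite /d'; index_lia.
rewrite ler_pM2r ?gp// ler_weXn2l//; rewrite /d'; index_lia.
Qed.

Lemma sum_gaps z (s : R) i k : (forall l, (l < k)%N -> z (i + l).+1 - z (i + l)%N <= s) ->
  z (i + k)%N - z i <= k%:R * s.
Proof.
elim: k => [|k IH] h; first by rewrite addn0 subrr mul0r.
have h1 := IH (fun l lk => h l (ltnW lk)); have h2 := h k (ltnSn _).
by rewrite addnS -natr1 mulrDl mul1r; lra.
Qed.

End Sequences.

Section Tree.
Context {R : realType} {B : R} {M : nat} {p q : R} {N : nat -> nat}
  {x : nat -> nat -> R} (cg : cgrid B M p q N x).

(** The node [(n, i)] is the pair of cells of level [n] that meet at [x n i.+1];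
    [width] is the length of its window, the union of the two cells. *)
Definition width n i := x n i.+2 - x n i.

Definition child n i j := [/\ (i.+2 <= N n)%N, (j.+2 <= N n.+1)%N,
  x n i <= x n.+1 j & x n.+1 j.+2 <= x n i.+2].

(** [shrink] bounds the length of a child by that of its parent; [spread] bounds
    the length of a window by that of any cell of the next level inside it. *)
Definition shrink := B / (1 + B).
Definition spread := (M + M)%:R * B ^+ (M + M).

Let B1 := cg_B cg.
Let xi := cg_inc cg.

Lemma width_gt0 n i : (i.+2 <= N n)%N -> 0 < width n i.
Proof. by move=> iN; rewrite subr_gt0 (inc_lt (@xi n)). Qed.

Lemma shrink_gt0 : 0 < shrink.
Proof. by rewrite /shrink divr_gt0; have := B1; lra. Qed.

Lemma shrink_lt1 : shrink < 1.
Proof. by have := B1 => ?; rewrite /shrink ltr_pdivrMr ?mul1r; lra. Qed.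

Lemma window n i : (i.+2 <= N n)%N -> exists j0 k1 k2,
  [/\ (2 <= k1 <= M)%N, (2 <= k2 <= M)%N, (j0 + k1 + k2 <= N n.+1)%N &
  [/\ x n.+1 j0 = x n i, x n.+1 (j0 + k1)%N = x n i.+1 &
      x n.+1 (j0 + k1 + k2)%N = x n i.+2]].
Proof.
move=> iN; have [j [k [hk hj e1 e2]]] := cg_cell cg (ltnW iN).
have [j' [k' [hk' hj' e1' e2']]] := cg_cell cg iN.
have E : j' = (j + k)%N by apply: (inc_eq (@xi n.+1)) => //; [index_lia|rewrite e1' e2].
by exists j, k, k'; rewrite -E.
Qed.

(** The midpoint of a node of level [n.+1] lies in some cell of level [n]. If it is
    not an endpoint of that level, both cells of the node lie in that cell, and
    either node of level [n] that uses this cell will do; at the ends of [p, q]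
    there is only one. Otherwise it is also the midpoint of the parent. *)
Lemma parent n j : (j.+2 <= N n.+1)%N -> exists i, child n i j.
Proof.
move=> jN; have N2 := cg_N cg n.
have z0 : x n 0%N < x n.+1 j.+1.
  by rewrite (cg_p cg) -(cg_p cg n.+1) (inc_lt (@xi (n.+1)))//; index_lia.
have zN : x n.+1 j.+1 < x n (N n).
  by rewrite (cg_q cg) -(cg_q cg n.+1) (inc_lt (@xi (n.+1)))//; index_lia.
have [i [iN h1 h2]] := locate (ltW z0) zN.
have [j0 [k [hk hj e1 e2]]] := cg_cell cg iN.
move: h1 h2; rewrite -e1 -e2 (inc_leE (@xi (n.+1))) ?(inc_ltE (@xi (n.+1))); try index_lia.
rewrite leq_eqVlt => /predU1P[jj h|jj h].
  case: i iN e1 e2 => [|i] iN e1 e2.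
    have E : j0 = 0%N by apply: (inc_eq (@xi n.+1)) => //; [index_lia|rewrite e1 !(cg_p cg)].
    by index_lia.
  have [j' [k' [hk' hj' e1' e2']]] := cg_cell cg (ltnW iN).
  have E : (j' + k' = j0)%N by apply: (inc_eq (@xi n.+1)) => //; [index_lia|rewrite e1 e2'].
  exists i; split=> //; rewrite -?e1' -?e2 (inc_leE (@xi (n.+1))); index_lia.
have [iN'|iN'] := leqP i.+2 (N n).
  exists i; split=> //; first by rewrite -e1 (inc_leE (@xi (n.+1))); index_lia.
  apply: (@le_trans _ _ (x n i.+1)); last by apply: (inc_le (@xi (n))).
  by rewrite -e2 (inc_leE (@xi (n.+1))); index_lia.
case: i iN e1 e2 iN' => [|i] iN e1 e2 iN'; first by index_lia.
exists i; split=> //; last by rewrite -e2 (inc_leE (@xi (n.+1))); index_lia.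
apply: (@le_trans _ _ (x n i.+1)); first by apply: (inc_le (@xi (n))) => //; index_lia.
by rewrite -e1 (inc_leE (@xi (n.+1))); index_lia.
Qed.

Lemma width_le_cell n i l : (i.+2 <= N n)%N -> (l < N n.+1)%N ->
  x n i <= x n.+1 l -> x n.+1 l.+1 <= x n i.+2 ->
  width n i <= spread * (x n.+1 l.+1 - x n.+1 l).
Proof.
move=> iN lN; have [j0 [k1 [k2 [h1 h2 h3 [e1 e2 e3]]]]] := window iN.
rewrite /width -e1 -e3 !(inc_leE (@xi (n.+1))); try index_lia.
move=> jl lj; rewrite -addnA.
have gp : 0 < x n.+1 l.+1 - x n.+1 l by rewrite subr_gt0 xi.
apply: (@le_trans _ _ ((k1 + k2)%:R * (B ^+ (M + M) * (x n.+1 l.+1 - x n.+1 l)))).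
  apply: sum_gaps => l' l'k; apply: (ratio_pow B1 (@xi n.+1) (cg_ratio cg (n := _))); index_lia.
rewrite mulrA ler_pM2r// ler_wpM2r ?ler_nat//; last by index_lia.
by rewrite exprn_ge0//; have := B1; lra.
Qed.

(** A child around the midpoint of the window leaves out, next to each of its two
    cells, a cell of comparable length; any other child lies in one of the two
    cells of its parent and misses the other one. *)
Lemma child_width n i j : child n i j -> width n.+1 j <= shrink * width n i.
Proof.
case=> iN jN; have [j0 [k1 [k2 [h1 h2 h3 [e1 e2 e3]]]]] := window iN.
rewrite -e1 -e3 !(inc_leE (@xi (n.+1))); try index_lia.
move=> hj1 hj2.
have B0 : 0 < 1 + B by have := B1; lra.
have Bp : 0 <= B by have := B1; lra.
rewrite /shrink mulrAC ler_pdivlMr// /width.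
have [xa xb] := cg_ratio cg iN.
have xn := @xi n.+1; have rn := cg_ratio cg (n := n.+1).
have le a b : (a <= b)%N -> (b <= N n.+1)%N -> x n.+1 a <= x n.+1 b := inc_le xn (i := a) (j := b).
have [E|] := eqVneq j.+1 (j0 + k1)%N.
  case: j jN hj1 hj2 E => [|j] jN hj1 hj2 E; first by index_lia.
  have r1 := rn j ltac:(index_lia); have r2 := rn j.+2 ltac:(index_lia).
  have l1 := le j0 j ltac:(index_lia) ltac:(index_lia).
  have l2 := le j.+4 (j0 + k1 + k2)%N ltac:(index_lia) ltac:(index_lia).
  case: r1 r2 => [r1 _] [_ r2].
  have := ler_wpM2l Bp l1; have := ler_wpM2l Bp l2.
  by rewrite -e1 -e3; lra.
rewrite neq_ltn => /orP[E|E].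
  have l1 := le j0 j ltac:(index_lia) ltac:(index_lia).
  have l2 := le j.+2 (j0 + k1)%N ltac:(index_lia) ltac:(index_lia).
  by rewrite e1 e2 in l1 l2; have := ler_wpM2l Bp l1; have := ler_wpM2l Bp l2; lra.
have l1 := le (j0 + k1)%N j ltac:(index_lia) ltac:(index_lia).
have l2 := le j.+2 (j0 + k1 + k2)%N ltac:(index_lia) ltac:(index_lia).
by rewrite e2 e3 in l1 l2; have := ler_wpM2l Bp l1; have := ler_wpM2l Bp l2; lra.
Qed.

Lemma common_child n i : (i.+3 <= N n)%N -> exists j, child n i j /\ child n i.+1 j.
Proof.
move=> iN; have [j0 [k [hk hj e1 e2]]] := cg_cell cg (ltnW iN).
have h : (j0.+2 <= j0 + k)%N by index_lia.
have h' : x n.+1 j0.+2 <= x n i.+2 by rewrite -e2 (inc_leE (@xi (n.+1))); index_lia.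
exists j0; split; split; rewrite ?e1//; try index_lia.
- by apply: (inc_le (@xi (n))) => //; index_lia.
- by apply: (le_trans h'); apply: (inc_le (@xi (n))).
Qed.

Lemma width_le n i : (i.+2 <= N n)%N -> width n i <= shrink ^+ n * (q - p).
Proof.
elim: n i => [|n IH] i iN.
  rewrite expr0 mul1r -(cg_p cg 0) -(cg_q cg 0) /width.
  by apply: lerB; apply: (inc_le (@xi (0))) => //; index_lia.
have [i' ch] := parent iN; apply: (le_trans (child_width ch)).
have [i'N _ _ _] := ch.
by rewrite exprS -mulrA ler_pM2l ?shrink_gt0// IH.
Qed.

End Tree.

(** * Distortion at the nodes of a subdivision *)

Section Distortion.
Context {R : realType}.
Implicit Types (h : R -> R) (a b c d t : R).

(** [sec] is the secant slope; [lr] and [cd] are the ratio and cross-ratio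
    distortions of consecutive intervals given by their endpoints. *)
Definition sec h a b := (h b - h a) / (b - a).
Definition lr h a b c := ln (sec h b c / sec h a b).
Definition cd h a b c d :=
  ln (sec h a c * sec h b d / (sec h a b * sec h c d)).

Definition increasing_on (p q : R) h :=
  forall a b, p <= a -> a < b -> b <= q -> h a < h b.

Lemma sec_gt0 p q h a b : increasing_on p q h -> p <= a -> a < b -> b <= q ->
  0 < sec h a b.
Proof. by move=> hi pa ab bq; rewrite divr_gt0// subr_gt0 ?hi. Qed.

Lemma finite_bound (f : nat -> R) k : exists2 K, 0 <= K & forall i, (i < k)%N -> f i <= K.
Proof.
elim: k => [|k [K K0 HK]]; first by exists 0.
exists (K + `|f k|); first by rewrite addr_ge0.
move=> i; rewrite ltnS leq_eqVlt => /predU1P[->|ik].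
  by have := ler_norm (f k); lra.
by have := HK i ik; have := normr_ge0 (f k); lra.
Qed.

Lemma geometric_small (l a e : R) : 0 <= l < 1 -> 0 < e ->
  exists n0, forall n, (n0 <= n)%N -> l ^+ n * a <= e.
Proof.
move=> /andP[l0 l1] e0.
have : (fun n => l ^+ n * a) @ \oo --> 0 * a.
  by apply: cvgMl; apply: cvg_expr; rewrite ger0_norm.
rewrite mul0r => /cvgr0Pnorm_le/(_ _ e0)[n0 _ H].
by exists n0 => n n0n; apply: le_trans (ler_norm _) (H n n0n).
Qed.

End Distortion.

Section Recursion.
Context {R : realType} {B : R} {M : nat} {p q : R} {N : nat -> nat}
  {x : nat -> nat -> R} (cg : cgrid B M p q N x).
Context {h : R -> R} (hi : increasing_on p q h).

Definition node_lr n i := lr h (x n i) (x n i.+1) (x n i.+2).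
Definition quad_cd n i := cd h (x n i) (x n i.+1) (x n i.+2) (x n i.+3).
(** The quantity that contracts without a second-order term,
    see [interp_ratio_le]. *)
Definition node_excess n i := expR `|node_lr n i| - 1.

Local Notation width := (@width R x).
Local Notation child := (@child R N x).
Local Notation lam := (@shrink R B).
Local Notation spread := (@spread R B M).

Let B1 := cg_B cg.
Let xi := cg_inc cg.

Lemma grid_ge n i : (i <= N n)%N -> p <= x n i.
Proof. by move=> iN; rewrite -(cg_p cg n) (inc_le (@xi n)). Qed.

Lemma grid_le n i : (i <= N n)%N -> x n i <= q.
Proof. by move=> iN; rewrite -(cg_q cg n) (inc_le (@xi n)). Qed.

Lemma grid_sec_gt0 n i j : (i < j)%N -> (j <= N n)%N -> 0 < sec h (x n i) (x n j).
Proof.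
move=> ij jN; apply: (sec_gt0 hi); last exact: grid_le.
  by apply: grid_ge; index_lia.
by apply: (inc_lt (@xi n)).
Qed.

Lemma node_core : exists C e0 : R, [/\ 0 < C, 0 < e0 &
  forall n i eps, (i.+2 <= N n)%N -> 0 <= eps <= e0 ->
    (forall l, (l.+3 <= N n.+1)%N -> x n i <= x n.+1 l ->
       x n.+1 l.+3 <= x n i.+2 -> `|quad_cd n.+1 l| <= eps) ->
  forall j, child n i j ->
    let L := interp (x n i) (x n i.+2)
               (sec h (x n i.+1) (x n i.+2) / sec h (x n i) (x n i.+1)) in
    `|node_lr n.+1 j - ln (L (x n.+1 j) / L (x n.+1 j.+2))| <= C * eps].
Proof.
have [C [e0 [C0 e00 H]]] := mobius_slope_ratio (M + M) B1; exists C, e0; split=> //.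
move=> n i eps iN ee cr j [_ jN hj1 hj2] /=.
have [j0 [k1 [k2 [h1 h2 h3 [e1 e2 e3]]]]] := window cg iN.
move: hj1 hj2 cr; rewrite -e1 -e2 -e3 !(inc_leE (@xi n.+1)); try index_lia.
move=> hj1 hj2 cr.
pose z k := x n.+1 (j0 + k)%N.
have K2 : (2 <= k1 + k2 <= M + M)%N by index_lia.
have zi : increasing_upto (k1 + k2) z.
  by move=> k kK; rewrite /z addnS; apply: xi; index_lia.
have Hi : increasing_upto (k1 + k2) (h \o z).
  move=> k kK; apply: hi; rewrite ?grid_ge ?grid_le ?zi//; index_lia.
have zB : ratio_upto B (k1 + k2) z.
  by move=> k kK; rewrite /z !addnS; apply: (cg_ratio cg); index_lia.
have cr' l : (l.+3 <= k1 + k2)%N -> `|cross z (h \o z) l| <= eps.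
  move=> lK.
  have -> : cross z (h \o z) l = quad_cd n.+1 (j0 + l)%N.
    by rewrite /quad_cd /cross /z /slope /cd /sec /= !addnS.
  by apply: cr; rewrite ?(inc_leE (@xi n.+1)); index_lia.
have [l El] : exists l, j = (j0 + l)%N by exists (j - j0)%N; index_lia.
have := H (k1 + k2)%N z (h \o z) eps K2 zi Hi zB ee cr' k1 l ltac:(index_lia) ltac:(index_lia).
by rewrite El /slope /z /node_lr /lr /sec /= !addnS addn0 addnA.
Qed.

(** The recursion on which all of the decay estimates rest: passing to a child
    multiplies the ratio distortion by the ratio of the lengths, up to the error
    coming from the cross-ratios inside the parent. *)
Lemma child_excess : exists C e0 : R, [/\ 0 < C, 0 < e0 &
  forall n i eps, (i.+2 <= N n)%N -> 0 <= eps <= e0 ->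
    (forall l, (l.+3 <= N n.+1)%N -> x n i <= x n.+1 l ->
       x n.+1 l.+3 <= x n i.+2 -> `|quad_cd n.+1 l| <= eps) ->
  forall j, child n i j ->
    node_excess n.+1 j <=
      C * eps + (1 + C * eps) * (width n.+1 j / width n i) * node_excess n i /\
    (`|node_lr n i| <= 2^-1 ->
     `|node_lr n.+1 j - width n.+1 j / width n i * node_lr n i| <=
      C * eps + 10 * (width n.+1 j / width n i) * `|node_lr n i| ^+ 2)].
Proof.
have [C [e0 [C0 e00 H]]] := node_core.
exists (2 * C), (Num.min e0 (2 * C)^-1); split.
- by rewrite mulr_gt0.
- by rewrite lt_min e00 invr_gt0 mulr_gt0.
move=> n i eps iN /andP[ee0]; rewrite le_min => /andP[ee e2] cr j ch.
have {H} := H n i eps iN _ cr j ch => /(_ ltac:(by rewrite ee0 ee)) /=.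
case: (ch) => _ jN hj1 hj2.
set rho := sec _ _ _ / sec _ _ _; set L := ln (_ / _) => H.
have rho0 : 0 < rho by rewrite divr_gt0// grid_sec_gt0//; index_lia.
have ab : x n i < x n i.+2 by apply: (inc_lt (@xi n)).
have uv : x n.+1 j < x n.+1 j.+2 by apply: (inc_lt (@xi n.+1)).
have H1 := interp_ratio_le ab hj1 uv hj2 rho0.
have H2 := interp_ratio_lin ab hj1 uv hj2 rho0.
rewrite -/(width n i) -/(width n.+1 j) in H1 H2.
have wi := width_gt0 cg iN; have wj := width_gt0 cg jN.
set th := width n.+1 j / width n i in H1 H2 *.
have th0 : 0 < th by rewrite divr_gt0.
have Ce0 : 0 <= C * eps by rewrite mulr_ge0// ltW.
have Ce : C * eps <= 2^-1.
  by have := ler_wpM2l (ltW C0) e2; rewrite invfM mulrCA mulfV ?gt_eqF// mulr1.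
have eE := expR_le1D2x Ce0 Ce.
have le1 : 1 <= expR (C * eps) by rewrite -[leLHS]expR0 ler_expR.
have lrho : ln rho = node_lr n i by [].
rewrite lrho in H1 H2; rewrite -/L in H1 H2.
split.
  rewrite /node_excess lerBlDr.
  have h0 : `|node_lr n.+1 j| <= C * eps + `|L|.
    rewrite -[node_lr n.+1 j](subrK L); apply: (le_trans (ler_normD _ _)).
    by rewrite lerD2r.
  apply: (@le_trans _ _ (expR (C * eps + `|L|))); first by rewrite ler_expR.
  rewrite expRD.
  set E := expR `|node_lr n i| - 1 in H1 *.
  have E0 : 0 <= th * E.
    by rewrite mulr_ge0 ?(ltW th0)// subr_ge0 -[leLHS]expR0 ler_expR.
  apply: (@le_trans _ _ ((1 + 2 * (C * eps)) * (1 + th * E))).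
    by apply: ler_pM; rewrite ?expR_ge0.
  by rewrite -!mulrA; lra.
move=> /H2 {}H2.
rewrite -[X in `|X|](subrKA L); apply: (le_trans (ler_normD _ _)).
by apply: lerD => //; apply: (le_trans H); rewrite -mulrA; lra.
Qed.

End Recursion.

(** * Decay of the ratio distortion *)

Section Decay.
Context {R : realType} {B : R} {M : nat} {p q : R} {N : nat -> nat}
  {x : nat -> nat -> R} (cg : cgrid B M p q N x).
Context {h : R -> R} (hi : increasing_on p q h).

Local Notation width := (@width R x).
Local Notation child := (@child R N x).
Local Notation lam := (@shrink R B).
Local Notation spread := (@spread R B M).
Local Notation node_lr := (@node_lr R x h).
Local Notation quad_cd := (@quad_cd R x h).
Local Notation node_excess := (@node_excess R x h).

Lemma node_excess_ge n i : `|node_lr n i| <= node_excess n i.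
Proof. by rewrite /node_excess lerBrDl expR_ge1Dx. Qed.

Lemma node_excess_ge0 n i : 0 <= node_excess n i.
Proof. exact: le_trans (node_excess_ge n i). Qed.

Lemma child_ratio n i j : child n i j ->
  0 < width n.+1 j / width n i <= lam.
Proof.
move=> ch; have [iN jN _ _] := ch.
have w0 := width_gt0 cg iN; have w1 := width_gt0 cg jN.
by rewrite divr_gt0// ler_pdivrMr// (child_width cg ch).
Qed.

Lemma width_le_child n i j : child n i j -> width n i <= spread * width n.+1 j.
Proof.
case=> iN jN h1 h2.
have lt2 : x n.+1 j.+1 <= x n.+1 j.+2 by apply: (inc_le (@cg_inc _ _ _ _ _ _ _ cg n.+1)).
apply: (le_trans (width_le_cell cg iN (ltnW jN) h1 (le_trans lt2 h2))).
apply: ler_wpM2l; last by rewrite /width lerB.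
by rewrite /spread mulr_ge0// exprn_ge0//; have := cg_B cg; order_lra.
Qed.

Lemma spread_gt0 : 0 < spread.
Proof.
have [j0 [k1 [k2 [/andP[h1 h2] _ _ _]]]] := window cg (cg_N cg 0).
rewrite /spread mulr_gt0 ?ltr0n//; first by lia.
by rewrite exprn_gt0//; have := cg_B cg; order_lra.
Qed.

Lemma lam_bounds : 0 <= lam < 1.
Proof. by rewrite (shrink_lt1 cg) ltW// (shrink_gt0 cg). Qed.

Lemma pq_lt : p < q.
Proof.
rewrite -(cg_p cg 0) -(cg_q cg 0) (inc_lt (@cg_inc _ _ _ _ _ _ _ cg 0%N))//.
exact: leq_trans (cg_N cg 0).
Qed.

Lemma powR_expn (l : R) n g : 0 <= l -> (l ^+ n) `^ g = (l `^ g) ^+ n.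
Proof. by move=> l0; rewrite -powR_mulrn// powRAC powR_mulrn// powR_ge0. Qed.

Lemma width_pow_le n i (g : R) : (i.+2 <= N n)%N -> 0 <= g ->
  width n i `^ g <= (lam `^ g) ^+ n * (q - p) `^ g.
Proof.
move=> iN g0; have /andP[l0 _] := lam_bounds.
rewrite -powR_expn// -powRM ?exprn_ge0//; last by rewrite subr_ge0 ltW ?pq_lt.
apply: ge0_ler_powR => //; rewrite ?nnegrE; last exact: (width_le cg).
  exact/ltW/(width_gt0 cg).
by rewrite mulr_ge0 ?exprn_ge0// subr_ge0 ltW ?pq_lt.
Qed.

Lemma lam_pow_bounds (g : R) : 0 < g -> 0 <= lam `^ g < 1.
Proof.
move=> g0; have /andP[l0 l1] := lam_bounds.
rewrite powR_ge0/= (_ : 1 = 1 `^ g); last by rewrite powR1.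
by rewrite gt0_ltr_powR ?nnegrE.
Qed.

Lemma width_pow_small (g e : R) : 0 < g -> 0 < e -> exists n0, forall n i,
  (n0 <= n)%N -> (i.+2 <= N n)%N -> width n i `^ g <= e.
Proof.
move=> g0 e0.
have [n0 H] := geometric_small ((q - p) `^ g) (lam_pow_bounds g0) e0.
by exists n0 => n i nn iN; apply: le_trans (width_pow_le iN (ltW g0)) (H n nn).
Qed.

Lemma quad_width n i l : (l.+3 <= N n.+1)%N -> x n i <= x n.+1 l ->
  x n.+1 l.+3 <= x n i.+2 -> width n.+1 l <= width n i.
Proof.
move=> lN h1 h2; have : x n.+1 l.+2 <= x n.+1 l.+3.
  by apply: (inc_le (@cg_inc _ _ _ _ _ _ _ cg n.+1)).
by rewrite /width; order_lra.
Qed.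

(** With errors at most [C * e], the excess satisfies [E' <= C e + mu E] for a fixed
    [mu < 1], and the limit of this recursion is [O(e)]. *)
Lemma node_lr_small :
  (forall eta, 0 < eta -> exists n0, forall n l, (n0 <= n)%N ->
     (l.+3 <= N n)%N -> `|quad_cd n l| <= eta) ->
  forall eta, 0 < eta -> exists n0, forall n i, (n0 <= n)%N ->
     (i.+2 <= N n)%N -> `|node_lr n i| <= eta.
Proof.
move=> small eta eta0.
have [C [e0 [C0 e00 step]]] := child_excess cg hi.
have /andP[l0 l1] := lam_bounds.
have l1' : 0 < 1 - lam by order_lra.
have [e [e_gt0 ee0 ee1 ee2]] : exists e, [/\ 0 < e, e <= e0,
    C * e <= (1 - lam) / 2 & C * e <= (1 - lam) * eta / 4].
  exists (Num.min e0 (Num.min ((1 - lam) / (2 * C)) ((1 - lam) * eta / (4 * C)))).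
  split.
  - by rewrite !lt_min e00 !divr_gt0 ?mulr_gt0.
  - by rewrite ge_min lexx.
  - rewrite mulrC -ler_pdivlMr// (_ : _ / 2 / C = (1 - lam) / (2 * C)).
      by rewrite !ge_min lexx orbT.
    by field; rewrite gt_eqF.
  - rewrite mulrC -ler_pdivlMr// (_ : _ / 4 / C = (1 - lam) * eta / (4 * C)).
      by rewrite !ge_min lexx !orbT.
    by field; rewrite gt_eqF.
have [n1 cds] := small e e_gt0.
pose mu := (1 + lam) / 2.
have Ce : 0 <= C * e by rewrite mulr_ge0// ltW.
have [E1 E10 HE1] := finite_bound (node_excess n1) (N n1).
have mu0 : 0 <= mu by rewrite /mu; order_lra.
have iter m i : (i.+2 <= N (n1 + m))%N ->
    node_excess (n1 + m) i <= mu ^+ m * E1 + eta / 2.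
  elim: m i => [|m IH] j.
    rewrite addn0 expr0 mul1r => jN; have := HE1 j (ltnW jN); order_lra.
  rewrite addnS => jN; have [i ch] := parent cg jN.
  have [iN _ _ _] := ch.
  have /andP[th0 th1] := child_ratio ch.
  have ee : 0 <= e <= e0 by rewrite ltW.
  have cds' l : (l.+3 <= N (n1 + m).+1)%N -> x (n1 + m) i <= x (n1 + m).+1 l ->
      x (n1 + m).+1 l.+3 <= x (n1 + m) i.+2 -> `|quad_cd (n1 + m).+1 l| <= e.
    move=> lN _ _; apply: (cds (n1 + m).+1 l _ lN).
    exact: leq_trans (leq_addr m n1) (leqnSn _).
  have [H _] := step (n1 + m)%N i e iN ee cds' j ch.
  apply: (le_trans H).
  have E0 := node_excess_ge0 (n1 + m) i.
  have IHi := IH i iN.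
  apply: (@le_trans _ _ (C * e + mu * node_excess (n1 + m) i)).
    rewrite lerD2l ler_wpM2r//.
    apply: (@le_trans _ _ ((1 + C * e) * lam)); first by rewrite ler_wpM2l//; order_lra.
    have : C * e * lam <= C * e * 1 by rewrite ler_wpM2l// ltW.
    by rewrite /mu; order_lra.
  have := ler_wpM2l mu0 IHi; rewrite exprS -mulrA.
  have -> : mu * (mu ^+ m * E1 + eta / 2) = mu * (mu ^+ m * E1) + eta / 2 * mu by ring.
  have : eta / 2 * mu = eta / 2 * ((1 + lam) / 2) by [].
  by order_lra.
have mu01 : 0 <= mu < 1 by rewrite mu0 /mu; order_lra.
have eta2 : 0 < eta / 2 by order_lra.
have [m0 Hm] := geometric_small E1 mu01 eta2.
exists (n1 + m0)%N => n i nn iN.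
have En : n = (n1 + (n - n1))%N by clear -nn; lia.
apply: (le_trans (node_excess_ge _ _)).
have iN' : (i.+2 <= N (n1 + (n - n1)))%N by rewrite -En.
have nm : (m0 <= n - n1)%N by clear -nn; lia.
by rewrite En; have := Hm _ nm; have := iter _ _ iN'; order_lra.
Qed.

(** The excess contracts like [w], which for [g < 1] is faster than [w^g]: its
    quotient by [w^g] is multiplied by at most [mu < 1] at each step, up to a
    bounded error. *)
Lemma node_lr_holder (g c : R) : 0 < g < 1 ->
  (forall n l, (l.+3 <= N n)%N -> `|quad_cd n l| <= c * width n l `^ g) ->
  exists K n0, forall n i, (n0 <= n)%N -> (i.+2 <= N n)%N ->
    `|node_lr n i| <= K * width n i `^ g.
Proof.
move=> /andP[g0 g1] cds'.
have [C [e0 [C0 e00 step]]] := child_excess cg hi.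
wlog c0 : c cds' / 0 < c.
  move=> W; apply: (W (`|c| + 1)); last by have := normr_ge0 c; order_lra.
  move=> n l lN; apply: (le_trans (cds' n l lN)); rewrite ler_wpM2r ?powR_ge0//.
  by have := ler_norm c; order_lra.
have /andP[l0 l1] := lam_bounds.
have g1' : 0 < 1 - g by order_lra.
have /andP[m0 m1] := lam_pow_bounds g1'.
set m := lam `^ (1 - g) in m0 m1.
have s0 := spread_gt0; have s0' := ltW s0; have c0' := ltW c0; have C0' := ltW C0.
have m1' : 0 < 1 - m by order_lra.
have small0 : 0 < Num.min (e0 / c) ((1 - m) / (2 * (C * c))).
  by rewrite lt_min !divr_gt0// ?mulr_gt0.
have [n1 H1] := width_pow_small g0 small0.
pose mu := (1 + m) / 2.
have [K1 K10 HK1] := finite_bound (fun i => node_excess n1 i / width n1 i `^ g) (N n1).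
pose K2 := C * c * spread `^ g / (1 - mu).
have mu1 : 0 < 1 - mu by rewrite /mu; order_lra.
have K20 : 0 <= K2.
  by apply: divr_ge0; [rewrite !mulr_ge0 ?powR_ge0|exact: ltW].
have iter k i : (i.+2 <= N (n1 + k))%N ->
    node_excess (n1 + k) i <= (K1 + K2) * width (n1 + k) i `^ g.
  elim: k i => [|k IH] j.
    rewrite addn0 => jN; have := HK1 j (ltnW jN).
    have w0 := powR_gt0 g (width_gt0 cg jN).
    rewrite ler_pdivrMr// => /le_trans; apply; rewrite ler_wpM2r ?powR_ge0//; order_lra.
  rewrite addnS => jN; have [i ch] := parent cg jN.
  have [iN _ _ _] := ch; set n := (n1 + k)%N in IH ch iN jN *.
  have wi := width_gt0 cg iN; have wj := width_gt0 cg jN.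
  have /andP[th0 th1] := child_ratio ch.
  have := H1 n i (leq_addr k n1) iN; rewrite le_min => /andP[we0 we1].
  pose e := c * width n i `^ g.
  have ee : 0 <= e <= e0.
    by rewrite /e mulr_ge0 ?powR_ge0//= mulrC -ler_pdivlMr.
  have Ce0 : 0 <= C * e by case/andP: ee => ? _; exact: mulr_ge0.
  have Ce1 : C * e <= (1 - m) / 2.
    by move: we1; rewrite invfM mulrA ler_pdivlMr ?mulr_gt0// /e mulrC mulrA.
  have cds l : (l.+3 <= N n.+1)%N -> x n i <= x n.+1 l ->
      x n.+1 l.+3 <= x n i.+2 -> `|quad_cd n.+1 l| <= e.
    move=> lN h1 h2; apply: (le_trans (cds' _ _ lN)); rewrite /e ler_wpM2l//.
    rewrite ge0_ler_powR ?nnegrE ?(ltW g0) ?(ltW wi)//; last exact: quad_width.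
    by apply/ltW/(width_gt0 cg)/ltnW.
  have [H _] := step n i e iN ee cds j ch.
  apply: (le_trans H).
  set th := width n.+1 j / width n i in th0 th1 *.
  have E0 := node_excess_ge0 n i; have IHi := IH i iN.
  have wth : th * width n i `^ g = th `^ (1 - g) * width n.+1 j `^ g.
    have -> : width n.+1 j = th * width n i by rewrite /th divfK// gt_eqF.
    rewrite powRM ?(ltW th0) ?(ltW wi)// mulrA -powRD ?subrK ?powRr1 ?(ltW th0)//.
    by rewrite (gt_eqF th0) implybT.
  have thm : th `^ (1 - g) <= m.
    by rewrite /m ge0_ler_powR ?nnegrE ?(ltW th0) ?(ltW g1').
  have wsp : width n i `^ g <= spread `^ g * width n.+1 j `^ g.
    have sw0 := mulr_ge0 s0' (ltW wj).
    rewrite -powRM ?(ltW wj)// ge0_ler_powR ?nnegrE ?(ltW g0) ?(ltW wi)//.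
    exact: width_le_child.
  set W := width n.+1 j `^ g in wth wsp *.
  have W0 : 0 <= W by rewrite powR_ge0.
  have p1 : C * e <= C * c * spread `^ g * W.
    by rewrite /e -!mulrA ler_wpM2l// ler_wpM2l.
  have p2 : (1 + C * e) * th * node_excess n i <= mu * (K1 + K2) * W.
    apply: (@le_trans _ _ ((1 + C * e) * th * ((K1 + K2) * width n i `^ g))).
      by rewrite ler_wpM2l//; apply: mulr_ge0; [order_lra|exact: ltW].
    have -> : (1 + C * e) * th * ((K1 + K2) * width n i `^ g) =
       (1 + C * e) * (K1 + K2) * (th * width n i `^ g) by ring.
    rewrite wth mulrA ler_wpM2r// -mulrA mulrC -mulrA [X in _ <= X]mulrC.
    rewrite ler_wpM2l ?addr_ge0//.
    have : th `^ (1 - g) * (1 + C * e) <= m * (1 + C * e) by rewrite ler_wpM2r//; order_lra.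
    have : m * (C * e) <= 1 * (C * e) by rewrite ler_wpM2r// ltW.
    by rewrite /mu; order_lra.
  have p3 : C * c * spread `^ g = (1 - mu) * K2.
    by rewrite /K2 [RHS]mulrCA mulfV ?mulr1// gt_eqF.
  rewrite p3 in p1.
  have : 0 <= (1 - mu) * K1 * W by rewrite !mulr_ge0// ltW.
  by order_lra.
exists (K1 + K2), n1 => n i nn iN.
apply: (le_trans (node_excess_ge _ _)).
have En : n = (n1 + (n - n1))%N by clear -nn; lia.
by rewrite En; apply: iter; rewrite -En.
Qed.

(** The quotient [f] of the excess by the length satisfies
    [1 + f' <= (1 + d) (1 + f)] with errors [d] that are summable over the levels. *)
Lemma node_lr_lipschitz (a c : R) : 0 < a ->
  (forall n l, (l.+3 <= N n)%N -> `|quad_cd n l| <= c * width n l `^ (1 + a)) ->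
  exists K n0, forall n i, (n0 <= n)%N -> (i.+2 <= N n)%N ->
    `|node_lr n i| <= K * width n i.
Proof.
move=> a0 cds'.
have [C [e0 [C0 e00 step]]] := child_excess cg hi.
wlog c0 : c cds' / 0 < c.
  move=> W; apply: (W (`|c| + 1)); last by have := normr_ge0 c; order_lra.
  move=> n l lN; apply: (le_trans (cds' n l lN)); rewrite ler_wpM2r ?powR_ge0//.
  by have := ler_norm c; order_lra.
have /andP[nu0 nu1] := lam_pow_bounds a0; set nu := lam `^ a in nu0 nu1.
have a1 : 0 < 1 + a by order_lra.
have s0 := spread_gt0; have s0' := ltW s0; have c0' := ltW c0; have C0' := ltW C0.
have W0 : 0 < q - p by rewrite subr_gt0 pq_lt.
have [n1 H1] := width_pow_small a1 (divr_gt0 e00 c0).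
have powS w : 0 < w -> w `^ (1 + a) = w * w `^ a.
  by move=> w0; rewrite powRD ?powRr1 ?(ltW w0)// (gt_eqF w0) implybT.
pose D := C * c * (q - p) `^ a * (spread + (q - p)).
have D0 : 0 <= D by apply: mulr_ge0; [rewrite !mulr_ge0 ?powR_ge0|exact/ltW/addr_gt0].
have [K1 K10 HK1] := finite_bound (fun i => node_excess n1 i / width n1 i) (N n1).
have nu1' : 0 < 1 - nu by order_lra.
pose S k := D * ((1 - nu ^+ k) / (1 - nu)).
have SS k : S k.+1 = S k + D * nu ^+ k.
  by rewrite /S exprS; field; rewrite gt_eqF.
have S0 : S 0%N = 0 by rewrite /S expr0 subrr mul0r mulr0.
have Sle k : S k <= D / (1 - nu).
  rewrite /S ler_wpM2l// ler_pdivrMr// mulVf ?gt_eqF//.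
  by have := exprn_ge0 k nu0; order_lra.
have iter k i : (i.+2 <= N (n1 + k))%N ->
    1 + node_excess (n1 + k) i / width (n1 + k) i <= (1 + K1) * expR (S k).
  elim: k i => [|k IH] j.
    by rewrite addn0 S0 expR0 mulr1 => jN; rewrite lerD2l; apply/HK1/ltnW.
  rewrite addnS => jN; have [i ch] := parent cg jN.
  have [iN _ _ _] := ch; set n := (n1 + k)%N in IH ch iN jN *.
  have wi := width_gt0 cg iN; have wj := width_gt0 cg jN.
  have /andP[th0 th1] := child_ratio ch.
  have we0 := H1 n i (leq_addr k n1) iN.
  pose e := c * width n i `^ (1 + a).
  have ee : 0 <= e <= e0.
    by rewrite /e mulr_ge0 ?powR_ge0//= mulrC -ler_pdivlMr.
  have cds l : (l.+3 <= N n.+1)%N -> x n i <= x n.+1 l ->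
      x n.+1 l.+3 <= x n i.+2 -> `|quad_cd n.+1 l| <= e.
    move=> lN h1 h2; apply: (le_trans (cds' _ _ lN)); rewrite /e ler_wpM2l//.
    rewrite ge0_ler_powR ?nnegrE ?(ltW a1) ?(ltW wi)//; last exact: quad_width.
    by apply/ltW/(width_gt0 cg)/ltnW.
  have [H _] := step n i e iN ee cds j ch.
  have E0 := node_excess_ge0 n i; have IHi := IH i iN.
  have wpow : width n i `^ a <= nu ^+ k * (q - p) `^ a.
    apply: (le_trans (width_pow_le iN (ltW a0))); rewrite ler_wpM2r ?powR_ge0//.
    by rewrite /n exprD ler_piMl ?exprn_ge0// exprn_ile1// ltW.
  have nuk : 0 <= nu ^+ k by rewrite exprn_ge0.
  have wq : width n i <= q - p.
    by apply: lerB; [exact: (grid_le cg)|apply: (grid_ge cg); exact/ltnW/ltnW].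
  have h1 : C * e / width n.+1 j <= C * c * (q - p) `^ a * spread * nu ^+ k.
    rewrite ler_pdivrMr// /e powS//.
    have := ler_pM (ltW wi) (powR_ge0 _ _) (width_le_child ch) wpow.
    by move=> /(ler_wpM2l (ltW (mulr_gt0 C0 c0))); order_lra.
  have h2 : C * e <= C * c * (q - p) `^ a * (q - p) * nu ^+ k.
    rewrite /e powS//.
    have := ler_pM (ltW wi) (powR_ge0 _ _) wq wpow.
    by move=> /(ler_wpM2l (ltW (mulr_gt0 C0 c0))); order_lra.
  set d := D * nu ^+ k.
  have Ed : d = C * c * (q - p) `^ a * spread * nu ^+ k + C * c * (q - p) `^ a * (q - p) * nu ^+ k.
    by rewrite /d /D; ring.
  have Cc0 := mulr_ge0 C0' c0'.
  have q1 := mulr_ge0 (mulr_ge0 (mulr_ge0 Cc0 (powR_ge0 (q - p) a)) s0') nuk.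
  have q2 := mulr_ge0 (mulr_ge0 (mulr_ge0 Cc0 (powR_ge0 (q - p) a)) (ltW W0)) nuk.
  have h3 : node_excess n.+1 j / width n.+1 j <= d + (1 + d) * (node_excess n i / width n i).
    apply: (@le_trans _ _ ((C * e + (1 + C * e) * (width n.+1 j / width n i) * node_excess n i) / width n.+1 j)).
      by rewrite ler_wpM2r// invr_ge0 ltW.
    have -> : (C * e + (1 + C * e) * (width n.+1 j / width n i) * node_excess n i) / width n.+1 j
      = C * e / width n.+1 j + (1 + C * e) * (node_excess n i / width n i).
      by field; rewrite !gt_eqF.
    apply: lerD; first by order_lra.
    by rewrite ler_wpM2r ?divr_ge0 ?(ltW wi)//; order_lra.
  have f0 : 0 <= node_excess n i / width n i by rewrite divr_ge0// ltW.
  set f := node_excess n i / width n i in f0 h3 IHi.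
  apply: (@le_trans _ _ ((1 + d) * (1 + f))); first by order_lra.
  have -> : (1 + K1) * expR (S k.+1) = expR d * ((1 + K1) * expR (S k)).
    by rewrite SS expRD; ring.
  have d0 : 0 <= 1 + d by rewrite addr_ge0// mulr_ge0.
  by apply: ler_pM => //; [rewrite addr_ge0|exact: expR_ge1Dx].
exists ((1 + K1) * expR (D / (1 - nu))), n1 => n i nn iN.
apply: (le_trans (node_excess_ge _ _)).
have w0 := width_gt0 cg iN; rewrite -ler_pdivrMr//.
have En : n = (n1 + (n - n1))%N by clear -nn; lia.
have := iter (n - n1)%N i; rewrite -En => /(_ iN) I.
have : (1 + K1) * expR (S (n - n1)%N) <= (1 + K1) * expR (D / (1 - nu)).
  by rewrite ler_wpM2l ?ler_expR//; order_lra.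
by order_lra.
Qed.

(** Once the ratio distortion is [O(w)], the second-order term of the recursion is
    as small as the contribution of the cross-ratios. *)
Lemma node_curvature_holder (a c K : R) n0 : 0 < a <= 1 ->
  (forall n l, (l.+3 <= N n)%N -> `|quad_cd n l| <= c * width n l `^ (1 + a)) ->
  (forall n i, (n0 <= n)%N -> (i.+2 <= N n)%N ->
    `|node_lr n i| <= K * width n i) ->
  exists K' n1, forall n i j, (n1 <= n)%N -> child n i j ->
    `|node_lr n.+1 j / width n.+1 j - node_lr n i / width n i| <=
    K' * width n i `^ a.
Proof.
move=> /andP[a0 a1'] cds' Klip.
have [C [e0 [C0 e00 step]]] := child_excess cg hi.
wlog c0 : c cds' / 0 < c.
  move=> W; apply: (W (`|c| + 1)); last by have := normr_ge0 c; order_lra.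
  move=> n l lN; apply: (le_trans (cds' n l lN)); rewrite ler_wpM2r ?powR_ge0//.
  by have := ler_norm c; order_lra.
wlog K0 : K Klip / 0 < K.
  move=> W; apply: (W (`|K| + 1)); last by have := normr_ge0 K; order_lra.
  move=> n l nn lN; apply: (le_trans (Klip n l nn lN)).
  by rewrite ler_wpM2r ?(ltW (width_gt0 cg lN))//; have := ler_norm K; order_lra.
have a1 : 0 < 1 + a by order_lra.
have s0 := spread_gt0; have s0' := ltW s0; have c0' := ltW c0; have C0' := ltW C0.
have W0 : 0 < q - p by rewrite subr_gt0 pq_lt.
have [n1 H1] := width_pow_small a1 (divr_gt0 e00 c0).
have half0 : (0 : R) < 2^-1 by order_lra.
have [n2 H2] := width_pow_small ltr01 (divr_gt0 half0 K0).
have powS w : 0 < w -> w `^ (1 + a) = w * w `^ a.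
  by move=> w0; rewrite powRD ?powRr1 ?(ltW w0)// (gt_eqF w0) implybT.
exists (C * c * spread + 10 * K ^+ 2 * (q - p) `^ (1 - a)), (n0 + (n1 + n2))%N.
move=> n i j nn ch; have [iN jN _ _] := ch.
have wi := width_gt0 cg iN; have wj := width_gt0 cg jN.
have we0 := H1 n i ltac:(clear -nn; lia) iN.
have wK := H2 n i ltac:(clear -nn; lia) iN; rewrite powRr1 ?(ltW wi)// in wK.
have rK := Klip n i ltac:(clear -nn; lia) iN.
pose e := c * width n i `^ (1 + a).
have ee : 0 <= e <= e0.
  by rewrite /e mulr_ge0 ?powR_ge0//= mulrC -ler_pdivlMr.
have cds l : (l.+3 <= N n.+1)%N -> x n i <= x n.+1 l ->
    x n.+1 l.+3 <= x n i.+2 -> `|quad_cd n.+1 l| <= e.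
  move=> lN h1 h2; apply: (le_trans (cds' _ _ lN)); rewrite /e ler_wpM2l//.
  rewrite ge0_ler_powR ?nnegrE ?(ltW a1) ?(ltW wi)//; last exact: quad_width.
  by apply/ltW/(width_gt0 cg)/ltnW.
have r2 : `|node_lr n i| <= 2^-1.
  by apply: (le_trans rK); rewrite mulrC -ler_pdivlMr.
have [_ /(_ r2) H] := step n i e iN ee cds j ch.
have wq : width n i <= q - p.
  by apply: lerB; [exact: (grid_le cg)|apply: (grid_ge cg); exact/ltnW/ltnW].
have -> : node_lr n.+1 j / width n.+1 j - node_lr n i / width n i =
  (node_lr n.+1 j - width n.+1 j / width n i * node_lr n i) / width n.+1 j.
  by field; rewrite !gt_eqF.
rewrite normrM normfV [`|width n.+1 j|]gtr0_norm// ler_pdivrMr//.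
apply: (le_trans H).
set A := width n i `^ a; have A0 : 0 <= A by rewrite powR_ge0.
have p1 : C * e <= C * c * spread * A * width n.+1 j.
  rewrite /e powS// -/A.
  have := ler_wpM2r A0 (width_le_child ch).
  by move=> /(ler_wpM2l (ltW (mulr_gt0 C0 c0))); order_lra.
have wsplit : width n i <= A * (q - p) `^ (1 - a).
  have -> : width n i = A * width n i `^ (1 - a).
    by rewrite /A -powRD ?[a + _]addrC ?subrK ?powRr1 ?(ltW wi)// (gt_eqF wi) implybT.
  rewrite ler_wpM2l// ge0_ler_powR ?nnegrE ?(ltW wi) ?(ltW W0)//; order_lra.
have p2 : 10 * (width n.+1 j / width n i) * `|node_lr n i| ^+ 2 <=
   10 * K ^+ 2 * (q - p) `^ (1 - a) * A * width n.+1 j.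
  apply: (@le_trans _ _ (10 * (width n.+1 j / width n i) * (K * width n i) ^+ 2)).
    have th0 : 0 <= width n.+1 j / width n i by rewrite divr_ge0 ?(ltW wi) ?(ltW wj).
    apply: ler_wpM2l; first by apply: mulr_ge0.
    by apply: lerXn2r => //; rewrite nnegrE; apply: mulr_ge0; exact: ltW.
  have -> : 10 * (width n.+1 j / width n i) * (K * width n i) ^+ 2 =
    10 * K ^+ 2 * width n.+1 j * width n i by field; rewrite gt_eqF.
  have k0 : 0 <= 10 * K ^+ 2 * width n.+1 j.
    by apply: mulr_ge0 (ltW wj); apply: mulr_ge0 (sqr_ge0 _).
  by have := ler_wpM2l k0 wsplit; order_lra.
by order_lra.
Qed.

End Decay.

(** * Oscillation of functions on the tree of nodes *)

Section Diameter.
Context {R : realType} {B : R} {M : nat} {p q : R} {N : nat -> nat}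
  {x : nat -> nat -> R} (cg : cgrid B M p q N x).

Local Notation width := (@width R x).
Local Notation child := (@child R N x).
Local Notation lam := (@shrink R B).
Local Notation spread := (@spread R B M).

Let xi := cg_inc cg.

Lemma cgrid_shift n0 :
  cgrid B M p q (fun n => N (n + n0)) (fun n => x (n + n0)).
Proof.
split; first exact: cg_B cg.
- by move=> n; exact: cg_N cg _.
- by move=> n; exact: cg_p cg _.
- by move=> n; exact: cg_q cg _.
- by move=> n; exact: cg_inc cg _.
- by move=> n; exact: (@cg_ratio _ _ _ _ _ _ _ cg (n + n0)%N).
- by move=> n i iN; exact: (cg_cell cg iN).
Qed.

Lemma contains_cell n s t : p <= s -> s < t -> t <= q ->
  ~ (exists i, [/\ (i.+2 <= N n)%N, x n i <= s & t <= x n i.+2]) ->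
  exists l, [/\ (l < N n)%N, s <= x n l & x n l.+1 <= t].
Proof.
move=> ps st tq nw; have N2 := cg_N cg n.
have s0 : x n 0%N <= s by rewrite (cg_p cg).
have sN : s < x n (N n) by rewrite (cg_q cg) (lt_le_trans st).
have [i [iN h1 h2]] := locate s0 sN.
have [iN'|iN'] := leqP i.+2 (N n).
  exists i.+1; split=> //; first exact: ltW.
  by rewrite leNgt; apply/negP => h; apply: nw; exists i; split=> //; exact: ltW.
case: i iN h1 h2 iN' => [|i] iN h1 h2 iN'; first by lia.
exfalso; apply: nw; exists i; split=> //.
  by apply: le_trans h1; apply: (inc_le (@xi n)) => //; exact: ltnW.
by have -> : i.+2 = N n; [lia|rewrite (cg_q cg)].
Qed.

(** An interval is comparable to the smallest window that contains it: at the next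
    level no window contains it any more, so it contains a cell. *)
Lemma deepest_window s t : p <= s -> s < t -> t <= q ->
  (exists l, [/\ (l < N 0)%N, s <= x 0 l & x 0 l.+1 <= t]) \/
  exists n i l, [/\ (i.+2 <= N n)%N, x n i <= s, t <= x n i.+2 &
    [/\ (l < N n.+1)%N, s <= x n.+1 l & x n.+1 l.+1 <= t]].
Proof.
move=> ps st tq.
pose P n := exists i, [/\ (i.+2 <= N n)%N, x n i <= s & t <= x n i.+2].
have [P0|nP0] := pselect (P 0%N); last by left; exact: contains_cell.
right.
have [n [[i [iN h1 h2]] nPn]] : exists n, P n /\ ~ P n.+1.
  apply: contrapT => nex.
  have all n : P n.
    elim: n => // n IH; apply: contrapT => nP; apply: nex; by exists n.
  have ts0 : 0 < (t - s) / 2 by rewrite divr_gt0// subr_gt0.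
  have [n0 H] := width_pow_small cg ltr01 ts0.
  have [i [iN h1 h2]] := all n0.
  have := H n0 i (leqnn _) iN; rewrite powRr1; last exact/ltW/(width_gt0 cg).
  by rewrite /width; order_lra.
by have [l hl] := contains_cell ps st tq nPn; exists n, i, l.
Qed.

Lemma width_adj n i i' : (i.+2 <= N n)%N -> (i'.+2 <= N n)%N ->
  (i < i'.+2)%N -> (i' < i.+2)%N -> width n i' <= (1 + B) * width n i.
Proof.
move=> iN i'N ii' i'i; have B1 := cg_B cg.
have w0 := width_gt0 cg iN.
have [->|ne] := eqVneq i' i.
  by rewrite mulrDl mul1r lerDl mulr_ge0// ?(ltW w0)//; order_lra.
have [E|E] : i' = i.+1 \/ i = i'.+1 by clear -ne ii' i'i; lia.
  subst i'; have [h1 _] := cg_ratio cg i'N.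
  have h0 : x n i < x n i.+1 by apply: xi; exact: ltnW.
  have h2 : x n i.+1 < x n i.+2 by apply: xi.
  rewrite /width; have : B * (x n i.+2 - x n i.+1) <= B * (x n i.+2 - x n i).
    by rewrite ler_wpM2l//; order_lra.
  by order_lra.
subst i; have [_ h1] := cg_ratio cg i'N.
have h0 : x n i'.+2 < x n i'.+3 by apply: xi.
have h2 : x n i'.+1 < x n i'.+2 by apply: xi.
rewrite /width; have : B * (x n i'.+2 - x n i'.+1) <= B * (x n i'.+3 - x n i'.+1).
  by rewrite ler_wpM2l//; order_lra.
by order_lra.
Qed.

(** Following parents upwards from any small window inside [s, t], the oscillations
    sum up geometrically until the level at which the lengths are comparable to
    [t - s] ([deepest_window]). The windows of that level that are reached overlap, and
    overlapping nodes have a common child. *)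
Lemma node_osc (V : nat -> nat -> R) (C a : R) : 0 < a ->
  (forall n i j, child n i j -> `|V n.+1 j - V n i| <= C * width n i `^ a) ->
  exists2 C', 0 <= C' & forall s t, p <= s -> s < t -> t <= q ->
  exists c n1, forall m j, (n1 <= m)%N -> (j.+2 <= N m)%N ->
    s <= x m j -> x m j.+2 <= t -> `|V m j - c| <= C' * (t - s) `^ a.
Proof.
move=> a0 HV.
wlog C0 : C HV / 0 < C.
  move=> W; apply: (W (`|C| + 1)); last by have := normr_ge0 C; order_lra.
  move=> n i j ch; apply: (le_trans (HV n i j ch)); rewrite ler_wpM2r ?powR_ge0//.
  by have := ler_norm C; order_lra.
have C0' := ltW C0; have B1 := cg_B cg.
have /andP[m0 m1] := lam_pow_bounds cg a0; set mu := lam `^ a in m0 m1.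
have mu1 : 0 < 1 - mu by order_lra.
pose D := C / (1 - mu).
have D0 : 0 <= D by rewrite divr_ge0// ltW.
have DC : C = D * (1 - mu) by rewrite divfK// gt_eqF.
have chain n k j : (j.+2 <= N (k + n))%N -> exists i,
    [/\ (i.+2 <= N n)%N, x n i <= x (k + n)%N j, x (k + n)%N j.+2 <= x n i.+2 &
      `|V (k + n)%N j - V n i| <= D * (width n i `^ a - width (k + n) j `^ a)].
  elim: k j => [|k IH] j jN.
    by exists j; rewrite add0n !subrr normr0 mulr0 !lexx.
  have [i ch] := parent cg (jN : (j.+2 <= N (k + n).+1)%N).
  have [iN _ h1 h2] := ch.
  have [i' [i'N g1 g2 g3]] := IH i iN.
  exists i'; split=> //; first exact: le_trans g1 h1.
    exact: le_trans h2 g2.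
  rewrite -(subrKA (V (k + n)%N i)); apply: (le_trans (ler_normD _ _)).
  have := HV _ _ _ ch; rewrite DC => h3.
  have wi := width_gt0 cg iN; have wj := width_gt0 cg (jN : (j.+2 <= N (k + n).+1)%N).
  have h4 : width (k + n).+1 j `^ a <= mu * width (k + n) i `^ a.
    rewrite /mu -powRM ?(ltW wi) ?(ltW (shrink_gt0 cg))//.
    have := child_width cg ch => h4.
    apply: (ge0_ler_powR (ltW a0)) => //; rewrite nnegrE; first exact: ltW.
    exact: le_trans (ltW wj) h4.
  have := ler_wpM2l D0 h4 => h5.
  have -> : (k.+1 + n)%N = (k + n).+1 by [].
  by order_lra.
have s0 := spread_gt0 cg.
have W0 : 0 < q - p by rewrite subr_gt0 (pq_lt cg).
have [K K0 HK] := finite_bound (fun i => `|V 0%N i|) (N 0).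
have [G G0 HG] := finite_bound (fun i => (x 0 i.+1 - x 0 i)^-1) (N 0).
pose C1 := (K + D * (q - p) `^ a) * (G `^ a).
pose C2 := (C * (1 + (1 + B) `^ a) + D * (1 + B) `^ a) * spread `^ a.
have C10 : 0 <= C1 by rewrite !mulr_ge0 ?powR_ge0// addr_ge0// mulr_ge0// powR_ge0.
have C20 : 0 <= C2.
  rewrite /C2 mulr_ge0 ?powR_ge0//; apply: addr_ge0; apply: mulr_ge0 => //;
  by rewrite ?powR_ge0// addr_ge0// powR_ge0.
exists (C1 + C2); first exact: addr_ge0.
move=> s t ps st tq; have ts0 : 0 < t - s by rewrite subr_gt0.
have T0 : 0 <= (t - s) `^ a by rewrite powR_ge0.
have [[l [lN l1 l2]]|[n [i [l [iN i1 i2 [lN l1 l2]]]]]] := deepest_window ps st tq.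
  exists 0, 0%N => m j _ jN j1 j2; rewrite subr0.
  have [i [iN _ _]] := chain 0%N m j ltac:(by rewrite addn0); rewrite addn0 => h.
  apply: (@le_trans _ _ (C1 * (t - s) `^ a)); last by rewrite ler_wpM2r// lerDl.
  have wi := width_gt0 cg iN.
  have wq : width 0 i `^ a <= (q - p) `^ a.
    by have := width_pow_le cg iN (ltW a0); rewrite expr0 mul1r.
  have gap0 : 0 < x 0 l.+1 - x 0 l by rewrite subr_gt0; exact: xi.
  have one : 1 <= G `^ a * (t - s) `^ a.
    rewrite -powRM ?(ltW ts0)// -[leLHS](_ : 1 `^ a = 1); last by rewrite powR1.
    apply: (ge0_ler_powR (ltW a0)); rewrite ?nnegrE ?mulr_ge0 ?(ltW ts0)//.
    rewrite -(mulVf (lt0r_neq0 gap0)); apply: ler_pM; rewrite ?invr_ge0 ?(ltW gap0)//.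
      exact: HG.
    by order_lra.
  apply: (@le_trans _ _ (K + D * (q - p) `^ a)).
    rewrite -[V m j](subrK (V 0%N i)); apply: (le_trans (ler_normD _ _)).
    have := HK i (ltnW iN) => hk.
    have : D * width 0 i `^ a <= D * (q - p) `^ a by rewrite ler_wpM2l.
    have : 0 <= D * width m j `^ a by rewrite mulr_ge0// powR_ge0.
    by order_lra.
  have Z : 0 <= K + D * (q - p) `^ a by apply: addr_ge0 => //; apply: mulr_ge0 => //; exact: powR_ge0.
  by rewrite /C1 -mulrA ler_peMr.
exists (V n i), n => m j nm jN j1 j2.
have Em : m = (m - n + n)%N by clear -nm; lia.
have jN' : (j.+2 <= N (m - n + n))%N by rewrite -Em.
have [i' [i'N]] := chain n (m - n)%N j jN'; rewrite -Em => h1 h2 h3.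
have wi := width_gt0 cg iN; have wi' := width_gt0 cg i'N.
have jj : x m j < x m j.+2 by apply: (inc_lt (@xi m)).
have ii' : (i < i'.+2)%N.
  rewrite -(inc_ltE (@xi n))//; first by order_lra.
  exact/ltnW/ltnW.
have i'i : (i' < i.+2)%N.
  rewrite -(inc_ltE (@xi n))//; first by order_lra.
  exact/ltnW/ltnW.
have wadj := width_adj iN i'N ii' i'i.
have wpow : width n i' `^ a <= (1 + B) `^ a * width n i `^ a.
  rewrite -powRM ?(ltW wi)//; last by order_lra.
  by apply: (ge0_ler_powR (ltW a0)) => //; rewrite nnegrE ?(ltW wi')// mulr_ge0 ?(ltW wi)//; order_lra.
have osc : `|V n i' - V n i| <= C * (1 + (1 + B) `^ a) * width n i `^ a.
  have Z0 : 0 <= C * (1 + (1 + B) `^ a) * width n i `^ a.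
    by apply: mulr_ge0; rewrite ?powR_ge0//; apply: mulr_ge0; rewrite ?addr_ge0 ?powR_ge0.
  have [->|ne] := eqVneq i' i; first by rewrite subrr normr0.
  have [j' [c1 c2]] : exists j', child n i j' /\ child n i' j'.
    have [E|E] : i' = i.+1 \/ i = i'.+1 by clear -ne ii' i'i; lia.
      by subst i'; exact: (common_child cg i'N).
    by subst i; have [j' [c1 c2]] := common_child cg iN; exists j'.
  have g1 := HV _ _ _ c1; have g2 := HV _ _ _ c2.
  have := ler_wpM2l C0' wpow.
  have : `|V n i' - V n i| <= `|V n.+1 j' - V n i'| + `|V n.+1 j' - V n i|.
    rewrite -(subrKA (V n.+1 j')) -[`|V n.+1 j' - V n i'|]normrN opprB.
    exact: ler_normD.
  by order_lra.
have fin : width n i `^ a <= spread `^ a * (t - s) `^ a.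
  rewrite -powRM ?(ltW s0) ?(ltW ts0)//.
  have h : width n i <= spread * (t - s).
    apply: (le_trans (width_le_cell cg iN lN (le_trans i1 l1) (le_trans l2 i2))).
    by rewrite ler_pM2l//; order_lra.
  apply: (ge0_ler_powR (ltW a0)) => //; rewrite nnegrE ?(ltW wi)//.
  exact: le_trans (ltW wi) h.
apply: (@le_trans _ _ (C2 * (t - s) `^ a)); last by rewrite ler_wpM2r// lerDr.
apply: (@le_trans _ _ ((C * (1 + (1 + B) `^ a) + D * (1 + B) `^ a) * width n i `^ a)).
  have : `|V m j - V n i| <= `|V m j - V n i'| + `|V n i' - V n i|.
    by rewrite -(subrKA (V n i')); exact: ler_normD.
  have := ler_wpM2l D0 wpow.
  have : 0 <= D * width m j `^ a by rewrite mulr_ge0// powR_ge0.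
  by order_lra.
rewrite /C2 -mulrA ler_wpM2l//; apply: addr_ge0; apply: mulr_ge0 => //;
by rewrite ?powR_ge0// addr_ge0// powR_ge0.
Qed.

End Diameter.

(** * Secants as limits of slopes of cells *)

Definition cont_on (R : realType) (p q : R) (f : R -> R) :=
  forall u, p <= u <= q -> forall e, 0 < e ->
  exists2 d, 0 < d & forall v, p <= v <= q -> `|v - u| <= d -> `|f v - f u| <= e.

Section Secants.
Context {R : realType} {B : R} {M : nat} {p q : R} {N : nat -> nat}
  {x : nat -> nat -> R} (cg : cgrid B M p q N x).
Context {h : R -> R} (hi : increasing_on p q h).

Local Notation width := (@width R x).
Local Notation child := (@child R N x).
Local Notation node_lr := (@node_lr R x h).

Let xi := cg_inc cg.

Lemma cell_small d : 0 < d -> exists n0, forall n l, (n0 <= n)%N ->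
  (l < N n)%N -> x n l.+1 - x n l <= d.
Proof.
move=> d0; have [n0 H] := width_pow_small cg ltr01 d0.
exists n0 => n l nn lN; have N2 := cg_N cg n.
have [i [iN i1 i2]] : exists i, [/\ (i.+2 <= N n)%N, (i <= l)%N & (l.+1 <= i.+2)%N].
  have [h1|h1] := leqP l.+2 (N n); first by exists l.
  by exists l.-1; split; clear -h1 lN N2; lia.
have := H n i nn iN; rewrite powRr1 ?(ltW (width_gt0 cg iN))//.
apply: le_trans; rewrite /width; apply: lerB; apply: (inc_le (@xi n)) => //.
exact: ltnW.
Qed.

Lemma grid_approx s t d n1 : p <= s -> s < t -> t <= q -> 0 < d ->
  exists m j k, [/\ (n1 <= m)%N, (j < k)%N, (k.+1 <= N m)%N &
    [/\ s <= x m j, x m j.+1 <= s + d, x m k.+1 <= t & t - d <= x m k]].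
Proof.
move=> ps st tq d0.
have d1 : 0 < Num.min (d / 2) ((t - s) / 8).
  by rewrite lt_min !divr_gt0// subr_gt0.
have [n0 H] := cell_small d1.
pose m := (n0 + n1)%N; have Hm l := H m l (leq_addr _ _).
have {}Hm l : (l < N m)%N -> x m l.+1 - x m l <= d / 2 /\ x m l.+1 - x m l <= (t - s) / 8.
  by move=> /Hm; rewrite le_min => /andP[].
have s0 : x m 0%N <= s by rewrite (cg_p cg).
have sN : s < x m (N m) by rewrite (cg_q cg) (lt_le_trans st).
have [i [iN h1 h2]] := locate s0 sN.
have [i1 [i1N g1 g2 g3]] : exists i1, [/\ (i1 <= N m)%N, x m i1 <= t, t - x m i1 <= d / 2 &
    t - x m i1 <= (t - s) / 8].
  move: tq; rewrite le_eqVlt => /predU1P[tE|tq].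
    by exists (N m); rewrite (cg_q cg) -tE subrr; split=> //; order_lra.
  have t0 : x m 0%N <= t by rewrite (cg_p cg); order_lra.
  have tN : t < x m (N m) by rewrite (cg_q cg).
  have [i1 [i1N f1 f2]] := locate t0 tN.
  by exists i1; have := Hm _ i1N; split=> //; [exact: ltnW|order_lra|order_lra].
have [a1 a2] := Hm i iN.
have i1i : (i.+3 < i1)%N.
  rewrite ltnNge; apply/negP => le.
  have e3 : x m i1 <= x m i + 3 * ((t - s) / 8).
    apply: (@le_trans _ _ (x m (minn i.+3 (N m)))).
      by apply: (inc_le (@xi m)); clear -le i1N; lia.
    have : x m (i + (minn i.+3 (N m) - i))%N - x m i <= (minn i.+3 (N m) - i)%:R * ((t - s) / 8).
      apply: sum_gaps => l lN; apply: (Hm _ _).2; clear -lN; lia.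
    have -> : (i + (minn i.+3 (N m) - i))%N = minn i.+3 (N m) by clear -iN; lia.
    have : (minn i.+3 (N m) - i)%:R <= 3 :> R by rewrite ler_nat; clear; lia.
    move=> g4 g5; have ts : 0 <= (t - s) / 8 by rewrite divr_ge0// subr_ge0 ltW.
    by have := ler_wpM2r ts g4; order_lra.
  by order_lra.
case: i1 => [|k] in i1N g1 g2 g3 i1i *; first by [].
have [b1 b2] := Hm k i1N.
have [c1 c2] := Hm i.+1 ltac:(clear -i1i i1N; lia).
exists m, i.+1, k; split; [exact: leq_addl|clear -i1i; lia|exact: i1N|].
by split=> //; order_lra.
Qed.

(** By continuity the secant is the limit of secants with endpoints in the grid,
    and these are weighted means of slopes of cells. *)
Lemma secant_limit (e1 e2 : R) n1 s t : cont_on p q h -> p <= s -> s < t -> t <= q ->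
  (forall m j, (n1 <= m)%N -> (j.+2 <= N m)%N -> s <= x m j -> x m j.+2 <= t ->
     e1 <= sec h (x m j) (x m j.+1) <= e2) ->
  forall s1 t1, s <= s1 -> s1 < t1 -> t1 <= t -> e1 <= sec h s1 t1 <= e2.
Proof.
move=> hc ps st tq H s1 t1 ss1 st1 tt1.
have ts0 : 0 < t1 - s1 by rewrite subr_gt0.
rewrite /sec ler_pdivlMr// ler_pdivrMr//.
have key e : 0 < e -> e1 * (t1 - s1) - e <= h t1 - h s1 <= e2 * (t1 - s1) + e.
  move=> e0.
  have e4 : 0 < e / 4 by order_lra.
  have [|ds ds0 Hs] := hc s1 _ _ e4; first by order_lra.
  have [|dt dt0 Ht] := hc t1 _ _ e4; first by order_lra.
  pose E := `|e1| + `|e2| + 1.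
  have E0 : 0 < E by rewrite /E; have := normr_ge0 e1; have := normr_ge0 e2; order_lra.
  have d0 : 0 < Num.min (e / (4 * E)) (Num.min ds dt).
    by rewrite !lt_min ds0 dt0 divr_gt0// mulr_gt0.
  have [m [j [k [m1 jk kN [f1 f2 f3 f4]]]]] := @grid_approx s1 t1 _ n1 ltac:(order_lra) st1 ltac:(order_lra) d0.
  have {}f2 : x m j <= s1 + Num.min (e / (4 * E)) (Num.min ds dt).
    by apply: le_trans f2; apply: (inc_le (@xi m)) => //; apply: leq_trans kN; exact: ltnW.
  set d := Num.min _ _ in d0 f2 f4.
  have dE : d * E <= e / 4.
    have : d <= e / (4 * E) by rewrite /d ge_min lexx.
    by rewrite invfM mulrA ler_pdivlMr.
  have dds : d <= ds by rewrite /d !ge_min lexx !orbT.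
  have ddt : d <= dt by rewrite /d !ge_min lexx !orbT.
  have kk : x m k <= x m k.+1 by apply: (inc_le (@xi m)).
  have jk' : x m j < x m k by apply: (inc_lt (@xi m)) => //; exact: ltnW.
  have inc : e1 * (x m k - x m j) <= (h \o x m) k - (h \o x m) j <= e2 * (x m k - x m j).
    apply: increment_between; first exact: ltnW.
      by move=> l hl; apply: xi; clear -hl kN; lia.
    move=> l hl; apply: (H m l) => //; first by clear -hl kN; lia.
      by apply: le_trans (_ : x m j <= _); [order_lra|apply: (inc_le (@xi m)); clear -hl kN; lia].
    by apply: le_trans (_ : _ <= x m k.+1) _; [apply: (inc_le (@xi m)); clear -hl kN; lia|order_lra].
  have /andP[i1 i2] := inc; rewrite /= in i1 i2.
  have := Hs (x m j) ltac:(order_lra) ltac:(rewrite ler_norml; order_lra).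
  have := Ht (x m k) ltac:(order_lra) ltac:(rewrite ler_norml; order_lra).
  rewrite !ler_norml => /andP[g1 g2] /andP[g3 g4].
  pose u := (t1 - s1) - (x m k - x m j).
  have u0 : 0 <= u by rewrite /u; order_lra.
  have u1 : u <= 2 * d by rewrite /u; order_lra.
  have b e' : `|e'| <= E -> `|e' * u| <= e / 2.
    move=> eE; rewrite normrM (ger0_norm u0).
    have : `|e'| * u <= E * (2 * d) by apply: ler_pM.
    by order_lra.
  have := b e1 ltac:(rewrite /E; have := normr_ge0 e2; order_lra).
  have := b e2 ltac:(rewrite /E; have := normr_ge0 e1; order_lra).
  rewrite !ler_norml => /andP[b1 b2] /andP[b3 b4].
  have E1 : e1 * (t1 - s1) = e1 * (x m k - x m j) + e1 * u by rewrite /u; ring.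
  have E2 : e2 * (t1 - s1) = e2 * (x m k - x m j) + e2 * u by rewrite /u; ring.
  by apply/andP; split; order_lra.
apply/andP; split; apply/ler_addgt0Pr => e e0; have := key e e0; order_lra.
Qed.

(** [node_osc] for the logarithms of slopes of cells: between a node and a child
    there are boundedly many adjacent pairs of cells, each contributing one ratio
    distortion. *)
Lemma slopes_holder (K a : R) : 0 < a -> cont_on p q h ->
  (forall n i, (i.+2 <= N n)%N -> `|node_lr n i| <= K * width n i `^ a) ->
  exists2 C, 0 <= C & forall s t, p <= s -> s < t -> t <= q -> exists c,
    forall s1 t1, s <= s1 -> s1 < t1 -> t1 <= t ->
      logclose (C * (t - s) `^ a) (sec h s1 t1) (expR c).
Proof.
move=> a0 hc Hr.
wlog K0 : K Hr / 0 <= K.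
  move=> W; apply: (W `|K|) => //.
  move=> n i iN; apply: (le_trans (Hr n i iN)); rewrite ler_wpM2r ?powR_ge0//.
  exact: ler_norm.
pose V n i := ln (sec h (x n i) (x n i.+1)).
have [C C0 HC] : exists2 C, 0 <= C & forall s t, p <= s -> s < t -> t <= q ->
    exists c n1, forall m j, (n1 <= m)%N -> (j.+2 <= N m)%N ->
      s <= x m j -> x m j.+2 <= t -> `|V m j - c| <= C * (t - s) `^ a.
  apply: (node_osc cg (C := (M + M)%:R * K)) => // n i j [iN jN hj1 hj2].
  have [j0 [k1 [k2 [h1 h2 h3 [e1 e2 e3]]]]] := window cg iN.
  have wi := width_gt0 cg iN.
  have Lr l : (j0 <= l)%N -> (l.+2 <= j0 + k1 + k2)%N ->
      logclose (K * width n i `^ a) (sec h (x n.+1 l) (x n.+1 l.+1))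
         (sec h (x n.+1 l.+1) (x n.+1 l.+2)).
    move=> l1 l2; have lN : (l.+2 <= N n.+1)%N by apply: leq_trans h3.
    have p1 := grid_sec_gt0 cg hi (ltnSn l) (ltnW lN).
    have p2 := grid_sec_gt0 cg hi (ltnSn l.+1) lN.
    apply/logcloseW => //; rewrite distrC -ln_div ?posrE//.
    apply: (le_trans (Hr n.+1 l lN)); rewrite ler_wpM2l//.
    apply: (ge0_ler_powR (ltW a0)); rewrite ?nnegrE ?(ltW wi) ?(ltW (width_gt0 cg lN))//.
    rewrite /width -e1 -e3; apply: lerB; apply: (inc_le (@xi n.+1)) => //.
    by clear -l1 h1 h2 l2 lN; lia.
  move: hj1 hj2; rewrite -e1 -e3 !(inc_leE (@xi n.+1))//; try (clear -h3 jN h1 h2; lia).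
  move=> hj1 hj2.
  pose z k := x n.+1 (j0 + k)%N.
  have zi : increasing_upto (k1 + k2) z.
    by move=> k kK; rewrite /z addnS; apply: xi; clear -kK h3; lia.
  have Hi : increasing_upto (k1 + k2) (h \o z).
    move=> k kK /=; apply: hi; last 1 first.
    - by apply: (grid_le cg); clear -kK h3; lia.
    - by apply: (grid_ge cg); clear -kK h3; lia.
    - exact: zi.
  have r0 : 0 <= K * width n i `^ a by rewrite mulr_ge0// powR_ge0.
  have Hs l : (l.+1 < k1 + k2)%N -> logclose (K * width n i `^ a)
      (slope z (h \o z) l l.+1) (slope z (h \o z) l.+1 l.+2).
    move=> lK; have := Lr (j0 + l)%N (leq_addr _ _) ltac:(clear -lK; lia).
    by rewrite -!addnS.
  have := slopes_logclose zi Hi r0 Hs (i := (j - j0)%N) (j := (j - j0).+1) (i' := 0%N) (j' := k1).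
  move=> /(_ ltac:(clear -hj1 hj2; lia) ltac:(clear -h1; lia)).
  rewrite /slope /z /= addnS subnKC// addn0 e1 e2 => L.
  have p1 := grid_sec_gt0 cg hi (ltnSn j) (ltnW jN).
  have p2 := grid_sec_gt0 cg hi (ltnSn i) (ltnW iN).
  have {L} := (logcloseW _ p1 p2).1 L => /le_trans; apply.
  rewrite -mulrA ler_wpM2r// ler_nat; clear -h1 h2; lia.
exists C => // s t ps st tq.
have [c [n1 H]] := HC s t ps st tq; exists c => s1 t1 ss1 st1 tt1.
set eta := C * (t - s) `^ a in H *.
have lim : expR (c - eta) <= sec h s1 t1 <= expR (c + eta).
  apply: (secant_limit (n1 := n1) hc ps st tq) => // m j nm jN sj jt.
  have p1 := grid_sec_gt0 cg hi (ltnSn j) (ltnW jN).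
  have := H m j nm jN sj jt; rewrite ler_norml /V => /andP[h1 h2].
  rewrite -[sec h _ _](lnK p1) !ler_expR; order_lra.
move: lim; rewrite expRB expRD => /andP[l1 l2]; split; first by rewrite mulrC.
by move: l1; rewrite ler_pdivrMr ?expR_gt0// mulrC.
Qed.

End Secants.

(** * Derivatives relative to an interval *)

Section Derivatives.
Context {R : realType}.
Implicit Types (p q u l a : R) (f g : R -> R).

Lemma itvccP p q u : `[p, q]%classic u <-> p <= u <= q.
Proof. by rewrite /= in_itv. Qed.

Lemma sec_sym f u v : sec f u v = sec f v u.
Proof. by rewrite /sec -[f v - f u]opprB -[v - u]opprB invrN mulrNN. Qed.

(** The derivative relative to [p, q], with explicit tolerances; [has_derivP]
    identifies it with a limit of difference quotients. *)
Definition has_deriv p q f u l := forall e, 0 < e -> exists2 d, 0 < d &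
  forall y, p <= y <= q -> y != u -> `|y - u| < d -> `|sec f u y - l| <= e.

Lemma near_withinP p q u (P : set R) :
  (within `[p, q]%classic u^') P <-> exists2 d, 0 < d &
    forall y, p <= y <= q -> y != u -> `|y - u| < d -> P y.
Proof.
rewrite /within /= /dnbhs /within /=; split.
  move=> /nbhs_ballP[d /= d0 H]; exists d => // y yI yu yd.
  by apply: H; rewrite ?in_itv// /ball/= distrC.
move=> [d d0 H]; apply/nbhs_ballP; exists d => //= y; rewrite /ball/= distrC => yd yu.
by rewrite in_itv/= => yI; exact: H.
Qed.

Lemma within_proper p q u : p < q -> p <= u <= q ->
  ProperFilter (within `[p, q]%classic u^').
Proof.
move=> pq /andP[pu uq].
have FF : Filter (within `[p, q]%classic u^') by exact: within_filter.
apply: Build_ProperFilter_ex => P /near_withinP[d d0 H].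
have [uq'|qu] := ltP u q.
  have m0 : 0 < Num.min (d / 2) (q - u) by rewrite lt_min divr_gt0// subr_gt0.
  exists (u + Num.min (d / 2) (q - u)); apply: H.
  - have : Num.min (d / 2) (q - u) <= q - u by rewrite ge_min lexx orbT.
    by move=> ?; apply/andP; split; lra.
  - by rewrite gt_eqF// ltrDl.
  - rewrite addrAC subrr add0r gtr0_norm//.
    by rewrite gt_min; apply/orP; left; lra.
have m0 : 0 < Num.min (d / 2) (u - p) by rewrite lt_min divr_gt0//; lra.
exists (u - Num.min (d / 2) (u - p)); apply: H.
- have : Num.min (d / 2) (u - p) <= u - p by rewrite ge_min lexx orbT.
  by move=> ?; apply/andP; split; lra.
- by rewrite lt_eqF// gtrDl oppr_lt0.
- rewrite addrAC subrr add0r normrN gtr0_norm//.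
  by rewrite gt_min; apply/orP; left; lra.
Qed.

Lemma has_derivP p q f u l :
  diff_quotient f u @ within `[p, q]%classic u^' --> l <-> has_deriv p q f u l.
Proof.
have FF : Filter (within `[p, q]%classic u^') by exact: within_filter.
split.
  move=> /cvgrPdist_le H e e0.
  have /near_withinP[d d0 Hd] := H e e0.
  by exists d => // y yI yu yd; rewrite distrC; exact: Hd.
move=> H; apply/cvgrPdist_le => e e0; apply/near_withinP.
have [d d0 Hd] := H e e0; exists d => // y yI yu yd.
by rewrite distrC; exact: Hd.
Qed.

Lemma derivable_inP p q f u : derivable_in `[p, q]%classic f u <->
  exists l, has_deriv p q f u l.
Proof.
split; first by move=> /cvg_ex[l /has_derivP hl]; exists l.
by move=> [l /has_derivP hl]; apply/cvg_ex; exists l.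
Qed.

Lemma derive_inE p q f u l : p < q -> p <= u <= q -> has_deriv p q f u l ->
  derive_in `[p, q]%classic f u = l.
Proof.
move=> pq uI /has_derivP hl; have PF := within_proper pq uI.
exact: cvg_lim.
Qed.

Lemma derive_in_deriv p q f u : p < q -> p <= u <= q ->
  derivable_in `[p, q]%classic f u ->
  has_deriv p q f u (derive_in `[p, q]%classic f u).
Proof.
by move=> pq uI /derivable_inP[l hl]; rewrite (derive_inE pq uI hl).
Qed.

Lemma has_deriv_ext p q f g u l : (forall y, p <= y <= q -> f y = g y) ->
  p <= u <= q -> has_deriv p q f u l -> has_deriv p q g u l.
Proof.
move=> fg uI H e e0; have [d d0 Hd] := H e e0; exists d => // y yI yu yd.
by have := Hd y yI yu yd; rewrite /sec !fg.
Qed.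

Lemma has_deriv_sub p q p' q' f u l : p <= p' -> q' <= q ->
  has_deriv p q f u l -> has_deriv p' q' f u l.
Proof.
move=> pp qq H e e0; have [d d0 Hd] := H e e0; exists d => // y /andP[h1 h2].
by apply: Hd; apply/andP; split; lra.
Qed.

Lemma has_derivN p q f u l : has_deriv p q f u l ->
  has_deriv p q (fun y => - f y) u (- l).
Proof.
move=> H e e0; have [d d0 Hd] := H e e0; exists d => // y yI yu yd.
have -> : sec (fun y => - f y) u y - - l = - (sec f u y - l).
  by rewrite /sec -opprD mulNr; ring.
by rewrite normrN; exact: Hd.
Qed.

(** A Holder condition on the derivative that does not mention it; the constant
    [c] may depend on the interval [s, t]. *)
Definition secant_holder a p q f := exists2 C, 0 <= C &
  forall s t, p <= s -> s < t -> t <= q -> exists c,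
  forall s1 t1, s <= s1 -> s1 < t1 -> t1 <= t ->
    `|sec f s1 t1 - c| <= C * (t - s) `^ a.

(** Close to a point all secants are close to each other, so the difference
    quotients satisfy the Cauchy criterion, and the estimate passes to the limit. *)
Lemma secant_holder_deriv a p q f : 0 < a -> p < q -> secant_holder a p q f ->
  exists C (f' : R -> R), [/\ 0 <= C,
    forall u, p <= u <= q -> has_deriv p q f u (f' u),
    forall s t, p <= s -> s < t -> t <= q ->
      forall s1 t1 u, s <= s1 -> s1 < t1 -> t1 <= t -> s <= u <= t ->
      `|sec f s1 t1 - f' u| <= C * (t - s) `^ a &
    forall u v, p <= u <= q -> p <= v <= q ->
      `|f' u - f' v| <= C * `|u - v| `^ a].
Proof.
move=> a0 pq [C C0 H].
have a0' := ltW a0.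
(* The points of [p, q] close to [u] lie in a short interval on which the secants
   are compared. *)
have nb u d : p <= u <= q -> 0 < d -> exists s t,
    [/\ p <= s, s < t, t <= q & [/\ s <= u <= t, t - s <= 2 * d &
      forall y, p <= y <= q -> `|y - u| < d -> s <= y <= t]].
  move=> /andP[pu uq] d0; exists (Num.max p (u - d)), (Num.min q (u + d)).
  have t1 : Num.min q (u + d) <= u + d by rewrite ge_min lexx orbT.
  have s1 : u - d <= Num.max p (u - d) by rewrite le_max lexx orbT.
  split.
  - by rewrite le_max lexx.
  - by rewrite gt_max !lt_min; apply/andP; split; apply/andP; split; lra.
  - by rewrite ge_min lexx.
  split.
  - by rewrite ge_max le_min; apply/andP; split; apply/andP; split; lra.
  - lra.
  - move=> y /andP[py yq]; rewrite ltr_norml => /andP[h1 h2].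
    by rewrite ge_max le_min; apply/andP; split; apply/andP; split; lra.
have small e : 0 < e -> exists2 d, 0 < d & forall r, 0 <= r -> r <= 2 * d -> C * r `^ a <= e.
  move=> e0; have e1 : 0 < e / (C + 1) by rewrite divr_gt0//; lra.
  exists ((e / (C + 1)) `^ a^-1 / 2); first by rewrite divr_gt0// powR_gt0.
  move=> r r0 rd; have : r `^ a <= ((e / (C + 1)) `^ a^-1) `^ a.
    by apply: (ge0_ler_powR a0'); rewrite ?nnegrE ?powR_ge0//; lra.
  rewrite -powRrM mulVf ?gt_eqF// powRr1 ?(ltW e1)// => h.
  apply: (@le_trans _ _ (C * (e / (C + 1)))); first by rewrite ler_wpM2l.
  by rewrite mulrA ler_pdivrMr; [rewrite mulrC ler_pM2l|]; lra.
pose f' u := lim (diff_quotient f u @ within `[p, q]%classic u^').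
have df u : p <= u <= q -> has_deriv p q f u (f' u).
  move=> uI; have PF := within_proper pq uI; apply/has_derivP.
  apply: cauchy_cvg; apply: cauchy_exP => e /= e0.
  have [d d0 Hd] := small (e / 2) ltac:(lra).
  have [s [t [ps st tq [su ts yst]]]] := nb u d uI d0.
  have [c Hc] := H s t ps st tq; exists c.
  suff : (within `[p, q]%classic u^') (fun y => ball c e (diff_quotient f u y)) by [].
  apply/near_withinP; exists d => // y yI yu yd.
  have /andP[sy yt] := yst y yI yd; case/andP: su => su ut.
  have C1 := Hd (t - s) ltac:(lra) ts.
  rewrite /ball /= distrC.
  have [uy|yu'|E] := ltgtP u y; last by rewrite E eqxx in yu.
    by have := Hc u y su uy yt => h; apply: le_lt_trans h _; lra.
  by rewrite [diff_quotient _ _ _]sec_sym; have := Hc y u sy yu' ut => h; apply: le_lt_trans h _; lra.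
have close s t u c : p <= s -> s < t -> t <= q -> s <= u <= t ->
    (forall s1 t1, s <= s1 -> s1 < t1 -> t1 <= t -> `|sec f s1 t1 - c| <= C * (t - s) `^ a) ->
    `|f' u - c| <= C * (t - s) `^ a.
  move=> ps st tq /andP[su ut] Hc; apply/ler_addgt0Pr => e e0.
  have uI : p <= u <= q by apply/andP; split; lra.
  have dst : has_deriv s t f u (f' u) by apply: has_deriv_sub (df u uI).
  have [d d0 Hd] := dst e e0.
  have PF := @within_proper s t u st ltac:(apply/andP; split; lra).
  have : (within `[s, t]%classic u^') (fun y => [/\ s <= y <= t, y != u & `|y - u| < d]).
    by apply/near_withinP; exists d.
  move=> /filter_ex[y [/andP[sy yt] yu yd]].
  have h1 := Hd y ltac:(apply/andP; split; lra) yu yd.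
  have h2 : `|sec f u y - c| <= C * (t - s) `^ a.
    have [uy|yu'|E] := ltgtP u y; last by rewrite E eqxx in yu.
      by apply: Hc.
    by rewrite sec_sym; apply: Hc.
  have : `|f' u - c| <= `|sec f u y - f' u| + `|sec f u y - c|.
    by rewrite -(subrKA (sec f u y)) [X in _ <= X + _]distrC; exact: ler_normD.
  by lra.
exists (2 * C), f'; split=> //.
- by rewrite mulr_ge0.
- move=> s t ps st tq s1 t1 u ss1 st1 tt1 su.
  have [c Hc] := H s t ps st tq.
  have h1 := close s t u c ps st tq su Hc; have h2 := Hc s1 t1 ss1 st1 tt1.
  have : `|sec f s1 t1 - f' u| <= `|sec f s1 t1 - c| + `|f' u - c|.
    by rewrite -(subrKA c) [X in _ <= _ + X]distrC; exact: ler_normD.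
  by rewrite -mulrA; lra.
- move=> u v; wlog uv : u v / u <= v.
    move=> W uI vI; have [h|h] := leP u v; first exact: W.
    by rewrite distrC [`|u - v|]distrC; apply: W => //; exact: ltW.
  move=> /andP[pu uq] /andP[pv vq].
  move: uv; rewrite le_eqVlt => /predU1P[->|uv].
    by rewrite !subrr normr0 mulr_ge0 ?powR_ge0// mulr_ge0.
  have [c Hc] := H u v pu uv vq.
  have h1 := close u v u c pu uv vq ltac:(by rewrite lexx ltW) Hc.
  have h2 := close u v v c pu uv vq ltac:(by rewrite lexx ltW) Hc.
  have : `|f' u - f' v| <= `|f' u - c| + `|f' v - c|.
    by rewrite -(subrKA c) [X in _ <= _ + X]distrC; exact: ler_normD.
  by rewrite [`|u - v|]distrC [`|v - u|]gtr0_norm ?subr_gt0// -mulrA; lra.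
Qed.

End Derivatives.

(** * Differentiability from the ratio distortion *)

Lemma logclose_dist {R : realType} (eta eta0 S s E : R) :
  0 <= eta <= eta0 -> 0 < s -> s <= S -> logclose eta s E ->
  `|s - E| <= eta * expR eta0 * S.
Proof.
move=> /andP[eta_ge0 eta_le] s0 sS [l1 l2].
have e1 : 1 - eta <= expR (- eta) by have := expR_ge1Dx (- eta).
have eg := expR_gt0 eta; have eng := expR_gt0 (- eta).
have ele : expR eta <= expR eta0 by rewrite ler_expR.
have e1' : 1 <= expR eta by rewrite -[leLHS]expR0 ler_expR.
have up : s - E <= eta * s.
  have := ler_wpM2l (ltW eng) l1; rewrite [leRHS]mulrA -expRD addNr expR0 mul1r.
  by have := ler_wpM2r (ltW s0) e1; order_lra.
have lo : E - s <= eta * expR eta * s.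
  have := ler_wpM2l (ltW eg) e1; rewrite -expRD subrr expR0 => e2.
  by have := ler_wpM2r (ltW s0) e2; order_lra.
have b2 : eta * expR eta * s <= eta * expR eta0 * S.
  by rewrite -!mulrA ler_wpM2l//; apply: ler_pM => //; exact: ltW.
have b1 : eta * s <= eta * expR eta * s.
  by rewrite -mulrA ler_wpM2l// ler_peMl// ltW.
by rewrite ler_norml; apply/andP; split; order_lra.
Qed.

(** From [1 - x^-1 <= ln x <= x - 1] at [x = b / a]. *)
Lemma ln_ratio_linear {R : realType} (a b m E : R) : 0 < a -> 0 < m -> m <= b ->
  `|b - a| <= E -> `|b - a - a * ln (b / a)| <= E ^+ 2 / m.
Proof.
move=> a0 m0 mb abE; have b0 : 0 < b by exact: lt_le_trans mb.
have q0 : 0 < b / a by rewrite divr_gt0.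
have lo : 0 <= b - a - a * ln (b / a).
  have : ln (1 + (b / a - 1)) <= b / a - 1 by apply: le_ln1Dx; lra.
  rewrite [1 + _]addrC subrK => /(ler_wpM2l (ltW a0)).
  by have -> : a * (b / a - 1) = b - a; [field; rewrite gt_eqF|lra].
have up : b - a - a * ln (b / a) <= (b - a) ^+ 2 / b.
  have := ln_ge_frac q0; rewrite invf_div => /(ler_wpM2l (ltW a0)).
  have -> : (b - a) ^+ 2 / b = b - a - a * (1 - a / b) by field; rewrite gt_eqF.
  by lra.
rewrite ger0_norm//; apply: (le_trans up); rewrite ler_pdivrMr//.
have sq : (b - a) ^+ 2 <= E ^+ 2.
  rewrite -[leLHS]real_normK ?num_real//; apply: lerXn2r => //.
  by rewrite nnegrE (le_trans (normr_ge0 _) abE).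
apply: (le_trans sq); rewrite mulrAC ler_pdivlMr// ler_wpM2l ?sqr_ge0//.
Qed.

Section Smoothness.
Context {R : realType} {B : R} {M : nat} {p q : R} {N : nat -> nat}
  {x : nat -> nat -> R} (cg : cgrid B M p q N x).
Context {h : R -> R} (hi : increasing_on p q h) (hc : @cont_on R p q h).

Local Notation width := (@width R x).
Local Notation child := (@child R N x).
Local Notation node_lr := (@node_lr R x h).

Let xi := cg_inc cg.

(** Exponentiating [slopes_holder]: on a bounded set of slopes, closeness of
    logarithms and closeness of values are equivalent. *)
Lemma secant_holder_of_lr (K a : R) : 0 < a ->
  (forall n i, (i.+2 <= N n)%N -> `|node_lr n i| <= K * width n i `^ a) ->
  secant_holder a p q h /\ exists2 m, 0 < m &
    forall s t, p <= s -> s < t -> t <= q -> m <= sec h s t.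
Proof.
move=> a0 Hr; have [C C0 H] := slopes_holder cg hi a0 hc Hr.
have pq := pq_lt cg.
have [c0 H0] := H p q (lexx _) pq (lexx _).
set eta0 := C * (q - p) `^ a in H0.
have eta00 : 0 <= eta0 by rewrite /eta0 mulr_ge0// powR_ge0.
pose S := expR eta0 * expR c0.
have S0 : 0 <= S by rewrite mulr_ge0// ltW ?expR_gt0.
split; last first.
  exists ((expR eta0)^-1 * expR c0); first by rewrite mulr_gt0 ?invr_gt0 ?expR_gt0.
  move=> s t ps st tq; have [_ h2] := H0 s t ps st tq.
  by rewrite ler_pdivrMl ?expR_gt0.
exists (C * expR eta0 * S); first by rewrite !mulr_ge0// ltW ?expR_gt0.
move=> s t ps st tq; have [c Hc] := H s t ps st tq.
exists (expR c) => s1 t1 ss1 st1 tt1; have [l1 l2] := Hc s1 t1 ss1 st1 tt1.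
have ps1 := le_trans ps ss1; have t1q := le_trans tt1 tq.
have [u1 _] := H0 s1 t1 ps1 st1 t1q.
have s0 : 0 < sec h s1 t1 := sec_gt0 hi ps1 st1 t1q.
set eta := C * (t - s) `^ a in l1 l2.
have eta_ge0 : 0 <= eta by rewrite /eta mulr_ge0// powR_ge0.
have eta_le : eta <= eta0.
  rewrite /eta ler_wpM2l//; apply: (ge0_ler_powR (ltW a0)); rewrite ?nnegrE ?subr_ge0 ?(ltW pq) ?(ltW st)//.
  exact: lerB.
have -> : C * expR eta0 * S * (t - s) `^ a = eta * expR eta0 * S by rewrite /eta; ring.
by apply: logclose_dist => //; rewrite eta_ge0.
Qed.

(** By [node_osc], the function [lr / width] is within [O((t - s)^a)] of a constant
    [c] over the nodes in [s, t]. Summing over a fine level shows that the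
    logarithm of the derivative [f] has secants within the same distance of [2 c]:
    the midpoints of the two cells of a node are at distance [width / 2]. The
    secants of [f] itself follow by exponentiating, the derivative being
    Lipschitz and bounded away from 0. *)
Lemma secant_holder_of_curvature (K K' a : R) (f : R -> R) (C m : R) :
  0 < a <= 1 ->
  (forall n i, (i.+2 <= N n)%N -> `|node_lr n i| <= K * width n i) ->
  (forall n i j, child n i j ->
    `|node_lr n.+1 j / width n.+1 j - node_lr n i / width n i| <=
      K' * width n i `^ a) ->
  0 <= C -> 0 < m ->
  (forall u, p <= u <= q -> m <= f u) ->
  (forall s t, p <= s -> s < t -> t <= q -> forall s1 t1 u,
     s <= s1 -> s1 < t1 -> t1 <= t -> s <= u <= t ->
     `|sec h s1 t1 - f u| <= C * (t - s)) ->
  (forall s t, p <= s -> s < t -> t <= q -> m <= sec h s t) ->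
  (forall u v, p <= u <= q -> p <= v <= q -> `|f u - f v| <= C * `|u - v|) ->
  secant_holder a p q f.
Proof.
move=> /andP[a0 a1] Hr Hu C0 m0 fm hf hm fl.
have [C2 C20 HC2] := node_osc cg (V := fun n i => node_lr n i / width n i) a0 Hu.
have W0 : 0 < q - p by rewrite subr_gt0 (pq_lt cg).
pose L := C / m; have L0 : 0 <= L by rewrite divr_ge0// ltW.
pose phi u := ln (f u).
have fp u : p <= u <= q -> 0 < f u by move=> /fm; order_lra.
have phil u v : p <= u <= q -> p <= v <= q -> `|phi u - phi v| <= L * `|u - v|.
  move=> uI vI; rewrite /phi -ln_div ?posrE ?fp//.
  apply: (le_trans (ln_ratio_le m0 (fm u uI) (fm v vI))).
  by rewrite /L mulrAC ler_wpM2r ?fl// invr_ge0 ltW.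
have lnsec s t u : p <= s -> s < t -> t <= q -> s <= u <= t ->
    forall s1 t1, s <= s1 -> s1 < t1 -> t1 <= t ->
    `|ln (sec h s1 t1) - phi u| <= L * (t - s).
  move=> ps st tq /[dup] su /andP[su1 su2] s1 t1 ss1 st1 tt1.
  have uI : p <= u <= q by apply/andP; split; order_lra.
  have ms := hm s1 t1 ltac:(order_lra) st1 ltac:(order_lra).
  rewrite /phi -ln_div ?posrE ?fp//; last by order_lra.
  apply: (le_trans (ln_ratio_le m0 ms (fm u uI))).
  by rewrite /L mulrAC ler_wpM2r ?invr_ge0 ?(ltW m0)//; exact: hf.
have main s t : p <= s -> s < t -> t <= q -> exists c, forall s1 t1,
    s <= s1 -> s1 < t1 -> t1 <= t ->
    `|phi t1 - phi s1 - 2 * c * (t1 - s1)| <= 2 * C2 * (t - s) `^ a * (t1 - s1).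
  move=> ps st tq; have [c [n1 H]] := HC2 s t ps st tq; exists c => s1 t1 ss1 st1 tt1.
  clear HC2 Hr Hu hf hm fm fp fl phil.
  set eta := C2 * (t - s) `^ a in H.
  have eta0 : 0 <= eta by rewrite mulr_ge0// powR_ge0.
  apply/ler_addgt0Pr => e e0.
  pose Q := 4 * `|c| + 2 * L + 1.
  have Q0 : 0 < Q by rewrite /Q; have := normr_ge0 c; order_lra.
  have d0 : 0 < e / Q by rewrite divr_gt0.
  have [k [j [l [nk jl lN [f1 f2 f3 f4]]]]] :=
    grid_approx cg n1 (le_trans ps ss1) st1 (le_trans tt1 tq) d0.
  set d := e / Q in d0 f2 f4; have dQ : d * Q = e by rewrite /d divfK// gt_eqF.
  have lt_j : x k j < x k j.+1 by apply: xi; clear -jl lN; lia.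
  have lt_l : x k l < x k l.+1 by apply: xi.
  have g1 := @lnsec s1 (x k j.+1) s1 ltac:(order_lra) ltac:(order_lra).
  have jl1 : x k j.+1 <= x k l by apply: (inc_le (@xi k)) => //; exact: ltnW.
  have {}g1 := g1 ltac:(order_lra) ltac:(order_lra) (x k j) (x k j.+1) f1 lt_j (lexx _).
  have g2 := @lnsec (x k l) t1 t1 ltac:(order_lra) ltac:(order_lra) ltac:(order_lra) ltac:(order_lra) (x k l) (x k l.+1) (lexx _) lt_l f3.
  have dj : L * (x k j.+1 - s1) <= L * d by rewrite ler_wpM2l//; order_lra.
  have dl : L * (t1 - x k l) <= L * d by rewrite ler_wpM2l//; order_lra.
  pose z i := x k i + x k i.+1.
  pose Z i := ln (sec h (x k i) (x k i.+1)).
  have inc : (c - eta) * (z l - z j) <= Z l - Z j <= (c + eta) * (z l - z j).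
    apply: increment_between; first exact: ltnW.
      move=> i hil; rewrite /z; have i2 : (i.+2 <= N k)%N by clear -hil lN; lia.
      by have := @xi k i (ltnW i2); have := @xi k i.+1 i2; order_lra.
    move=> i hil; have i2 : (i.+2 <= N k)%N by clear -hil lN; lia.
    have wi := width_gt0 cg i2.
    have -> : slope z Z i i.+1 = node_lr k i / width k i.
      rewrite /slope /z /Z /node_lr /lr ln_div ?posrE ?(grid_sec_gt0 cg hi)//.
        by rewrite /width; congr (_ / _); ring.
      exact: ltnW.
    have := H k i nk i2; rewrite ler_norml => h'.
    have {h'} := h' _ _; rewrite (_ : s <= x k i); last first.
      by apply: le_trans (_ : x k j <= _); [order_lra|apply: (inc_le (@xi k)); clear -hil lN; lia].
    rewrite (_ : x k i.+2 <= t); last first.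
      by apply: le_trans (_ : _ <= x k l.+1) _; [apply: (inc_le (@xi k)); clear -hil lN; lia|order_lra].
    by move=> /(_ isT isT) /andP[h1 h2]; apply/andP; split; order_lra.
  have zz : 0 <= z l - z j by rewrite /z; order_lra.
  pose u := 2 * (t1 - s1) - (z l - z j).
  have u0 : 0 <= u by rewrite /u /z; order_lra.
  have u1 : u <= 4 * d by rewrite /u /z; order_lra.
  have cu : `|c * u| <= `|c| * (4 * d) by rewrite normrM (ger0_norm u0) ler_wpM2l.
  have Ez : z l - z j = 2 * (t1 - s1) - u by rewrite /u; ring.
  have ez : eta * (z l - z j) <= eta * (2 * (t1 - s1)).
    by rewrite ler_wpM2l// Ez gerBl.
  have cz : c * (z l - z j) = 2 * c * (t1 - s1) - c * u by rewrite Ez; ring.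
  move: g1 g2 cu inc; rewrite !ler_norml -/(Z j) -/(Z l) mulrBl mulrDl cz.
  move=> /andP[g1 g2] /andP[g3 g4] /andP[cu1 cu2] /andP[i1 i2].
  have -> : 2 * C2 * (t - s) `^ a * (t1 - s1) = eta * (2 * (t1 - s1)) by rewrite /eta; ring.
  have dQ' : 4 * (`|c| * d) + 2 * (L * d) + d = e by rewrite -dQ /Q; ring.
  clear a0 a1 C0 m0 C20 W0 L0 ps st tq e0 Q0 jl lN f1 f2 f3 f4 dQ lt_j lt_l jl1.
  by apply/andP; split; order_lra.
clear HC2 Hr Hu lnsec hf hm.
pose eta1 := C2 * (q - p) `^ a.
have eta10 : 0 <= eta1 by rewrite mulr_ge0// powR_ge0.
pose F := f p + C * (q - p).
have pI : p <= p <= q by rewrite lexx ltW// -subr_gt0.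
have F0 : 0 <= F by rewrite addr_ge0 ?mulr_ge0 ?(ltW W0) ?(ltW (fp p pI)).
have fF u : p <= u <= q -> f u <= F.
  move=> /[dup] uI /andP[pu uq]; have := fl u p uI pI; rewrite ler_norml => /andP[_].
  rewrite [`|_|]ger0_norm; last by order_lra.
  by have : C * (u - p) <= C * (q - p) by [rewrite ler_wpM2l//; order_lra]; rewrite /F; order_lra.
pose X := (q - p) `^ (1 - a).
have X0 : 0 <= X by rewrite powR_ge0.
exists (C * L * X + F * (2 * C2) + (L + 2 * eta1) * C * X).
  apply: addr_ge0; first apply: addr_ge0.
  - exact: mulr_ge0 (mulr_ge0 C0 L0) X0.
  - exact: mulr_ge0 F0 (mulr_ge0 (ler0n _ 2) C20).
  - exact: mulr_ge0 (mulr_ge0 (addr_ge0 L0 (mulr_ge0 (ler0n _ 2) eta10)) C0) X0.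
move=> s t ps st tq; have [c Hc] := main s t ps st tq.
have sI : p <= s <= q by apply/andP; split; order_lra.
have ts : 0 < t - s by rewrite subr_gt0.
set T := (t - s) `^ a in Hc *; have T0 : 0 <= T by rewrite powR_ge0.
have tT : t - s <= X * T.
  have -> : t - s = (t - s) `^ (1 - a) * T.
    by rewrite /T -powRD ?subrK ?powRr1 ?(ltW ts)// (gt_eqF ts) implybT.
  rewrite ler_wpM2r//; apply: ge0_ler_powR;
    [by rewrite subr_ge0|by rewrite nnegrE ltW|by rewrite nnegrE ltW|exact: lerB].
have Teta : C2 * T <= eta1.
  rewrite /eta1 ler_wpM2l//; apply: (ge0_ler_powR (ltW a0));
    [by rewrite nnegrE ltW|by rewrite nnegrE ltW|exact: lerB].
have c_le : `|2 * c| <= L + 2 * eta1.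
  have := Hc s t (lexx _) st (lexx _).
  have tI : p <= t <= q by rewrite (le_trans ps (ltW st)).
  have := phil t s tI sI; rewrite [`|t - s|]gtr0_norm// => h1 h2.
  rewrite -(ler_pM2r ts) -{1}[t - s]gtr0_norm// -normrM.
  have : `|2 * c * (t - s)| <= `|phi t - phi s| + `|phi t - phi s - 2 * c * (t - s)|.
    by have := ler_normB (phi t - phi s) (phi t - phi s - 2 * c * (t - s)); rewrite subKr.
  have : C2 * T * (t - s) <= eta1 * (t - s) by rewrite ler_wpM2r// ltW.
  by order_lra.
exists (f s * (2 * c)) => s1 t1 ss1 st1 tt1.
have ts1 : 0 < t1 - s1 by rewrite subr_gt0.
have s1I : p <= s1 <= q by rewrite (le_trans ps ss1) (le_trans (le_trans (ltW st1) tt1) tq).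
have t1I : p <= t1 <= q by rewrite (le_trans (le_trans ps ss1) (ltW st1)) (le_trans tt1 tq).
have Hc1 := Hc s1 t1 ss1 st1 tt1.
have f0 := fp s1 s1I; have f1 := fp t1 t1I.
have fm1 := fm t1 t1I.
set g0 := f s1 in f0 *; set g1 := f t1 in f1 fm1 *.
set D := phi t1 - phi s1 in Hc1.
have DE : D = ln (g1 / g0) by rewrite ln_div ?posrE.
have gg : `|g1 - g0| <= C * (t1 - s1).
  by have := fl t1 s1 t1I s1I; rewrite [`|t1 - s1|]gtr0_norm.
have lin : `|g1 - g0 - g0 * D| <= C * L * (t1 - s1) * (t1 - s1).
  rewrite DE; apply: (le_trans (ln_ratio_linear f0 m0 fm1 gg)).
  by rewrite /L (_ : _ / m = C * (C / m) * (t1 - s1) * (t1 - s1))//; ring.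
have tt : t1 - s1 <= t - s by apply: lerB.
have CL0 := mulr_ge0 C0 L0.
have z1 : `|sec f s1 t1 - g0 * (D / (t1 - s1))| <= C * L * X * T.
  have -> : sec f s1 t1 - g0 * (D / (t1 - s1)) = (g1 - g0 - g0 * D) / (t1 - s1).
    by rewrite /sec -/g0 -/g1; field; rewrite gt_eqF.
  rewrite normrM normfV (gtr0_norm ts1) ler_pdivrMr//; apply: (le_trans lin).
  rewrite ler_pM2r//.
  rewrite -[C * L * X * T]mulrA ler_wpM2l ?CL0//; exact: le_trans tt tT.
have z2 : `|g0 * (D / (t1 - s1)) - g0 * (2 * c)| <= F * (2 * C2) * T.
  have -> : g0 * (D / (t1 - s1)) - g0 * (2 * c) = g0 * ((D - 2 * c * (t1 - s1)) / (t1 - s1)).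
    by field; rewrite gt_eqF.
  have z0 : `|(D - 2 * c * (t1 - s1)) / (t1 - s1)| <= 2 * C2 * T.
    by rewrite normrM normfV (gtr0_norm ts1) ler_pdivrMr.
  rewrite normrM (gtr0_norm f0) -[leRHS]mulrA.
  exact: ler_pM (ltW f0) (normr_ge0 _) (fF s1 s1I) z0.
have z3 : `|g0 * (2 * c) - f s * (2 * c)| <= (L + 2 * eta1) * C * X * T.
  rewrite -mulrBl normrM mulrC -!mulrA; apply: ler_pM => //.
  apply: (le_trans (fl s1 s s1I sI)); rewrite ler_wpM2l//.
  by rewrite ger0_norm; [exact: le_trans (lerB (le_trans (ltW st1) tt1) (lexx s)) tT|rewrite subr_ge0].
have : `|sec f s1 t1 - f s * (2 * c)| <= `|sec f s1 t1 - g0 * (D / (t1 - s1))| +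
    (`|g0 * (D / (t1 - s1)) - g0 * (2 * c)| + `|g0 * (2 * c) - f s * (2 * c)|).
  rewrite -(subrKA (g0 * (D / (t1 - s1)))); apply: (le_trans (ler_normD _ _)).
  rewrite lerD2l -(subrKA (g0 * (2 * c))); exact: ler_normD.
by order_lra.
Qed.

End Smoothness.

(** * Adjacent intervals of comparable length *)

Lemma ln_ratio_sandwich {R : realType} (tau r sg P Q : R) :
  0 < tau <= 2^-1 -> 0 < sg -> 0 < P -> 0 < Q ->
  P <= expR r * sg * (1 + tau) -> Q <= expR r * sg * (1 + tau) ->
  sg * (1 - tau) <= expR r * P -> sg * (1 - tau) <= expR r * Q ->
  `|ln (Q / P)| <= 2 * r + 4 * tau.
Proof.
move=> /andP[tau0 tau1] sg0 P0 Q0 c1 c2 c3 c4.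
have tt : 1 + tau <= expR (4 * tau) * (1 - tau).
  have h1 : 1 + 4 * tau <= expR (4 * tau) := expR_ge1Dx _.
  have h2 : 0 <= 1 - tau by order_lra.
  have := ler_wpM2r h2 h1; have : tau * tau <= 2^-1 * tau by rewrite ler_wpM2r// ltW.
  by order_lra.
have fin X Y : X <= expR r * sg * (1 + tau) -> sg * (1 - tau) <= expR r * Y ->
    X <= expR (2 * r + 4 * tau) * Y.
  move=> h1 h2; apply: (le_trans h1).
  have h3 : sg * (1 + tau) <= expR (4 * tau) * (expR r * Y).
    apply: (@le_trans _ _ (expR (4 * tau) * (sg * (1 - tau)))).
      by rewrite mulrCA ler_wpM2l// ltW.
    by rewrite ler_wpM2l// expR_ge0.
  have -> : expR (2 * r + 4 * tau) * Y = expR r * (expR (4 * tau) * (expR r * Y)).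
    have -> : 2 * r + 4 * tau = r + (4 * tau + r) by ring.
    by rewrite !expRD; ring.
  by rewrite -mulrA ler_wpM2l// expR_ge0.
by rewrite ln_div ?posrE//; apply/(logcloseW _ Q0 P0); split; exact: fin.
Qed.

Section ThreePoints.
Context {R : realType} {B : R} {M : nat} {p q : R} {N : nat -> nat}
  {x : nat -> nat -> R} (cg : cgrid B M p q N x).
Context {h : R -> R} (hi : increasing_on p q h).

Local Notation node_lr := (@node_lr R x h).
Local Notation lam := (@shrink R B).
Local Notation spread := (@spread R B M).

Let xi := cg_inc cg.

(** Every cell has a neighbour of comparable length inside the same cell of the
    preceding level, whence the factor [shrink]. *)
Lemma refine1 n i c (g : R) : (i + c <= N n)%N ->
  (forall l, (l < c)%N -> x n (i + l).+1 - x n (i + l)%N <= g) ->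
  exists j K, [/\ (j + K <= N n.+1)%N, (K <= c * M)%N, x n.+1 j = x n i,
    x n.+1 (j + K)%N = x n (i + c)%N &
    forall l, (l < K)%N -> x n.+1 (j + l).+1 - x n.+1 (j + l)%N <= lam * g].
Proof.
have B1 := cg_B cg.
elim: c => [|c IH] ic Hg.
  have [iN|Ni] := ltnP i (N n).
    have [j [k [hk hj e1 e2]]] := cg_cell cg iN.
    by exists j, 0%N; split; rewrite ?addn0//; clear -hj; lia.
  have E : i = N n by clear -Ni ic; lia.
  exists (N n.+1), 0%N; split; rewrite ?addn0 ?E ?(cg_q cg)//.
have [|l lc|j [K [jK Kc e1 e2 Hl]]] := IH; first by clear -ic; lia.
  exact/Hg/ltnW.
have icN : (i + c < N n)%N by clear -ic; lia.
have [j' [k' [hk hj f1 f2]]] := cg_cell cg icN.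
have E : j' = (j + K)%N.
  by apply: (inc_eq (@xi n.+1)) => //; [clear -hj; lia|rewrite f1 e2].
subst j'; exists j, (K + k')%N; split.
- by rewrite addnA.
- by clear -Kc hk; lia.
- by [].
- by rewrite addnA f2 addnS.
move=> l lK; have [lK'|Kl] := ltnP l K; first exact: Hl.
have gc := Hg c (ltnSn c).
have [l' El] : exists l', l = (K + l')%N by exists (l - K)%N; clear -Kl; lia.
subst l; have l'k : (l' < k')%N by clear -lK; lia.
rewrite addnA; set a := (j + K)%N in hj f1 f2 *.
have pair l2 : (l2.+2 <= k')%N ->
    (1 + B) * (x n.+1 (a + l2).+1 - x n.+1 (a + l2)%N) <= B * g /\
    (1 + B) * (x n.+1 (a + l2).+2 - x n.+1 (a + l2).+1) <= B * g.
  move=> l2k.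
  have [r1 r2] := @cg_ratio _ _ _ _ _ _ _ cg n.+1 (a + l2)%N ltac:(clear -l2k hj; lia).
  have m1 : x n.+1 a <= x n.+1 (a + l2)%N by apply: (inc_le (@xi n.+1)); clear -l2k hj; lia.
  have m2 : x n.+1 (a + l2).+2 <= x n.+1 (a + k')%N.
    by apply: (inc_le (@xi n.+1)); clear -l2k hj; lia.
  have tot : x n.+1 (a + l2).+2 - x n.+1 (a + l2)%N <= g by rewrite f1 f2 in m1 m2; order_lra.
  have := ler_wpM2l (_ : 0 <= B) tot; rewrite (_ : 0 <= B); last by order_lra.
  by move=> /(_ isT) tot'; split; order_lra.
have B0 : 0 < 1 + B by order_lra.
rewrite /shrink mulrAC ler_pdivlMr// mulrC.
case: l' l'k {lK Kl} => [|l'] l'k.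
  by have [|] := pair 0%N; rewrite ?addn0//; clear -hk; lia.
by have [|_] := pair l'; rewrite ?addnS//; clear -l'k; lia.
Qed.

Lemma refine k n i c (g : R) : (i + c <= N n)%N ->
  (forall l, (l < c)%N -> x n (i + l).+1 - x n (i + l)%N <= g) ->
  exists j K, [/\ (j + K <= N (k + n))%N, (K <= c * M ^ k)%N,
    x (k + n)%N j = x n i, x (k + n)%N (j + K)%N = x n (i + c)%N &
    forall l, (l < K)%N ->
      x (k + n)%N (j + l).+1 - x (k + n)%N (j + l)%N <= lam ^+ k * g].
Proof.
move=> ic Hg; elim: k => [|k [j [K [jK Kc e1 e2 Hl]]]].
  by exists i, c; split; rewrite ?add0n ?muln1// => l lc; rewrite expr0 mul1r; exact: Hg.
have [j' [K' [jK' Kc' f1 f2 Hl']]] := refine1 jK Hl.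
exists j', K'; split.
- exact: jK'.
- by rewrite expnSr mulnA (leq_trans Kc')// leq_mul2r Kc orbT.
- by rewrite -e1 -f1.
- by rewrite -e2 -f2.
- by move=> l lK; have := Hl' l lK; rewrite exprS -mulrA.
Qed.

(** The deepest window that contains [s, t] does it with two cells; if there is
    none, all the cells of the coarsest level do. *)
Lemma localize : exists c0 (S : R), 0 < S /\
  forall s t, p <= s -> s < t -> t <= q -> exists n i c,
  [/\ (0 < c <= c0)%N, (i + c <= N n)%N, x n i <= s, t <= x n (i + c)%N &
      x n (i + c)%N - x n i <= S * (t - s)].
Proof.
have s0 := spread_gt0 cg; have pq := pq_lt cg.
have [G G0 HG] := finite_bound (fun i => (x 0 i.+1 - x 0 i)^-1) (N 0).
exists (2 + N 0)%N, (spread + G * (q - p)); split.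
  by rewrite ltr_pwDl// mulr_ge0// subr_ge0 ltW.
move=> s t ps st tq; have ts : 0 < t - s by rewrite subr_gt0.
have Gq : 0 <= G * (q - p) by rewrite mulr_ge0// subr_ge0 ltW.
have [[l [lN l1 l2]]|[n [i [l [iN i1 i2 [lN l1 l2]]]]]] := deepest_window cg ps st tq.
  exists 0%N, 0%N, (N 0); rewrite add0n (cg_p cg) (cg_q cg); split=> //.
    by have := cg_N cg 0; clear; lia.
  have gap0 : 0 < x 0 l.+1 - x 0 l by rewrite subr_gt0; exact: xi.
  have h1 : 1 <= G * (t - s).
    rewrite -(mulVf (lt0r_neq0 gap0)); apply: ler_pM; rewrite ?invr_ge0 ?(ltW gap0)//.
      exact: HG.
    by apply: lerB.
  have qp : 0 <= q - p by rewrite subr_ge0 ltW.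
  have := ler_wpM2r qp h1.
  have : 0 <= spread * (t - s) by rewrite mulr_ge0 ?(ltW s0) ?(ltW ts).
  by order_lra.
exists n, i, 2%N; rewrite addn2; split=> //.
have hw := width_le_cell cg iN lN (le_trans i1 l1) (le_trans l2 i2).
have h2 : spread * (x n.+1 l.+1 - x n.+1 l) <= spread * (t - s).
  by rewrite ler_pM2l//; apply: lerB.
apply: (le_trans hw); apply: (le_trans h2).
by rewrite ler_wpM2r ?(ltW ts)// lerDl.
Qed.

(** The two adjacent intervals are approximated by unions of cells of a level that
    lies [k] levels below their size: the cells at the ends cost [4 tau], and the
    slopes of the at most [K] cells involved drift by at most [K * rho]. *)
Lemma three_point_bound (d tau : R) n0 : 1 <= d -> 0 < tau <= 2^-1 ->
  exists k K (S : R), [/\ (n0 <= k)%N, 0 < S &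
  forall s u t, p <= s -> s < u -> u < t -> t <= q ->
    u - s <= d * (t - u) -> t - u <= d * (u - s) ->
  exists n, (exists2 i, (i < N n)%N & x n i.+1 - x n i <= S * (t - s)) /\
    forall rho, 0 <= rho ->
    (forall l, (l.+2 <= N (k + n))%N -> s <= x (k + n)%N l.+1 <= t ->
       `|node_lr (k + n) l| <= rho) ->
    `|ln ((h t - h u) / (h u - h s) * ((u - s) / (t - u)))| <=
      2 * (K%:R * rho) + 4 * tau].
Proof.
move=> d1 /andP[tau0 tau1].
have [c0 [S [S0 loc]]] := localize.
have lb := lam_bounds cg.
have e0 : 0 < tau / (2 * S * (1 + d)) by rewrite divr_gt0// mulr_gt0 ?mulr_gt0//; order_lra.
have [k0 Hk] := geometric_small 1 lb e0.
pose k := (k0 + n0)%N.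
have {}Hk : 2 * (lam ^+ k * S) * (1 + d) <= tau.
  have := Hk k (leq_addr _ _); rewrite mulr1 ler_pdivlMr; first by order_lra.
  by rewrite mulr_gt0 ?mulr_gt0//; order_lra.
exists k, (c0 * M ^ k)%N, S; split=> //; first exact: leq_addl.
move=> s u t ps su ut tq ud tu.
have st : s < t by exact: lt_trans su ut.
have [n [i [c [/andP[c1 cc0] ic i1 i2 iS]]]] := loc s t ps st tq.
exists n; split.
  exists i; first by clear -ic c1; lia.
  apply: le_trans iS; apply: lerB => //; apply: (inc_le (@xi n)); clear -ic c1; lia.
move=> rho rho0 Hr.
have gW l : (l < c)%N -> x n (i + l).+1 - x n (i + l)%N <= S * (t - s).
  move=> lc; apply: le_trans iS; apply: lerB; apply: (inc_le (@xi n)); clear -lc ic; lia.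
have [j [K [jK Kc e1 e2 Hl]]] := refine k ic gW.
set m := (k + n)%N in jK e1 e2 Hl Hr.
pose z l := x m (j + l)%N.
have zi : increasing_upto K z by move=> l lK; rewrite /z addnS; apply: xi; clear -lK jK; lia.
have Hi : increasing_upto K (h \o z).
  move=> l lK /=; apply: hi (zi l lK) _.
    by apply: (grid_ge cg); clear -lK jK; lia.
  by apply: (grid_le cg); clear -lK jK; lia.
have z0 : z 0%N <= s by rewrite /z addn0 e1.
have zK : t <= z K by rewrite /z e2.
set dl := lam ^+ k * (S * (t - s)) in Hl.
have gl l : (l < K)%N -> z l.+1 - z l <= dl by move=> lK; rewrite /z addnS; exact: Hl.
have dlt : dl * 2 <= tau * (u - s) /\ dl * 2 <= tau * (t - u).
  have k1 : t - s <= (1 + d) * (u - s) by order_lra.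
  have k2 : t - s <= (1 + d) * (t - u) by order_lra.
  have lS : 0 <= lam ^+ k * S by rewrite mulr_ge0 ?exprn_ge0 ?(ltW S0)//; case/andP: lb.
  have su0 : 0 <= u - s by order_lra.
  have tu0 : 0 <= t - u by order_lra.
  have E : dl = lam ^+ k * S * (t - s) by rewrite /dl; ring.
  split; rewrite E.
    have := ler_wpM2l lS k1; have := ler_wpM2r su0 Hk.
    by order_lra.
  have := ler_wpM2l lS k2; have := ler_wpM2r tu0 Hk.
  by order_lra.
case: dlt => dls dlt.
have zKs : s < z K by exact: lt_le_trans zK.
have [j1 [j1K f1 f2]] := locate z0 zKs.
have z0u : z 0%N <= u by exact: ltW (le_lt_trans z0 su).
have zKu : u < z K by exact: lt_le_trans zK.
have [j2 [j2K g1 g2]] := locate z0u zKu.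
have [j3 [j3K q1 q2]] : exists j3, [/\ (j3 < K)%N, z j3 < t & t <= z j3.+1].
  have := zK; rewrite le_eqVlt => /predU1P[tE|tK].
    case: (K) tE zi jK j1K => [|K'] tE zi' _ j1K'; first by [].
    by exists K'; rewrite -tE; split=> //; rewrite tE; exact: zi'.
  have z0t : z 0%N <= t by exact: ltW (le_lt_trans z0 st).
  have [j3 [j3K q1 q2]] := locate z0t tK.
  move: q1; rewrite le_eqVlt => /predU1P[tE|q1]; last by exists j3; split=> //; exact: ltW.
  case: j3 j3K tE {q2} => [|j3] j3K tE; first by move: (le_lt_trans z0 st); rewrite tE ltxx.
  by exists j3; rewrite -tE; split=> //; [exact: ltnW|apply: zi; exact: ltnW].
have dl1 := gl j1 j1K; have dl2 := gl j2 j2K; have dl3 := gl j3 j3K.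
have tau_s : tau * (u - s) <= 2^-1 * (u - s) by rewrite ler_wpM2r//; order_lra.
have tau_t : tau * (t - u) <= 2^-1 * (t - u) by rewrite ler_wpM2r//; order_lra.
have zlt a b : (a <= K)%N -> (b <= K)%N -> z a < z b -> (a < b)%N.
  by move=> aK bK; rewrite (inc_ltE zi).
have j12 : (j1.+1 < j2)%N by apply: zlt => //; [exact: ltnW|order_lra].
have j23 : (j2.+1 < j3)%N by apply: zlt => //; [exact: ltnW|order_lra].
have b1 : z j2.+1 - z j1 <= (1 + tau) * (u - s) by order_lra.
have b2 : z j3.+1 - z j2 <= (1 + tau) * (t - u) by order_lra.
have b3 : (1 - tau) * (u - s) <= z j2 - z j1.+1 by order_lra.
have b4 : (1 - tau) * (t - u) <= z j3 - z j2.+1 by order_lra.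
have pu := le_trans ps (ltW su); have uq := le_trans (ltW ut) tq.
(* The slopes of all unions of cells from [j1] to [j3] are close to each other. *)
pose y l := z (j1 + l)%N.
have yK : (j3.+1 - j1 <= K)%N by clear -j3K; lia.
have yi : increasing_upto (j3.+1 - j1) y.
  by move=> l lK; rewrite /y addnS; apply: zi; clear -lK j3K; lia.
have Yi : increasing_upto (j3.+1 - j1) (h \o y).
  by move=> l lK; rewrite /= /y addnS; apply: Hi; clear -lK j3K; lia.
have sl := slopes_logclose yi Yi rho0.
have {}sl : forall a b a' b', (j1 <= a)%N -> (a < b)%N -> (b <= j3.+1)%N ->
   (j1 <= a')%N -> (a' < b')%N -> (b' <= j3.+1)%N ->
   logclose ((c0 * M ^ k)%:R * rho) (sec h (z a) (z b)) (sec h (z a') (z b')).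
  move=> a b a' b' ja ab bj ja' ab' bj'.
  have H l : (l.+1 < j3.+1 - j1)%N ->
      logclose rho (slope y (h \o y) l l.+1) (slope y (h \o y) l.+1 l.+2).
    move=> lj; have lN : ((j + (j1 + l)).+2 <= N m)%N by clear -lj j3K jK; lia.
    have r1 := Hr (j + (j1 + l))%N lN.
    have p1 := grid_sec_gt0 cg hi (ltnSn (j + (j1 + l))%N) (ltnW lN).
    have p2 := grid_sec_gt0 cg hi (ltnSn (j + (j1 + l)).+1) lN.
    rewrite /slope /= /y /z !addnS; apply/logcloseW => //.
    rewrite distrC -ln_div ?posrE//; apply: r1.
    rewrite -!addnS -/(z _); apply/andP; split.
      by apply: le_trans (ltW f2) _; apply: (inc_le zi); clear -lj j3K; lia.
    by apply: le_trans (ltW q1); apply: (inc_le zi); clear -lj j3K; lia.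
  have := sl H (a - j1)%N (b - j1)%N (a' - j1)%N (b' - j1)%N
     ltac:(clear -ja ab bj; lia) ltac:(clear -ja' ab' bj'; lia).
  rewrite /slope /= /y !subnKC//; try by clear -ja ab ja' ab'; lia.
  apply: logclose_le.
  - rewrite ler_wpM2r// ler_nat; apply: leq_trans yK _; apply: leq_trans Kc _.
    by rewrite leq_mul2r cc0 orbT.
  - apply/ltW/(slope_gt0 zi Hi) => //; exact: leq_trans bj j3K.
  - apply/ltW/(slope_gt0 zi Hi) => //; exact: leq_trans bj' j3K.
set rr := (c0 * M ^ k)%:R * rho in sl *.
have rr0 : 0 <= rr by rewrite mulr_ge0.
set sg := sec h (z j1) (z j3.+1).
have incr a b : (a < b)%N -> (b <= K)%N -> h (z b) - h (z a) = sec h (z a) (z b) * (z b - z a).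
  by move=> ab bK; rewrite divfK// subr_eq0 gt_eqF//; exact: (inc_lt zi).
have sg0 : 0 < sg.
  by apply: (slope_gt0 zi Hi) => //; clear -j12 j23; lia.
have er := expR_gt0 rr.
have bnd a b : (j1 <= a)%N -> (a < b)%N -> (b <= j3.+1)%N ->
    h (z b) - h (z a) <= expR rr * sg * (z b - z a) /\
    sg * (z b - z a) <= expR rr * (h (z b) - h (z a)).
  move=> ja ab bj; have bK : (b <= K)%N by exact: leq_trans bj j3K.
  have zab : 0 <= z b - z a by rewrite subr_ge0; apply: (inc_le zi) => //; exact: ltnW.
  have j13 : (j1 < j3.+1)%N by clear -j12 j23; lia.
  have [l1 l2] := sl a b j1 j3.+1 ja ab bj (leqnn _) j13 (leqnn _).
  rewrite (incr a b ab bK) mulrA; split; exact: ler_wpM2r.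
have [_ L1] := bnd j1.+1 j2 (leqnSn _) j12 ltac:(clear -j23; lia).
have [U1 _] := bnd j1 j2.+1 (leqnn _) ltac:(clear -j12; lia) ltac:(clear -j23; lia).
have [_ L2] := bnd j2.+1 j3 ltac:(clear -j12; lia) j23 (leqnSn _).
have [U2 _] := bnd j2 j3.+1 ltac:(clear -j12; lia) ltac:(clear -j23; lia) (leqnn _).
have mono a b : p <= a -> a <= b -> b <= q -> h a <= h b.
  move=> pa; rewrite le_eqVlt => /predU1P[->//|ab] bq; exact/ltW/hi.
have pz l : (l <= K)%N -> p <= z l by move=> lK; apply: (grid_ge cg); clear -lK jK; lia.
have zq l : (l <= K)%N -> z l <= q by move=> lK; apply: (grid_le cg); clear -lK jK; lia.
have m1 := mono _ _ (pz j1 (ltnW j1K)) f1 (le_trans (ltW su) uq).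
have m2 := mono _ _ ps (ltW f2) (zq j1.+1 j1K).
have m3 := mono _ _ (pz j2 (ltnW j2K)) g1 uq.
have m4 := mono _ _ pu (ltW g2) (zq j2.+1 j2K).
have m5 := mono _ _ (pz j3 (ltnW j3K)) (ltW q1) tq.
have m6 := mono _ _ (le_trans ps (ltW st)) q2 (zq j3.+1 j3K).
have hus : 0 < h u - h s by rewrite subr_gt0; apply: hi.
have htu : 0 < h t - h u by rewrite subr_gt0; apply: hi.
have us0 : 0 < u - s by rewrite subr_gt0.
have tu0 : 0 < t - u by rewrite subr_gt0.
have mean_le a b (A H : R) : 0 < A -> 0 < H -> b - a <= (1 + tau) * A ->
   H <= expR rr * sg * (b - a) -> H / A <= expR rr * sg * (1 + tau).
  move=> A0 H0 ba Hb; rewrite ler_pdivrMr//; apply: (le_trans Hb).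
  by rewrite -[X in _ <= X]mulrA ler_wpM2l// mulr_ge0// ltW.
have mean_ge a b (A H : R) : 0 < A -> 0 < H -> (1 - tau) * A <= b - a ->
   sg * (b - a) <= expR rr * H -> sg * (1 - tau) <= expR rr * (H / A).
  move=> A0 H0 ba Hb; rewrite mulrA ler_pdivlMr//; apply: le_trans Hb.
  by rewrite -mulrA ler_wpM2l// ltW.
have er0 := ltW er.
have k1 := mean_le _ _ _ _ us0 hus b1 (le_trans (lerB m4 m1) U1).
have k2 := mean_le _ _ _ _ tu0 htu b2 (le_trans (lerB m6 m3) U2).
have k3 := mean_ge _ _ _ _ us0 hus b3 (le_trans L1 (ler_wpM2l er0 (lerB m3 m2))).
have k4 := mean_ge _ _ _ _ tu0 htu b4 (le_trans L2 (ler_wpM2l er0 (lerB m5 m4))).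
have -> : (h t - h u) / (h u - h s) * ((u - s) / (t - u)) =
    ((h t - h u) / (t - u)) / ((h u - h s) / (u - s)).
  by field; rewrite !gt_eqF.
have tau01 : 0 < tau <= 2^-1 by rewrite tau0.
exact: ln_ratio_sandwich tau01 sg0 (divr_gt0 hus us0) (divr_gt0 htu tu0) k1 k2 k3 k4.
Qed.

End ThreePoints.

(** * Affine maps and the mean value theorem *)

Section AffineGrid.
Context {R : realType} {B : R} {M : nat} {p q : R} {N : nat -> nat}
  {x : nat -> nat -> R} (cg : cgrid B M p q N x).
Context {h : R -> R} (hi : increasing_on p q h) (hc : cont_on p q h).

Local Notation width := (@width R x).
Local Notation node_lr := (@node_lr R x h).

Let xi := cg_inc cg.

(** Summing the bound over a level, the slopes of all cells agree up to a factor
    that tends to 1. *)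
Lemma affine_of_lr :
  (forall e, 0 < e -> exists n0, forall n i, (n0 <= n)%N -> (i.+2 <= N n)%N ->
     `|node_lr n i| <= e * width n i) ->
  forall u, p <= u <= q -> h u = h p + sec h p q * (u - p).
Proof.
move=> Hr; have pq := pq_lt cg; have W0 : 0 < q - p by rewrite subr_gt0.
set sg := sec h p q; have sg0 : 0 < sg := sec_gt0 hi (lexx _) pq (lexx _).
have key e s t : 0 < e -> p <= s -> s < t -> t <= q ->
    expR (- e) * sg <= sec h s t <= expR e * sg.
  move=> e0 ps st tq.
  have d0 : 0 < e / (2 * (q - p)) by rewrite divr_gt0// mulr_gt0.
  have [n0 H] := Hr _ d0; set d := e / _ in d0 H.
  apply: (secant_limit cg (n1 := n0) hc (lexx p) pq (lexx q)) => // n j nn jN _ _.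
  pose z i := x n i + x n i.+1.
  pose Z i := ln (sec h (x n i) (x n i.+1)).
  have zle a b : (a <= b)%N -> (b < N n)%N -> z a <= z b.
    by move=> ab bN; apply: lerD; apply: (inc_le (@xi n)) => //; exact: ltnW.
  have drift a b : (a <= b)%N -> (b < N n)%N -> `|Z b - Z a| <= e.
    move=> ab bN.
    have /andP[i1 i2] : (- d) * (z b - z a) <= Z b - Z a <= d * (z b - z a).
      apply: increment_between => //.
        move=> i hil; have i2 : (i.+2 <= N n)%N by clear -hil bN; lia.
        by rewrite /z; apply: ltrD; apply: xi => //; exact: ltnW.
      move=> i hil; have i2 : (i.+2 <= N n)%N by clear -hil bN; lia.
      have wi := width_gt0 cg i2.
      have -> : slope z Z i i.+1 = node_lr n i / width n i.
        rewrite /slope /z /Z /node_lr /lr ln_div ?posrE ?(grid_sec_gt0 cg hi)//.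
          by rewrite /width; congr (_ / _); ring.
        exact: ltnW.
      rewrite -ler_norml normrM normfV (gtr0_norm wi) ler_pdivrMr//.
      exact: H.
    have zz : z b - z a <= 2 * (q - p).
      have h1 := grid_le cg (ltnW bN); have h2 := grid_le cg bN.
      have aN : (a < N n)%N by exact: leq_ltn_trans bN.
      have h3 := grid_ge cg (ltnW aN); have h4 := grid_ge cg aN.
      by rewrite /z; lra.
    have dz : d * (z b - z a) <= e.
      have -> : e = d * (2 * (q - p)) by rewrite /d divfK// gt_eqF// mulr_gt0.
      by rewrite ler_wpM2l// ltW.
    by rewrite ler_norml; apply/andP; split; lra.
  have cell i : (i < N n)%N -> logclose e (sec h (x n i) (x n i.+1)) (sec h (x n j) (x n j.+1)).
    move=> iN; have jN' := ltnW jN.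
    apply/logcloseW; [exact: (grid_sec_gt0 cg hi)|exact: (grid_sec_gt0 cg hi)|].
    have [ij|ij] := leqP i j; first by rewrite distrC; exact: drift.
    by apply: drift => //; exact: ltnW.
  set sj := sec h (x n j) (x n j.+1) in cell *.
  have /andP[s1 s2] : expR (- e) * sj <= sg <= expR e * sj.
    rewrite /sg -(cg_p cg n) -(cg_q cg n).
    apply: (slope_between (@xi n) (H := h \o x n)) => //.
      exact: leq_trans (cg_N cg n).
    move=> l /andP[_ lN]; have [c1 c2] := cell l lN; apply/andP; split => //.
    by rewrite expRN ler_pdivrMl ?expR_gt0.
  apply/andP; split; first by rewrite expRN ler_pdivrMl ?expR_gt0.
  by move: s1; rewrite expRN ler_pdivrMl ?expR_gt0.
move=> u /andP[]; rewrite le_eqVlt => /predU1P[<- _|pu uq].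
  by rewrite subrr mulr0 addr0.
suff E : sec h p u = sg.
  by rewrite -E /sec divfK ?subr_eq0 ?gt_eqF//; ring.
have small e : 0 < e -> `|sec h p u - sg| <= e.
  move=> e0.
  have sg2 : 0 < 2 * sg by exact: mulr_gt0.
  pose e' := Num.min 2^-1 (e / (2 * sg)).
  have e'0 : 0 < e' by rewrite lt_min invr_gt0 ltr0n/= divr_gt0.
  have e'1 : e' <= 2^-1 by rewrite ge_min lexx.
  have e'2 : 2 * e' * sg <= e.
    have : e' <= e / (2 * sg) by rewrite ge_min lexx orbT.
    by rewrite ler_pdivlMr// [2 * e']mulrC mulrA.
  have /andP[k1 k2] := key e' p u e'0 (lexx _) pu uq.
  have h1 := expR_le1D2x (ltW e'0) e'1.
  have h2 := expR_ge1Dx (- e').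
  have h3 : expR e' * sg <= (1 + 2 * e') * sg by rewrite ler_pM2r.
  have h4 : (1 - e') * sg <= expR (- e') * sg by rewrite ler_pM2r.
  have h5 : 0 <= e' * sg by rewrite mulr_ge0// ltW.
  by rewrite ler_norml; apply/andP; split; lra.
apply/eqP; rewrite -subr_eq0 -normr_eq0 eq_le normr_ge0 andbT.
by apply/ler_addgt0Pr => e e0; rewrite add0r; exact: small.
Qed.

End AffineGrid.

Section MeanValue.
Context {R : realType}.
Implicit Types (p q s t u a : R) (f g : R -> R).

Lemma within_cont_on p q f : {within `[p, q]%classic, continuous f} -> cont_on p q f.
Proof.
move=> /subspace_continuousP H u uI e e0.
have /cvgrPdist_le/(_ e e0) := H u (iffRL (itvccP p q u) uI).
rewrite /within /= => /nbhs_ballP[d /= d0 Hd].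
exists (d / 2); first by rewrite divr_gt0.
move=> v vI vd; rewrite distrC; apply: Hd; last by apply/itvccP.
by rewrite /ball /= distrC; apply: le_lt_trans vd _; lra.
Qed.

Lemma cont_on_within p q f : cont_on p q f -> {within `[p, q]%classic, continuous f}.
Proof.
move=> H; apply/subspace_continuousP => u /itvccP uI.
apply/cvgrPdist_le => e e0; have [d d0 Hd] := H u uI e e0.
rewrite /within /=; apply/nbhs_ballP; exists d => // v.
rewrite /ball /= distrC => vd /itvccP vI; rewrite distrC; apply: Hd => //.
exact: ltW.
Qed.

Lemma cont_on_sub p q p' q' f : p <= p' -> q' <= q -> cont_on p q f -> cont_on p' q' f.
Proof.
move=> pp qq H u /andP[u1 u2] e e0.
have [|d d0 Hd] := H u _ e e0; first by apply/andP; split; lra.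
by exists d => // v /andP[v1 v2]; apply: Hd; apply/andP; split; lra.
Qed.

Lemma has_deriv_cont p q f f' : (forall u, p <= u <= q -> has_deriv p q f u (f' u)) ->
  cont_on p q f.
Proof.
move=> H u uI e e0; have [d d0 Hd] := H u uI 1 ltr01.
pose K := `|f' u| + 1; have K0 : 0 < K by rewrite /K; have := normr_ge0 (f' u); lra.
have d1 : 0 < Num.min (d / 2) (e / K) by rewrite lt_min !divr_gt0.
exists (Num.min (d / 2) (e / K)) => // v vI.
rewrite le_min => /andP[v1 v2].
have [->|vu] := eqVneq v u; first by rewrite subrr normr0 ltW.
have h1 := Hd v vI vu ltac:(lra).
have h2 : `|sec f u v| <= K.
  have : `|sec f u v| <= `|sec f u v - f' u| + `|f' u|.
    by rewrite -{1}[sec f u v](subrK (f' u)); exact: ler_normD.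
  by rewrite /K; lra.
have -> : f v - f u = sec f u v * (v - u) by rewrite divfK// subr_eq0.
rewrite normrM; apply: (@le_trans _ _ (K * (e / K))); first exact: ler_pM.
by rewrite mulrCA mulfV ?mulr1// gt_eqF.
Qed.

Lemma mean_value p q f f' : (forall u, p <= u <= q -> has_deriv p q f u (f' u)) ->
  forall s t, p <= s -> s < t -> t <= q ->
  exists2 xi, s <= xi <= t & sec f s t = f' xi.
Proof.
move=> H s t ps st tq.
have fc : {within `[s, t]%classic, continuous f}.
  by apply/cont_on_within/(cont_on_sub ps tq)/has_deriv_cont/H.
have fd u : u \in `]s, t[ -> is_derive u 1 f (f' u).
  rewrite in_itv/= => /andP[su ut].
  have uI : p <= u <= q by apply/andP; split; lra.
  have lim : (fun e => e^-1 *: ((f \o shift u) (e *: (1 : R)) - f u)) @ 0^' --> f' u.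
    apply/cvgrPdist_le => e e0; have [d d0 Hd] := H u uI e e0.
    have m0 : 0 < Num.min d (Num.min (u - s) (t - u)) by rewrite !lt_min d0 !subr_gt0 su.
    rewrite /dnbhs /within /=; apply/nbhs_ballP.
    exists (Num.min d (Num.min (u - s) (t - u))) => //= y.
    rewrite /ball /= sub0r normrN !lt_min => /andP[y1 /andP[y2 y3]] y0.
    have yn := ler_norm y; have yn' := ler_norm (- y); rewrite normrN in yn'.
    rewrite distrC.
    have := Hd (y + u) ltac:(apply/andP; split; lra).
    rewrite -subr_eq0 addrK => /(_ y0 y1).
    rewrite /sec addrK [_ / y]mulrC.
    by rewrite /GRing.scale /= mulr1.
  apply: DeriveDef; first by apply/cvg_ex; exists (f' u).
  exact: cvg_lim.
have [xi] := MVT st fd fc.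
rewrite in_itv/= => /andP[x1 x2] E; exists xi; first by rewrite !ltW.
by rewrite /sec E mulfK// subr_eq0 gt_eqF.
Qed.

Lemma holder_secant p q a f f' C : 0 <= a -> 0 <= C ->
  (forall u, p <= u <= q -> has_deriv p q f u (f' u)) ->
  (forall u v, p <= u <= q -> p <= v <= q -> `|f' u - f' v| <= C * `|u - v| `^ a) ->
  forall s t, p <= s -> s < t -> t <= q -> forall s1 t1 u,
    s <= s1 -> s1 < t1 -> t1 <= t -> s <= u <= t ->
    `|sec f s1 t1 - f' u| <= C * (t - s) `^ a.
Proof.
move=> a0 C0 H Hh s t ps st tq s1 t1 u ss1 st1 tt1 /andP[su ut].
have [xi /andP[x1 x2] ->] := mean_value H (le_trans ps ss1) st1 (le_trans tt1 tq).
apply: (le_trans (Hh xi u _ _)); try by apply/andP; split; lra.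
rewrite ler_wpM2l//; apply: ge0_ler_powR; rewrite ?nnegrE//; first by lra.
by rewrite ler_norml; apply/andP; split; lra.
Qed.

End MeanValue.

(** * Distortion of smooth maps *)

Section Direct.
Context {R : realType}.
Implicit Types (p q s t u a : R) (f g h : R -> R).

(** The derivative is nonnegative because [h] increases, continuous, and without
    zeros on a compact interval. *)
Lemma deriv_lower_bound p q h f a C : p < q -> increasing_on p q h -> 0 < a -> 0 <= C ->
  (forall u, p <= u <= q -> has_deriv p q h u (f u)) ->
  (forall u v, p <= u <= q -> p <= v <= q -> `|f u - f v| <= C * `|u - v| `^ a) ->
  (forall u, p <= u <= q -> f u <> 0) ->
  exists2 m, 0 < m & forall u, p <= u <= q -> m <= f u.
Proof.
move=> pq hi a0 C0 H Hh fn0.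
have fge u : p <= u <= q -> 0 <= f u.
  move=> uI; rewrite leNgt; apply/negP => fu.
  have e0 : 0 < - f u / 2 by order_lra.
  have [d d0 Hd] := H u uI _ e0.
  have PF := within_proper pq uI.
  have : (within `[p, q]%classic u^') (fun y => [/\ p <= y <= q, y != u & `|y - u| < d]).
    by apply/near_withinP; exists d.
  move=> /filter_ex[y [yI yu yd]].
  have := Hd y yI yu yd; rewrite ler_norml => /andP[_ h1].
  have : 0 < sec h u y.
    case/andP: uI => pu uq; case/andP: yI => py yq.
    by have [uy|yu'|E] := ltgtP u y; [exact: (sec_gt0 hi)|rewrite sec_sym; exact: (sec_gt0 hi)|rewrite E eqxx in yu].
  by order_lra.
have fc : {within `[p, q]%classic, continuous f}.
  apply: cont_on_within => u uI e e0.
  have e1 : 0 < e / (C + 1) by rewrite divr_gt0//; order_lra.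
  exists ((e / (C + 1)) `^ a^-1); first exact: powR_gt0.
  move=> v vI vd; apply: (le_trans (Hh v u vI uI)).
  have : `|v - u| `^ a <= ((e / (C + 1)) `^ a^-1) `^ a.
    by apply: (ge0_ler_powR (ltW a0)); rewrite ?nnegrE ?powR_ge0.
  rewrite -powRrM mulVf ?gt_eqF// powRr1 ?(ltW e1)// => h1.
  apply: (@le_trans _ _ (C * (e / (C + 1)))); first by rewrite ler_wpM2l.
  by rewrite mulrA ler_pdivrMr; [rewrite mulrC ler_pM2l|]; order_lra.
have [c cI Hc] := EVT_min (ltW pq) fc.
have cI' : p <= c <= q by move: cI; rewrite in_itv.
exists (f c); first by rewrite lt_def fge// andbT; apply/eqP/fn0.
by move=> u uI; apply: Hc; rewrite in_itv.
Qed.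

Lemma lr_of_holder p q h f a C : p < q -> increasing_on p q h -> 0 < a -> 0 <= C ->
  (forall u, p <= u <= q -> has_deriv p q h u (f u)) ->
  (forall u v, p <= u <= q -> p <= v <= q -> `|f u - f v| <= C * `|u - v| `^ a) ->
  (forall u, p <= u <= q -> f u <> 0) ->
  exists2 K, 0 <= K & forall u v w, p <= u -> u < v -> v < w -> w <= q ->
    `|lr h u v w| <= K * (w - u) `^ a.
Proof.
move=> pq hi a0 C0 H Hh fn0.
have [m m0 Hm] := deriv_lower_bound pq hi a0 C0 H Hh fn0.
exists (2 * C / m); first by rewrite divr_ge0 ?(ltW m0)// mulr_ge0.
move=> u v w pu uv vw wq; have uw := lt_trans uv vw.
have secm s t : p <= s -> s < t -> t <= q -> m <= sec h s t.
  move=> ps st tq; have [xi /andP[x1 x2] ->] := mean_value H ps st tq.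
  by apply: Hm; rewrite (le_trans ps x1) (le_trans x2 tq).
have h1 := holder_secant (ltW a0) C0 H Hh pu uw wq.
have g1 := h1 u v u (lexx _) uv (ltW vw) ltac:(by rewrite lexx ltW).
have g2 := h1 v w u (ltW uv) vw (lexx _) ltac:(by rewrite lexx ltW).
have m1 := secm u v pu uv (le_trans (ltW vw) wq).
have m2 := secm v w (le_trans pu (ltW uv)) vw wq.
apply: (le_trans (ln_ratio_le m0 m2 m1)).
rewrite mulrAC ler_wpM2r ?invr_ge0 ?(ltW m0)//.
have : `|sec h v w - sec h u v| <= `|sec h v w - f u| + `|sec h u v - f u|.
  by rewrite -(subrKA (f u)) [X in _ <= _ + X]distrC; exact: ler_normD.
by rewrite -mulrA; order_lra.
Qed.

(** The secant over two adjacent intervals is an average of the two slopes, hence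
    as close to either of them as they are to each other. *)
Lemma cd_le_lr p q h u v w y : increasing_on p q h ->
  p <= u -> u < v -> v < w -> w < y -> y <= q ->
  `|cd h u v w y| <= `|lr h u v w| + `|lr h v w y|.
Proof.
move=> hi pu uv vw wy yq.
have pv := le_trans pu (ltW uv); have pw := le_trans pv (ltW vw).
have wq := le_trans (ltW wy) yq; have vq := le_trans (ltW vw) wq.
have s1 : 0 < sec h u v := sec_gt0 hi pu uv vq.
have s2 : 0 < sec h v w := sec_gt0 hi pv vw wq.
have s3 : 0 < sec h w y := sec_gt0 hi pw wy yq.
have s13 : 0 < sec h u w := sec_gt0 hi pu (lt_trans uv vw) wq.
have s24 : 0 < sec h v y := sec_gt0 hi pv (lt_trans vw wy) yq.
have E1 : sec h u w * (w - u) = (v - u) * sec h u v + (w - v) * sec h v w.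
  by rewrite /sec; field; rewrite !subr_eq0 !gt_eqF// (lt_trans uv vw).
have E2 : sec h v y * (y - v) = (w - v) * sec h v w + (y - w) * sec h w y.
  by rewrite /sec; field; rewrite !subr_eq0 !gt_eqF// (lt_trans vw wy).
have r1 : logclose `|lr h u v w| (sec h u v) (sec h v w).
  by apply/logcloseW => //; rewrite distrC -ln_div ?posrE.
have r2 : logclose `|lr h v w y| (sec h w y) (sec h v w).
  by apply/logcloseW => //; rewrite -ln_div ?posrE.
have c1 : logclose `|lr h u v w| (sec h u w) (sec h u v).
  apply: (@logclose_cancel _ _ _ _ (w - u)); first by rewrite subr_gt0 (lt_trans uv).
  rewrite mulrC E1 (_ : w - u = (v - u) + (w - v)); last by ring.
  by apply: logclose_avg => //; rewrite subr_gt0.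
have c2 : logclose `|lr h v w y| (sec h v y) (sec h w y).
  apply: (@logclose_cancel _ _ _ _ (y - v)); first by rewrite subr_gt0 (lt_trans vw).
  rewrite mulrC E2 addrC (_ : y - v = (y - w) + (w - v)); last by ring.
  by apply: logclose_avg => //; rewrite subr_gt0.
have := logcloseM (ltW s13) (ltW s1) (ltW s24) (ltW s3) c1 c2.
have p1 := mulr_gt0 s13 s24; have p2 := mulr_gt0 s1 s3.
rewrite /cd ln_div ?posrE//; exact: (logcloseW _ p1 p2).1.
Qed.

(** Second-order Taylor expansion of secants: in [cd] the terms of order 1
    cancel, because the midpoints of its two pairs of secants have the same
    sum. *)
Lemma cd_of_C2 p q h f g a C : p < q -> increasing_on p q h -> 0 < a <= 1 -> 0 <= C ->
  (forall u, p <= u <= q -> has_deriv p q h u (f u)) ->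
  (forall u, p <= u <= q -> has_deriv p q f u (g u)) ->
  (forall u v, p <= u <= q -> p <= v <= q -> `|g u - g v| <= C * `|u - v| `^ a) ->
  (forall u, p <= u <= q -> f u <> 0) ->
  exists2 K, 0 <= K & forall u v w y, p <= u -> u < v -> v < w -> w < y -> y <= q ->
    `|cd h u v w y| <= K * (y - u) `^ (1 + a).
Proof.
move=> pq hi /andP[a0 a1] C0 H H2 Hh fn0.
have qp : 0 < q - p by rewrite subr_gt0.
have a1' : 0 <= 1 - a by order_lra.
have a1p : 0 < 1 + a by order_lra.
pose Kg := `|g p| + C * (q - p) `^ a.
have Kg0 : 0 <= Kg by rewrite addr_ge0// mulr_ge0// powR_ge0.
have gK u : p <= u <= q -> `|g u| <= Kg.
  move=> /[dup] uI /andP[pu uq].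
  have h1 := Hh u p uI ltac:(by rewrite lexx ltW).
  have h2 : `|u - p| `^ a <= (q - p) `^ a.
    apply: (ge0_ler_powR (ltW a0)); rewrite ?nnegrE ?(ltW qp)//.
    by rewrite ger0_norm ?subr_ge0//; exact: lerB.
  have : `|g u| <= `|g u - g p| + `|g p|.
    by rewrite -{1}[g u](subrK (g p)); exact: ler_normD.
  by have := ler_wpM2l C0 h2; rewrite /Kg; order_lra.
have fl u v : p <= u <= q -> p <= v <= q -> `|f u - f v| <= Kg * `|u - v| `^ 1.
  move=> uI vI; rewrite powRr1//.
  wlog uv : u v uI vI / u < v.
    move=> W; have [uv|vu|->] := ltgtP u v; first exact: W.
      by rewrite distrC [`|u - v|]distrC; exact: W.
    by rewrite !subrr normr0 mulr0.
  case/andP: uI => pu uq; case/andP: vI => pv vq.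
  have [xi /andP[x1 x2] E] := mean_value H2 pu uv vq.
  have -> : f u - f v = sec f u v * (u - v).
    by rewrite /sec; field; rewrite subr_eq0 gt_eqF.
  by rewrite normrM E ler_wpM2r// gK// (le_trans pu x1) (le_trans x2 vq).
have [m m0 Hm] := deriv_lower_bound pq hi ltr01 Kg0 H fl fn0.
have secm s t : p <= s -> s < t -> t <= q -> m <= sec h s t.
  move=> ps st tq; have [xi /andP[x1 x2] ->] := mean_value H ps st tq.
  by apply: Hm; rewrite (le_trans ps x1) (le_trans x2 tq).
pose F := `|f p| + Kg * (q - p).
have F0 : 0 <= F by rewrite addr_ge0// mulr_ge0// ltW.
have secF s t : p <= s -> s < t -> t <= q -> `|sec h s t| <= F.
  move=> ps st tq; have [xi /andP[x1 x2] ->] := mean_value H ps st tq.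
  have xI : p <= xi <= q by rewrite (le_trans ps x1) (le_trans x2 tq).
  have h1 := fl xi p xI ltac:(by rewrite lexx ltW); rewrite powRr1// in h1.
  have h2 : `|xi - p| <= q - p.
    by case/andP: xI => ? ?; rewrite ger0_norm ?subr_ge0//; exact: lerB.
  have : `|f xi| <= `|f xi - f p| + `|f p|.
    by rewrite -{1}[f xi](subrK (f p)); exact: ler_normD.
  by have := ler_wpM2l Kg0 h2; rewrite /F; order_lra.
(* The mean value theorem is applied to [h] minus its quadratic Taylor polynomial
   at [s]. *)
have taylor s t : p <= s -> s < t -> t <= q -> forall s1 t1, s <= s1 -> s1 < t1 -> t1 <= t ->
    `|sec h s1 t1 - (f s + g s * ((s1 + t1) / 2 - s))| <= C * (t - s) `^ (1 + a).
  move=> ps st tq s1 t1 ss1 st1 tt1.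
  pose G u := h u - (f s * u + g s * ((u - s) ^+ 2 / 2)).
  pose G' u := f u - f s - g s * (u - s).
  have secG u y : y != u -> sec G u y = sec h u y - (f s + g s * ((u + y) / 2 - s)).
    by move=> yu; rewrite /sec /G; field; rewrite subr_eq0.
  have dG u : p <= u <= q -> has_deriv p q G u (G' u).
    move=> uI e e0; have e2 : 0 < e / 2 by order_lra.
    have [d d0 Hd] := H u uI _ e2.
    have k0 : 0 < `|g s| + 1 by have := normr_ge0 (g s); order_lra.
    exists (Num.min d (e / (`|g s| + 1))); first by rewrite lt_min d0 divr_gt0.
    move=> y yI yu; rewrite lt_min => /andP[yd ye].
    have h1 := Hd y yI yu yd.
    have -> : sec G u y - G' u = (sec h u y - f u) - g s * ((y - u) / 2).
      by rewrite secG// /G'; field.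
    apply: (le_trans (ler_normB _ _)).
    have h2 : `|g s| * `|y - u| <= e.
      apply: (@le_trans _ _ ((`|g s| + 1) * `|y - u|)); first by rewrite ler_wpM2r//; order_lra.
      by rewrite mulrC -ler_pdivlMr// ltW.
    have h3 : `|g s * ((y - u) / 2)| = `|g s| * `|y - u| / 2.
      by rewrite !normrM normfV [`|2|]gtr0_norm// mulrA.
    by rewrite h3; order_lra.
  have [xi /andP[x1 x2]] := mean_value dG (le_trans ps ss1) st1 (le_trans tt1 tq).
  rewrite secG ?gt_eqF// => ->.
  have T0 : 0 <= t - s by rewrite subr_ge0 ltW.
  have TE : (t - s) `^ (1 + a) = (t - s) `^ a * (t - s).
    rewrite powRD ?powRr1 ?T0//; first by rewrite mulrC.
    by rewrite subr_eq0 (gt_eqF st) implybT.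
  have xs := le_trans ss1 x1; have xt := le_trans x2 tt1.
  rewrite TE; move: xs; rewrite le_eqVlt => /predU1P[<-|sxi].
    rewrite /G' !subrr mulr0 subr0 normr0.
    by apply: mulr_ge0 => //; apply: mulr_ge0 => //; exact: powR_ge0.
  have h1 := holder_secant (ltW a0) C0 H2 Hh ps st tq (lexx s) sxi xt (u := s) ltac:(by rewrite lexx ltW).
  have -> : G' xi = (sec f s xi - g s) * (xi - s).
    by rewrite /G' /sec; field; rewrite subr_eq0 gt_eqF.
  rewrite normrM [leRHS]mulrA [`|xi - s|]gtr0_norm ?subr_gt0//.
  apply: ler_pM (normr_ge0 _) _ h1 (lerB xt (lexx s)).
  by rewrite subr_ge0 ltW.
pose em := C * (q - p) `^ (1 + a).
have em0 : 0 <= em by rewrite mulr_ge0// powR_ge0.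
pose K := (2 * (2 * F + em) * C + 2 * Kg ^+ 2 * (q - p) `^ (1 - a)) / m ^+ 2.
have K0 : 0 <= K.
  rewrite divr_ge0 ?sqr_ge0//; apply: addr_ge0; first apply: mulr_ge0 => //.
    by rewrite mulr_ge0// addr_ge0// mulr_ge0.
  by apply: mulr_ge0 (powR_ge0 _ _); rewrite mulr_ge0// sqr_ge0.
exists K => // u v w y pu uv vw wy yq.
have uw := lt_trans uv vw; have uy := lt_trans uw wy; have vy := lt_trans vw wy.
have pv := le_trans pu (ltW uv); have pw := le_trans pv (ltW vw).
have wq := le_trans (ltW wy) yq; have vq := le_trans (ltW vw) wq.
have tl := taylor u y pu uy yq.
have t1 := tl u w (lexx _) uw (ltW wy); have t2 := tl v y (ltW uv) vy (lexx _).
have t3 := tl u v (lexx _) uv (ltW vy); have t4 := tl w y (ltW uw) wy (lexx _).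
have f1 := secF u w pu uw wq; have f2 := secF v y pv vy yq.
have f3 := secF u v pu uv vq; have f4 := secF w y pw wy yq.
have m1 := secm u w pu uw wq; have m2 := secm v y pv vy yq.
have m3 := secm u v pu uv vq; have m4 := secm w y pw wy yq.
have T0 : 0 < y - u by rewrite subr_gt0.
set eta := C * (y - u) `^ (1 + a) in t1 t2 t3 t4.
have eta0 : 0 <= eta by rewrite mulr_ge0// powR_ge0.
have etam : eta <= em.
  rewrite /eta /em ler_wpM2l//; apply: (ge0_ler_powR (ltW a1p)); rewrite ?nnegrE ?(ltW T0) ?(ltW qp)//.
  exact: lerB.
have mm : 0 < m ^+ 2 by rewrite exprn_gt0.
have X m' n' : m <= m' -> m <= n' -> m ^+ 2 <= m' * n'.
  by move=> h1 h2; rewrite expr2; apply: ler_pM => //; exact: ltW.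
rewrite /cd; apply: (le_trans (ln_ratio_le mm (X _ _ m1 m2) (X _ _ m3 m4))).
rewrite /K [leRHS]mulrAC ler_wpM2r ?invr_ge0 ?(ltW mm)//.
(* The quadratic Taylor polynomial replaces each of the four secants up to [eta],
   hence their two products up to a multiple of [eta]. *)
have prod (s1 s2 p1 p2 : R) : `|s1 - p1| <= eta -> `|s2 - p2| <= eta -> `|s1| <= F -> `|s2| <= F ->
    `|s1 * s2 - p1 * p2| <= (2 * F + em) * eta.
  move=> h1 h2 h3 h4.
  have -> : s1 * s2 - p1 * p2 = (s1 - p1) * s2 + s1 * (s2 - p2) - (s1 - p1) * (s2 - p2) by ring.
  apply: (le_trans (ler_normB _ _)).
  have k1 : `|(s1 - p1) * s2| <= eta * F by rewrite normrM; exact: ler_pM.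
  have k2 : `|s1 * (s2 - p2)| <= F * eta by rewrite normrM; exact: ler_pM.
  have k3 : `|(s1 - p1) * (s2 - p2)| <= em * eta.
    by rewrite normrM; apply: ler_pM => //; exact: le_trans etam.
  by have := ler_normD ((s1 - p1) * s2) (s1 * (s2 - p2)); clear -k1 k2 k3; lra.
have q1 := prod _ _ _ _ t1 t2 f1 f2.
have q2 := prod _ _ _ _ t3 t4 f3 f4.
move: q1 q2; set P1 := (X in `|_ - X| <= _); set S1 := (X in `|X - _| <= _) => q1.
set P2 := (X in `|_ - X| <= _); set S2 := (X in `|X - _| <= _) => q2.
have PP : P1 - P2 = g u ^+ 2 * (((u + w) / 2 - u) * ((v + y) / 2 - u) - ((u + v) / 2 - u) * ((w + y) / 2 - u)).
  by rewrite /P1 /P2; field.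
have bb : `|P1 - P2| <= 2 * Kg ^+ 2 * (y - u) ^+ 2.
  have -> : 2 * Kg ^+ 2 * (y - u) ^+ 2 = Kg ^+ 2 * (2 * (y - u) ^+ 2) by ring.
  rewrite PP normrM normrX.
  apply: ler_pM (exprn_ge0 _ (normr_ge0 _)) (normr_ge0 _) _ _.
    apply: lerXn2r; rewrite ?nnegrE//; apply: gK.
    by rewrite pu (le_trans (ltW uy) yq).
  have mid c d : u <= c -> c <= d -> d <= y -> 0 <= (c + d) / 2 - u <= y - u.
    by clear; move=> h1 h2 h3; apply/andP; split; order_lra.
  have /andP[a1l a1u] := mid u w (lexx _) (ltW uw) (ltW wy).
  have /andP[a2l a2u] := mid v y (ltW uv) (ltW vy) (lexx _).
  have /andP[a3l a3u] := mid u v (lexx _) (ltW uv) (ltW vy).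
  have /andP[a4l a4u] := mid w y (ltW uw) (ltW wy) (lexx _).
  have b1 := ler_pM a1l a2l a1u a2u; have b2 := ler_pM a3l a4l a3u a4u.
  have b3 := mulr_ge0 a1l a2l; have b4 := mulr_ge0 a3l a4l.
  by clear -b1 b2 b3 b4; rewrite expr2 ler_norml; apply/andP; split; order_lra.
have TT : (y - u) ^+ 2 <= (q - p) `^ (1 - a) * (y - u) `^ (1 + a).
  have -> : (y - u) ^+ 2 = (y - u) `^ (1 - a) * (y - u) `^ (1 + a).
    rewrite -powRD; last by rewrite subr_eq0 (gt_eqF uy) implybT.
    by rewrite (_ : 1 - a + (1 + a) = 2%:R) ?powR_mulrn ?(ltW T0)//; ring.
  rewrite ler_wpM2r ?powR_ge0//; apply: (ge0_ler_powR a1'); rewrite ?nnegrE ?(ltW T0) ?(ltW qp)//.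
  exact: lerB.
have kk : 0 <= 2 * Kg ^+ 2 by rewrite mulr_ge0// sqr_ge0.
have := ler_wpM2l kk TT.
have : `|S1 - S2| <= `|S1 - P1| + (`|P1 - P2| + `|S2 - P2|).
  rewrite -(subrKA P1); apply: (le_trans (ler_normD _ _)); rewrite lerD2l.
  by rewrite -(subrKA P2) [X in _ <= _ + X]distrC; exact: ler_normD.
have -> : (2 * (2 * F + em) * C + 2 * Kg ^+ 2 * (q - p) `^ (1 - a)) * (y - u) `^ (1 + a) =
  2 * ((2 * F + em) * eta) + 2 * Kg ^+ 2 * ((q - p) `^ (1 - a) * (y - u) `^ (1 + a)).
  by rewrite /eta; ring.
move: q1 q2 bb.
move: (`|S1 - S2|) (`|S1 - P1|) (`|S2 - P2|) (`|P1 - P2|) => s12 s1p s2p p12.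
by clear; lra.
Qed.

End Direct.

(** * From grids to refining subdivisions *)

Section Levels.
Context {R : realType}.
Implicit Types (u v y : nat -> R) (p q : R).

(** The intervals are consecutive and cover [p, q], so the first one starts at [p]
    and the last one ends at [q]. *)
Lemma chain_points N u v p q : (0 < N)%N -> p <= q ->
  (forall i, (i < N)%N -> u i < v i) ->
  (forall i, (i.+1 < N)%N -> v i = u i.+1) ->
  (forall t, p <= t <= q <-> exists2 i, (i < N)%N & u i <= t <= v i) ->
  exists y, [/\ increasing_upto N y, y 0%N = p, y N = q &
    forall i, (i < N)%N -> u i = y i /\ v i = y i.+1].
Proof.
move=> N0 pq uv vu cover.
pose y i := if i is i'.+1 then v i' else u 0%N.
have uy i : (i < N)%N -> u i = y i.
  by case: i => [|i] iN //=; rewrite vu.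
have yi : increasing_upto N y by move=> i iN; rewrite -uy//; exact: uv.
have y0 : y 0%N = p.
  apply/eqP; rewrite eq_le; apply/andP; split.
    have [i iN /andP[h1 _]] := (cover p).1 ltac:(by rewrite lexx).
    by apply: le_trans h1; rewrite uy//; apply: (inc_le yi) => //; exact: ltnW.
  suff : p <= u 0%N <= q by case/andP.
  by apply/cover; exists 0%N => //; rewrite lexx ltW// uv.
have yN : y N = q.
  apply/eqP; rewrite eq_le; apply/andP; split.
    suff : p <= v N.-1 <= q by case: (N) N0 => // N' _ /andP[].
    by apply/cover; exists N.-1; rewrite ?lexx ?andbT ?(ltW (uv _ _))//; lia.
  have [i iN /andP[_ h1]] := (cover q).1 ltac:(by rewrite lexx andbT).
  by apply: (le_trans h1); rewrite -[v i]/(y i.+1); apply: (inc_le yi).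
by exists y; split=> // i iN; split; [exact: uy|].
Qed.

Lemma len_itv (s t : R) : s <= t -> len `[s, t]%classic = t - s.
Proof. by move=> st; rewrite /len sup_itvcc// inf_itvcc. Qed.

Lemma itv_inter1 (a b c d z : R) : a < b -> c < d ->
  `[a, b]%classic `&` `[c, d]%classic = [set z] -> b = c \/ a = d.
Proof.
move=> ab cd E.
have zI : (`[a, b]%classic `&` `[c, d]%classic) z by rewrite E.
case: zI => /=; rewrite !in_itv/= => /andP[az zb] /andP[cz zd].
have uniq t : a <= t -> t <= b -> c <= t -> t <= d -> t = z.
  move=> *; suff : [set z] t by []; rewrite -E; split; rewrite /= in_itv/=; exact/andP.
have e1 : Num.max a c = z.
  by apply: uniq; rewrite ?le_max ?ge_max ?lexx ?orbT//; apply/andP; split; lra.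
have e2 : Num.min b d = z.
  by apply: uniq; rewrite ?ge_min ?le_min ?lexx ?orbT//; apply/andP; split; lra.
move: e1 e2; rewrite /Num.max /Num.min; case: ltP => h1; case: ltP => h2 e1 e2; subst.
- by left.
- by move: cd; rewrite ltxx.
- by move: ab; rewrite ltxx.
- by right.
Qed.

Lemma itv_interior_meet (a b c d : R) : a < b -> c < d -> b = d ->
  (`[a, b]%classic)^° `&` (`[c, d]%classic)^° <> set0.
Proof.
move=> ab cd E; rewrite !interior_itv; subst d.
have m1 : Num.max a c < b by rewrite gt_max ab.
have a1 : a <= Num.max a c by rewrite le_max lexx.
have c1 : c <= Num.max a c by rewrite le_max lexx orbT.
move=> /seteqP[H _]; apply: (H ((Num.max a c + b) / 2)).
by split; rewrite /= in_itv/=; apply/andP; split; lra.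
Qed.

Lemma itv_interior_meet_l (a b c d : R) : a < b -> c < d -> a = c ->
  (`[a, b]%classic)^° `&` (`[c, d]%classic)^° <> set0.
Proof.
move=> ab cd E; rewrite !interior_itv; subst c.
have m1 : a < Num.min b d by rewrite lt_min ab.
have a1 : Num.min b d <= b by rewrite ge_min lexx.
have c1 : Num.min b d <= d by rewrite ge_min lexx orbT.
move=> /seteqP[H _]; apply: (H ((a + Num.min b d) / 2)).
by split; rewrite /= in_itv/=; apply/andP; split; lra.
Qed.

End Levels.

Section GridPoints.
Context {R : realType} {B M p q : R} {Omega : nat -> nat} {G : nat -> nat -> set R}.
Context (pq : p < q) (bm : BM_grid B M `[p, q]%classic Omega G).

(** The conditions on a grid leave open in which direction a level is numbered:
    [o] tells whether it is from left to right, and [pos] is the position of the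
    [b]-th interval counted from the left, starting at 0. *)
Definition pos (o : bool) N b := if o then b.-1 else (N - b)%N.

(** Two intervals whose intersection is one point lie on different sides of it.
    The direction from the first interval to the second is then the same for all
    following pairs, for turning back would make the intervals [b] and [b.+2]
    overlap. *)
Lemma level_points n : (1 <= n)%N -> exists (y : nat -> R) (o : bool),
  [/\ (0 < Omega n)%N, increasing_upto (Omega n) y, y 0%N = p, y (Omega n) = q &
    forall b, (1 <= b <= Omega n)%N ->
      G n b = `[y (pos o (Omega n) b), y (pos o (Omega n) b).+1]%classic].
Proof.
move=> n1; set N := Omega n.
have N0 : (0 < N)%N.
  have : (\bigcup_(b in [set b | (1 <= b <= Omega n)%N]) G n b) p.
    by rewrite (grid_cover bm n1) /= in_itv/= lexx ltW.
  by move=> [b /= hb _]; rewrite /N; clear -hb; lia.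
pose u b := inf (G n b); pose v b := sup (G n b).
have GE b : (1 <= b <= N)%N -> u b < v b /\ G n b = `[u b, v b]%classic.
  move=> hb; have [s [t [st E]]] := grid_itv bm n1 hb.
  by rewrite /u /v E inf_itvcc ?sup_itvcc ?(ltW st).
have adj b : (1 <= b < N)%N -> v b = u b.+1 \/ u b = v b.+1.
  move=> hb; have [x [E _ _]] := grid_adjacent bm n1 hb.
  have [h1 e1] := GE b ltac:(clear -hb; lia); have [h2 e2] := GE b.+1 ltac:(clear -hb; lia).
  by rewrite e1 e2 in E; exact: itv_inter1 E.
have disj b : (1 <= b)%N -> (b.+2 <= N)%N -> (G n b)^° `&` (G n b.+2)^° = set0.
  by move=> b1 bN; apply: (grid_disjoint bm n1); clear -b1 bN; lia.
have right b : (1 <= b)%N -> (b.+2 <= N)%N -> v b = u b.+1 -> v b.+1 = u b.+2.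
  move=> b1 bN e; have [//|e'] := adj b.+1 ltac:(clear -bN; lia).
  have [h1 e1] := GE b ltac:(clear -b1 bN; lia); have [h2 e2] := GE b.+2 ltac:(clear -b1 bN; lia).
  have := disj b b1 bN; rewrite e1 e2 => D; exfalso.
  by apply: (itv_interior_meet h1 h2 _ D); rewrite e e'.
have left b : (1 <= b)%N -> (b.+2 <= N)%N -> u b = v b.+1 -> u b.+1 = v b.+2.
  move=> b1 bN e; have [e'|//] := adj b.+1 ltac:(clear -bN; lia).
  have [h1 e1] := GE b ltac:(clear -b1 bN; lia); have [h2 e2] := GE b.+2 ltac:(clear -b1 bN; lia).
  have := disj b b1 bN; rewrite e1 e2 => D; exfalso.
  by apply: (itv_interior_meet_l h1 h2 _ D); rewrite e e'.
have cover t : p <= t <= q <-> exists2 b, (1 <= b <= N)%N & u b <= t <= v b.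
  have -> : (p <= t <= q) = (t \in `[p, q]) by rewrite in_itv.
  have <- : (\bigcup_(b in [set b | (1 <= b <= Omega n)%N]) G n b) t = (t \in `[p, q]) :> Prop.
    by rewrite (grid_cover bm n1).
  split.
    by move=> [b /= hb]; have [_ ->] := GE b hb; rewrite /= in_itv/=; exists b.
  move=> [b hb ht]; exists b => //; have [_ ->] := GE b hb.
  by rewrite /= in_itv.
have [allr|alll] : (forall b, (1 <= b < N)%N -> v b = u b.+1) \/
    (forall b, (1 <= b < N)%N -> u b = v b.+1).
  have [N1|N2] := leqP N 1; first by left => b hb; clear -hb N1; lia.
  have [e|e] := adj 1%N N2.
    left; elim => [|b IH] hb; first by clear -hb; lia.
    have [->//|b0] := eqVneq b 0%N.
    by apply: right; [lia|clear -hb; lia|apply: IH; clear -hb b0; lia].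
  right; elim => [|b IH] hb; first by clear -hb; lia.
  have [->//|b0] := eqVneq b 0%N.
  by apply: left; [lia|clear -hb; lia|apply: IH; clear -hb b0; lia].
- have [i iN|i iN|t|y [yi y0 yN Hy]] := @chain_points R N (fun i => u i.+1) (fun i => v i.+1) p q N0 (ltW pq).
  + by have [] := GE i.+1 ltac:(clear -iN; lia).
  + by apply: allr; clear -iN; lia.
  + rewrite cover; split.
      by move=> [b hb ht]; exists b.-1; [clear -hb; lia|rewrite prednK//; clear -hb; lia].
    by move=> [i iN ht]; exists i.+1.
  exists y, true; split=> // b hb; have [_ ->] := GE b hb.
  rewrite /pos; have [e1 e2] := Hy b.-1 ltac:(clear -hb; lia).
  by rewrite -e1 -e2 prednK//; clear -hb; lia.
have [i iN|i iN|t|y [yi y0 yN Hy]] := @chain_points R N (fun i => u (N - i)%N) (fun i => v (N - i)%N) p q N0 (ltW pq).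
+ by have [] := GE (N - i)%N ltac:(clear -iN; lia).
+ rewrite (_ : (N - i)%N = (N - i.+1).+1); last by clear -iN; lia.
  by rewrite -alll//; clear -iN; lia.
+ rewrite cover; split.
    by move=> [b hb ht]; exists (N - b)%N; [clear -hb; lia|rewrite subKn//; clear -hb; lia].
  by move=> [i iN ht]; exists (N - i)%N => //; clear -iN; lia.
exists y, false; split=> // b hb; have [_ ->] := GE b hb.
rewrite /pos; have [e1 e2] := Hy (N - b)%N ltac:(clear -hb; lia).
by rewrite -e1 -e2 subKn//; clear -hb; lia.
Qed.

End GridPoints.

Section GridTransport.
Context {R : realType} {B M p q : R} {Omega : nat -> nat} {G : nat -> nat -> set R}.
Context (pq : p < q) (B1 : 1 <= B) (bm : BM_grid B M `[p, q]%classic Omega G).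

Definition level_points_of n (y : nat -> R) (ori : bool) :=
  [/\ (0 < Omega n)%N, increasing_upto (Omega n) y, y 0%N = p, y (Omega n) = q &
    forall b, (1 <= b <= Omega n)%N ->
      G n b = `[y (pos ori (Omega n) b), y (pos ori (Omega n) b).+1]%classic].

Lemma grid_points : exists (y : nat -> nat -> R) (ori : nat -> bool),
  forall n, (1 <= n)%N -> level_points_of n (y n) (ori n).
Proof.
have H n : exists yo : (nat -> R) * bool, (1 <= n)%N -> level_points_of n yo.1 yo.2.
  have [n1|n0] := leqP 1 n; last by exists (fun=> 0, true) => n1; move: n0 n1; clear; lia.
  by have [y [ori Hy]] := level_points pq bm n1; exists (y, ori).
have [f Hf] := choice H.
by exists (fun n => (f n).1), (fun n => (f n).2).
Qed.

Context {y : nat -> nat -> R} {ori : nat -> bool}.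
Context (gp : forall n, (1 <= n)%N -> level_points_of n (y n) (ori n)).

Lemma pos_lt oo N b : (1 <= b <= N)%N -> (pos oo N b < N)%N.
Proof. by rewrite /pos; case: oo; clear; lia. Qed.

Lemma pos_inj oo N b c : (1 <= b <= N)%N -> (1 <= c <= N)%N ->
  pos oo N b = pos oo N c -> b = c.
Proof. by rewrite /pos; case: oo; clear; lia. Qed.

Lemma pos_surj oo N i : (i < N)%N -> exists2 b, (1 <= b <= N)%N & pos oo N b = i.
Proof.
move=> iN; rewrite /pos; case: oo; first by exists i.+1.
by exists (N - i)%N; clear -iN; lia.
Qed.

Lemma y_inc n : (1 <= n)%N -> increasing_upto (Omega n) (y n).
Proof. by move=> /gp[]. Qed.

Lemma y_in n i : (1 <= n)%N -> (i <= Omega n)%N -> p <= y n i <= q.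
Proof.
move=> n1 iN; have [N0 yi y0 yN _] := gp n1.
by apply/andP; split; [rewrite -y0|rewrite -yN]; apply: (inc_le yi).
Qed.

Lemma len_cell n b : (1 <= n)%N -> (1 <= b <= Omega n)%N ->
  len (G n b) = y n (pos (ori n) (Omega n) b).+1 - y n (pos (ori n) (Omega n) b).
Proof.
move=> n1 hb; have [N0 yi _ _ GE] := gp n1; rewrite GE// len_itv//.
by apply: (inc_le yi) => //; exact: pos_lt.
Qed.

Lemma y_ratio n : (1 <= n)%N -> ratio_upto B (Omega n) (y n).
Proof.
move=> n1 i iN; have B0 : 0 < B by have := B1; lra.
have [b hb Eb] : exists2 b, (1 <= b < Omega n)%N &
   (pos (ori n) (Omega n) b = i /\ pos (ori n) (Omega n) b.+1 = i.+1) \/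
   (pos (ori n) (Omega n) b = i.+1 /\ pos (ori n) (Omega n) b.+1 = i).
  rewrite /pos; case: (ori n); first by exists i.+1; [clear -iN; lia|left].
  by exists (Omega n - i.+1)%N; [|right]; clear -iN; lia.
have := grid_ratio bm n1 hb.
rewrite !len_cell//; try by clear -hb; lia.
have g1 : 0 < y n i.+1 - y n i by rewrite subr_gt0; apply: y_inc => //; exact: ltnW.
have g2 : 0 < y n i.+2 - y n i.+1 by rewrite subr_gt0; exact: y_inc.
have fin (g g' : R) : 0 < g -> 0 < g' -> B^-1 <= g' / g <= B -> g' <= B * g /\ g <= B * g'.
  move=> g0 g0'; rewrite ler_pdivlMr// ler_pdivrMr// => /andP[h1 h2]; split=> //.
  by rewrite -ler_pdivrMl.
by case: Eb => [[-> ->]|[-> ->]] /fin[]//.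
Qed.

Lemma count_pos oo N j j' : (j <= j' <= N)%N ->
  count (fun c => (j <= pos oo N c < j')%N) (iota 1 N) = (j' - j)%N.
Proof.
move=> hj.
have -> : count (fun c => (j <= pos oo N c < j')%N) (iota 1 N) =
    count (fun i => (j <= i < j')%N) (map (pos oo N) (iota 1 N)) by rewrite count_map.
have P : perm_eq (map (pos oo N) (iota 1 N)) (iota 0 N).
  apply: uniq_perm; last 1 first.
  - move=> i; rewrite mem_iota add0n /=; apply/mapP/idP => [[b]|iN].
      by rewrite mem_iota => hb ->; apply: pos_lt; clear -hb; lia.
    have [b hb E] := @pos_surj oo N i iN; exists b => //.
    by rewrite mem_iota; clear -hb; lia.
  - rewrite map_inj_in_uniq ?iota_uniq// => b c; rewrite !mem_iota => hb hc.
    by apply: pos_inj; [clear -hb; lia|clear -hc; lia].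
  - exact: iota_uniq.
rewrite (permP P) -size_filter.
have -> : [seq i <- iota 0 N | (j <= i < j')%N] = iota j (j' - j).
  have -> : N = (j + ((j' - j) + (N - j')))%N by clear -hj; lia.
  rewrite iotaD filter_cat add0n iotaD filter_cat.
  rewrite (eq_in_filter (a2 := pred0)); last by move=> i; rewrite mem_iota /=; clear; lia.
  rewrite filter_pred0 cat0s.
  rewrite (eq_in_filter (a2 := predT)); last by move=> i; rewrite mem_iota /=; clear; lia.
  rewrite filter_predT (eq_in_filter (a2 := pred0)); last by move=> i; rewrite mem_iota /=; clear; lia.
  by rewrite filter_pred0 cats0.
by rewrite size_iota.
Qed.

Lemma y_refine n i : (1 <= n)%N -> (i <= Omega n)%N ->
  exists2 j, (j <= Omega n.+1)%N & y n.+1 j = y n i.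
Proof.
move=> n1 iN; have [N0 yi y0 yN GE] := gp n1.
have [N0' yi' y0' yN' GE'] := gp (ltn0Sn n).
have [b hb xb] : exists2 b, (1 <= b <= Omega n)%N & endpoints (G n b) (y n i).
  have [iN'|iN'] := ltnP i (Omega n).
    have [b hb E] := @pos_surj (ori n) (Omega n) i iN'; exists b => //.
    by rewrite GE// E /endpoints inf_itvcc; [left|apply/ltW/yi].
  have E : i = (Omega n).-1.+1 by clear -iN iN' N0; lia.
  have pN : ((Omega n).-1 < Omega n)%N by clear -N0; lia.
  have [b hb Eb] := @pos_surj (ori n) (Omega n) (Omega n).-1 pN; exists b => //.
  by rewrite GE// Eb E /endpoints sup_itvcc; [right|apply/ltW/yi].
have [c hc xc] := grid_endpoints bm n1 hb xb.
have cN := @pos_lt (ori n.+1) _ _ hc.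
rewrite GE'// /endpoints inf_itvcc ?sup_itvcc in xc; try exact/ltW/yi'.
case: xc => /= E; [exists (pos (ori n.+1) (Omega n.+1) c) => //; exact: ltnW|].
by exists (pos (ori n.+1) (Omega n.+1) c).+1.
Qed.

Lemma y_children n i (M' : nat) : M <= M'%:R -> (1 <= n)%N -> (i < Omega n)%N ->
  exists j k, [/\ (2 <= k <= M')%N, (j + k <= Omega n.+1)%N,
    y n.+1 j = y n i & y n.+1 (j + k)%N = y n i.+1].
Proof.
move=> MM n1 iN; have [N0 yi y0 yN GE] := gp n1.
have [N0' yi' y0' yN' GE'] := gp (ltn0Sn n).
have [j jN Ej] := y_refine n1 (ltnW iN); have [j' jN' Ej'] := y_refine n1 iN.
have jj' : (j < j')%N by rewrite -(inc_ltE yi')// Ej Ej' yi.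
have [b hb Eb] := @pos_surj (ori n) (Omega n) i iN.
have := grid_children bm n1 hb.
have -> : count (fun c => `[< G n.+1 c `<=` G n b >]) (iota 1 (Omega n.+1)) = (j' - j)%N.
  rewrite -(@count_pos (ori n.+1) (Omega n.+1) j j'); last by clear -jj' jN'; lia.
  apply: eq_in_count => c; rewrite mem_iota => hc.
  have {}hc : (1 <= c <= Omega n.+1)%N by clear -hc; lia.
  have cN := @pos_lt (ori n.+1) _ _ hc; set k := pos _ _ c in cN *.
  rewrite GE'// GE// Eb -Ej -Ej' -/k; apply/asboolP/andP.
    move=> sub; have yk := yi' k cN.
    have h1 := sub (y n.+1 k) ltac:(by rewrite /= in_itv/= lexx ltW).
    have h2 := sub (y n.+1 k.+1) ltac:(by rewrite /= in_itv/= lexx ltW).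
    move: h1 h2; rewrite /= !in_itv/= => /andP[h1 _] /andP[_ h2]; split.
      by rewrite -(inc_leE yi')//; exact: ltnW.
    by rewrite -(inc_leE yi').
  move=> [h1 h2] t; rewrite /= !in_itv/= => /andP[t1 t2]; apply/andP; split.
    by apply: le_trans t1; apply: (inc_le yi') => //; exact: ltnW.
  by apply: (le_trans t2); apply: (inc_le yi').
move=> [k2 kM]; exists j, (j' - j)%N; rewrite subnKC ?(ltnW jj')//; split=> //.
by rewrite k2 -(ler_nat R) (le_trans kM).
Qed.

Lemma cgrid_of_grid (M' : nat) : M <= M'%:R ->
  cgrid B M' p q (fun n => Omega n.+2) (fun n => y n.+2).
Proof.
move=> MM; split => //.
- move=> n; have [N0 _ _ _ _] := gp (ltn0Sn n).
  have [j [k [hk jk _ _]]] := y_children MM (ltn0Sn n) N0.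
  by clear -hk jk; lia.
- by move=> n; have [] := gp (ltn0Sn n.+1).
- by move=> n; have [] := gp (ltn0Sn n.+1).
- by move=> n; exact: y_inc.
- by move=> n; exact: y_ratio.
- by move=> n i iN; exact: y_children.
Qed.

Context {h : R -> R} (hi : increasing_on p q h).

Lemma len_image s t : p <= s -> s < t -> t <= q -> len (h @` `[s, t]%classic) = h t - h s.
Proof.
move=> ps st tq.
have mono a b : s <= a -> a <= b -> b <= t -> h a <= h b.
  move=> sa; rewrite le_eqVlt => /predU1P[->//|ab] bt.
  by apply/ltW/hi => //; [exact: le_trans ps sa|exact: le_trans bt tq].
have inS : `[s, t]%classic s by rewrite /= in_itv/= lexx ltW.
have inT : `[s, t]%classic t by rewrite /= in_itv/= lexx ltW.
have ub : ubound (h @` `[s, t]%classic) (h t).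
  by move=> _ [a /= + <-]; rewrite in_itv/= => /andP[sa at']; apply: mono.
have lb : lbound (h @` `[s, t]%classic) (h s).
  by move=> _ [a /= + <-]; rewrite in_itv/= => /andP[sa at']; apply: mono.
rewrite /len; congr (_ - _); apply/eqP; rewrite eq_le; apply/andP; split.
- by apply: ge_sup => //; exists (h t), t.
- by apply: ub_le_sup; [exists (h t)|exists t].
- by apply: ge_inf; [exists (h s)|exists s].
- by apply: lb_le_inf => //; exists (h s), s.
Qed.

Lemma lrd_itv s t w : p <= s -> s < t -> t < w -> w <= q ->
  lrd h `[s, t]%classic `[t, w]%classic = lr h s t w /\
  lrd h `[t, w]%classic `[s, t]%classic = - lr h s t w.
Proof.
move=> ps st tw wq.
have pt := le_trans ps (ltW st); have tq := le_trans (ltW tw) wq.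
rewrite /lrd !len_image// !len_itv ?(ltW st) ?(ltW tw)//.
have h1 : 0 < h t - h s by rewrite subr_gt0 hi.
have h2 : 0 < h w - h t by rewrite subr_gt0 hi.
have g1 : 0 < t - s by rewrite subr_gt0.
have g2 : 0 < w - t by rewrite subr_gt0.
rewrite /lr /sec; split.
  by congr ln; field; rewrite !gt_eqF.
rewrite -lnV ?posrE; last by rewrite divr_gt0// divr_gt0.
by congr ln; field; rewrite !gt_eqF.
Qed.

Lemma crd_itv s t w z : p <= s -> s < t -> t < w -> w < z -> z <= q ->
  crd h `[s, t]%classic `[t, w]%classic `[w, z]%classic = cd h s t w z /\
  crd h `[w, z]%classic `[t, w]%classic `[s, t]%classic = cd h s t w z.
Proof.
move=> ps st tw wz zq.
have pt := le_trans ps (ltW st); have pw := le_trans pt (ltW tw).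
have wq := le_trans (ltW wz) zq; have tq := le_trans (ltW tw) wq.
rewrite /crd /cr !len_image// !len_itv ?(ltW st) ?(ltW tw) ?(ltW wz)//.
have h1 : 0 < h t - h s by rewrite subr_gt0 hi.
have h2 : 0 < h w - h t by rewrite subr_gt0 hi.
have h3 : 0 < h z - h w by rewrite subr_gt0 hi.
have g1 : 0 < t - s by rewrite subr_gt0.
have g2 : 0 < w - t by rewrite subr_gt0.
have g3 : 0 < z - w by rewrite subr_gt0.
have h12 : 0 < h w - h s by lra.
have h23 : 0 < h z - h t by lra.
have g12 : 0 < w - s by lra.
have g23 : 0 < z - t by lra.
have E (a b c : R) : 0 < a -> 0 < c -> 1 + b / a * ((a + b + c) / c) = (a + b) * (b + c) / (a * c).
  by move=> a0 c0; field; rewrite !gt_eqF.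
have P (a b c : R) : 0 < a -> 0 < b -> 0 < c -> 0 < (a + b) * (b + c) / (a * c).
  by move=> *; rewrite divr_gt0// mulr_gt0// addr_gt0.
rewrite !E// -!ln_div ?posrE ?P// /cd /sec; split; congr ln; field;
  by rewrite !gt_eqF//; lra.
Qed.

(** Reversing the direction changes the sign of the ratio distortion, so pairs of
    adjacent intervals and nodes correspond up to this sign. *)
Lemma pair_node n b : pairs Omega n b -> exists i,
  [/\ (i.+2 <= Omega n)%N,
    `|grid_lrd h G n b| = `|lr h (y n i) (y n i.+1) (y n i.+2)|, 0 < grid_len G n b &
    grid_len G n b <= y n i.+2 - y n i <= (1 + B) * grid_len G n b].
Proof.
move=> [n1 hb]; have [N0 yi y0 yN GE] := gp n1.
have hb1 : (1 <= b <= Omega n)%N by clear -hb; lia.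
have hb2 : (1 <= b.+1 <= Omega n)%N by clear -hb; lia.
have fin i : (i.+2 <= Omega n)%N -> [/\ p <= y n i, y n i < y n i.+1,
    y n i.+1 < y n i.+2, y n i.+2 <= q & (y n i.+2 - y n i.+1 <= B * (y n i.+1 - y n i)) /\
    (y n i.+1 - y n i <= B * (y n i.+2 - y n i.+1))].
  move=> iN; have [? ?] := y_ratio n1 iN; split => //.
  - by have /andP[] := y_in n1 (ltnW (ltnW iN)).
  - by apply: yi; exact: ltnW.
  - exact: yi.
  - by have /andP[] := y_in n1 iN.
rewrite /grid_lrd /grid_len GE// GE// /pos; case: (ori n).
  exists b.-1; have Eb : b.-1.+2 = b.+1 by clear -hb; lia.
  have [p1 p2 p3 p4 [p5 p6]] := fin b.-1 ltac:(clear -hb; lia).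
  rewrite Eb in p3 p4 p5 p6 *; have E1 : b.-1.+1 = b by clear -hb; lia.
  rewrite E1 /= in p2 p3 p5 p6 *.
  have [-> _] := lrd_itv p1 p2 p3 p4; rewrite len_itv ?(ltW p2)//.
  by split; [clear -hb; lia|by []|lra|apply/andP; split; lra].
exists (Omega n - b.+1)%N; have E1 : (Omega n - b)%N = (Omega n - b.+1).+1 by clear -hb; lia.
have [p1 p2 p3 p4 [p5 p6]] := fin (Omega n - b.+1)%N ltac:(clear -hb; lia).
rewrite E1; have [_ ->] := lrd_itv p1 p2 p3 p4; rewrite normrN len_itv ?(ltW p3)//.
by split; [clear -hb; lia|by []|lra|apply/andP; split; lra].
Qed.

Lemma node_pair n i : (1 <= n)%N -> (i.+2 <= Omega n)%N -> exists b,
  [/\ pairs Omega n b,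
    `|grid_lrd h G n b| = `|lr h (y n i) (y n i.+1) (y n i.+2)|, 0 < grid_len G n b &
    grid_len G n b <= y n i.+2 - y n i <= (1 + B) * grid_len G n b].
Proof.
move=> n1 iN.
pose b := if ori n then i.+1 else (Omega n - i.+1)%N.
have hb : pairs Omega n b by split=> //; rewrite /b; case: (ori n); clear -iN; lia.
have [N0 yi y0 yN GE] := gp n1; exists b.
have hb1 : (1 <= b <= Omega n)%N by clear -hb; case: hb => _; lia.
have hb2 : (1 <= b.+1 <= Omega n)%N by clear -hb; case: hb => _; lia.
have p1 : p <= y n i by have /andP[] := y_in n1 (ltnW (ltnW iN)).
have p2 : y n i < y n i.+1 by apply: yi; exact: ltnW.
have p3 : y n i.+1 < y n i.+2 by exact: yi.
have p4 : y n i.+2 <= q by have /andP[] := y_in n1 iN.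
have [p5 p6] := y_ratio n1 iN.
rewrite /grid_lrd /grid_len GE// GE//.
have [[-> ->]|[-> ->]] : (pos (ori n) (Omega n) b = i /\ pos (ori n) (Omega n) b.+1 = i.+1) \/
   (pos (ori n) (Omega n) b = i.+1 /\ pos (ori n) (Omega n) b.+1 = i).
  rewrite /b /pos; case: (ori n); first by left.
  by right; clear -iN; lia.
- have [-> _] := lrd_itv p1 p2 p3 p4; rewrite len_itv ?(ltW p2)//.
  by split; [by []|by []|lra|apply/andP; split; lra].
- have [_ ->] := lrd_itv p1 p2 p3 p4; rewrite normrN len_itv ?(ltW p3)//.
  by split; [by []|by []|lra|apply/andP; split; lra].
Qed.

(** The cross-ratio distortion is symmetric under reversal, but the length in
    the bounds is that of the first interval of the triple, which is the leftmost
    or the rightmost of the three cells. *)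
Definition quad_data n i b :=
  [/\ `|grid_crd h G n b| = `|cd h (y n i) (y n i.+1) (y n i.+2) (y n i.+3)|,
    0 < grid_len G n b, grid_len G n b <= (1 + B) * (y n i.+2 - y n i) &
    y n i.+3 - y n i <= (1 + B + B ^+ 2) * grid_len G n b].

Lemma quad_dataP n i b : (1 <= n)%N -> (i.+3 <= Omega n)%N ->
  (1 <= b)%N -> (b.+2 <= Omega n)%N ->
  [\/ pos (ori n) (Omega n) b = i /\ ori n | pos (ori n) (Omega n) b = i.+2 /\ ~~ ori n] ->
  quad_data n i b.
Proof.
move=> n1 iN b1 bN E.
have hb1 : (1 <= b <= Omega n)%N by clear -b1 bN; lia.
have hb2 : (1 <= b.+1 <= Omega n)%N by clear -bN; lia.
have hb3 : (1 <= b.+2 <= Omega n)%N by clear -bN; lia.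
have [N0 yi y0 yN GE] := gp n1.
have p1 : p <= y n i by have /andP[] := y_in n1 (ltnW (ltnW (ltnW iN))).
have p2 : y n i < y n i.+1 by apply: yi; exact/ltnW/ltnW.
have p3 : y n i.+1 < y n i.+2 by apply: yi; exact: ltnW.
have p4 : y n i.+2 < y n i.+3 by exact: yi.
have p5 : y n i.+3 <= q by have /andP[] := y_in n1 iN.
have [p6 p7] := y_ratio n1 (ltnW iN); have [p8 p9] := y_ratio n1 iN.
have B1' := B1; have B0 : 0 <= B by lra.
have p10 := ler_wpM2l B0 p8; have p11 := ler_wpM2l B0 p6.
have p12 := ler_wpM2l B0 p7; have p13 := ler_wpM2l B0 p9.
have [c1 c2] := crd_itv p1 p2 p3 p4 p5.
rewrite /quad_data /grid_crd /grid_len GE// GE// GE//.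
case: E => -[E oE].
  have E2 : pos (ori n) (Omega n) b.+1 = i.+1 by move: E; rewrite /pos oE; clear -b1; lia.
  have E3 : pos (ori n) (Omega n) b.+2 = i.+2 by move: E; rewrite /pos oE; clear -b1; lia.
  rewrite E E2 E3 c1 len_itv ?(ltW p2)//.
  by clear -p2 p3 p4 p6 p8 p11 p10 B1'; split=> //; lra.
have E2 : pos (ori n) (Omega n) b.+1 = i.+1 by move: E; rewrite /pos (negPf oE); clear -bN; lia.
have E3 : pos (ori n) (Omega n) b.+2 = i by move: E; rewrite /pos (negPf oE); clear -bN; lia.
rewrite E E2 E3 c2 len_itv ?(ltW p4)//.
have B2 : 0 <= B * (y n i.+1 - y n i) by rewrite mulr_ge0//; lra.
by clear -p2 p3 p4 p7 p9 p8 p12 p13 B1' B2; split=> //; lra.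
Qed.

Lemma triple_quad n b : triples Omega n b ->
  exists2 i, (i.+3 <= Omega n)%N & quad_data n i b.
Proof.
move=> [n1 [b1 bN]].
exists (if ori n then b.-1 else (Omega n - b.+2)%N).
  by case: (ori n); clear -b1 bN; lia.
apply: quad_dataP => //; first by case: (ori n); clear -b1 bN; lia.
by rewrite /pos; case: (ori n); [left|right]; split=> //; clear -b1 bN; lia.
Qed.

Lemma quad_triple n i : (1 <= n)%N -> (i.+3 <= Omega n)%N ->
  exists2 b, triples Omega n b & quad_data n i b.
Proof.
move=> n1 iN.
exists (if ori n then i.+1 else (Omega n - i.+2)%N).
  by split=> //; case: (ori n); clear -iN; lia.
apply: quad_dataP => //; try by case: (ori n); clear -iN; lia.
by rewrite /pos; case: (ori n); [left|right]; split=> //; clear -iN; lia.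
Qed.

End GridTransport.

(** * Moduli of continuity *)

Section Modulus.
Context {R : realType}.
Implicit Types (e : R -> R) (P : R -> R -> Prop).

(** Moduli of continuity are only used through smallness near 0 and boundedness on
    bounded intervals; [modulus_above] goes back from these two properties. *)
Lemma modulus_small e : modulus e -> forall b, 0 < b ->
  exists2 d, 0 < d & forall t, 0 <= t -> t < d -> e t <= b.
Proof.
move=> [/subspace_continuousP ec _ e0] b b0.
have /cvgrPdist_le/(_ b b0) := ec 0 ltac:(by rewrite /= in_itv/= lexx).
rewrite /within /= => /nbhs_ballP[d /= d0 Hd]; exists d => // t t0 td.
have tB : ball 0 d t by rewrite /ball /= sub0r normrN ger0_norm.
have : `|e 0 - e t| <= b := Hd t tB ltac:(by rewrite /= in_itv/= t0).
by rewrite e0 sub0r normrN => h; apply: le_trans h; exact: ler_norm.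
Qed.

Lemma modulus_bounded e W : modulus e ->
  exists2 K, 0 <= K & forall t, 0 <= t -> t <= W -> e t <= K.
Proof.
move=> [ec e_ge0 e0]; have [W0|W0] := leP 0 W; last first.
  by exists 0 => // t t0 tW; move: t0 tW W0; lra.
have ecW : {within `[0, W]%classic, continuous e}.
  apply: continuous_subspaceW ec => t /=; rewrite !in_itv/= => /andP[->//].
have [c cI Hc] := EVT_max W0 ecW.
move: cI; rewrite in_itv/= => /andP[c0 _].
exists (e c); first exact: e_ge0.
by move=> t t0 tW; apply: Hc; rewrite in_itv/= t0.
Qed.

(** The least concave majorant of the data: the infimum of the affine functions
    [a + b t] with nonnegative coefficients that lie above all of the points. *)
Lemma modulus_above P K : (forall t v, P t v -> 0 <= t /\ v <= K) ->
  (forall b, 0 < b -> exists2 d, 0 < d & forall t v, P t v -> t < d -> v <= b) ->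
  exists2 e, modulus e & forall t v, P t v -> v <= e t.
Proof.
move=> PK Psmall.
wlog K0 : K PK / 0 < K.
  move=> W; apply: (W (Num.max K 1)); last by rewrite lt_max ltr01 orbT.
  by move=> t v /PK[? h]; split=> //; rewrite le_max h.
pose D (ab : R * R) := [/\ 0 <= ab.1, 0 <= ab.2 &
  forall s v, P s v -> v <= ab.1 + ab.2 * s].
pose S t := [set z | exists2 ab, D ab & z = ab.1 + ab.2 * t].
pose e t := inf (S t).
have DK : D (K, 0).
  by split=> //=; [exact: ltW|move=> s v /PK[_]; rewrite mul0r addr0].
have S0 t : S t !=set0 by exists (K + 0 * t); exists (K, 0).
have Slb t : 0 <= t -> lbound (S t) 0.
  move=> t0 _ [ab [a0 b0 _] ->]; exact: addr_ge0 a0 (mulr_ge0 b0 t0).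
have le_e t z : 0 <= t -> S t z -> e t <= z.
  by move=> t0 Sz; apply: ge_inf => //; exists 0; exact: Slb.
have e_ge0 t : 0 <= t -> 0 <= e t.
  by move=> t0; apply: lb_le_inf => //; exact: Slb.
have eK t : 0 <= t -> e t <= K.
  by move=> t0; apply: le_e => //; exists (K, 0) => //=; rewrite mul0r addr0.
have e_mono s t : 0 <= s -> s <= t -> e s <= e t.
  move=> s0 st; apply: lb_le_inf => // _ [[a b] [a0 b0 H] ->] /=.
  apply: (@le_trans _ _ (a + b * s)); last by rewrite lerD2l ler_wpM2l.
  by apply: le_e => //; exists (a, b).
have e_conc s t : 0 < s -> s <= t -> e t - e s <= K * (t - s) / s.
  move=> s0 st; have t0 : 0 < t by exact: lt_le_trans st.
  have h1 : s / t * e t <= e s.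
    apply: lb_le_inf => // _ [[a b] Dab ->] /=.
    have h : e t <= a + b * t by apply: le_e; [exact: ltW|exists (a, b)].
    have [a0 _ _] := Dab; rewrite /= in a0.
    rewrite mulrAC ler_pdivrMr//.
    have h2 := ler_wpM2l (ltW s0) h; have h3 := ler_wpM2l a0 st.
    by apply: (le_trans h2); rewrite -[leLHS]addr0; move: h3; nra.
  have h2 : e t <= e s * t / s.
    by rewrite ler_pdivlMr// mulrC -ler_pdivrMr// mulrAC.
  have -> : K * (t - s) / s = K * t / s - K by field; rewrite gt_eqF.
  have h3 : (e s - K) * t / s <= e s - K.
    rewrite ler_pdivrMr//; apply: ler_wnM2l => //.
    by rewrite subr_le0; exact/eK/ltW.
  have -> : K * t / s - K = (e s * t / s - (e s - K) * t / s) - K by field; rewrite gt_eqF.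
  by move: h2 h3; clear; lra.
have e_lin b : 0 < b -> exists2 c, 0 < c & forall t, 0 <= t -> e t <= b + c * t.
  move=> b0; have [d d0 Hd] := Psmall b b0; exists (K / d); first exact: divr_gt0.
  move=> t t0; apply: le_e => //; exists (b, K / d) => //; split=> /=.
  - exact: ltW.
  - by rewrite divr_ge0 ?ltW.
  move=> s v Psv; have [s0 vK] := PK _ _ Psv; have [sd|ds] := ltP s d.
    have := Hd _ _ Psv sd; have : 0 <= K / d * s by rewrite mulr_ge0// divr_ge0 ?ltW.
    by lra.
  have : K <= K / d * s by rewrite mulrAC ler_pdivlMr// ler_pM2l.
  by lra.
have e00 : e 0 = 0.
  apply/eqP; rewrite eq_le e_ge0// andbT; apply/ler_addgt0Pr => b b0.
  by have [c _ /(_ 0 (lexx _))] := e_lin b b0; rewrite mulr0 addr0 add0r.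
exists e; last first.
  move=> t v Ptv; apply: lb_le_inf => // _ [ab [_ _ H] ->]; exact: H.
split=> //; apply/subspace_continuousP => s; rewrite /= in_itv/= andbT => s0.
apply/cvgrPdist_le => b b0; rewrite /within /=; apply/nbhs_ballP.
move: s0; rewrite le_eqVlt => /predU1P[<-|s0].
  have [c c0 Hc] := e_lin (b / 2) ltac:(lra).
  exists (b / 2 / c); first by rewrite /= !divr_gt0.
  move=> t; rewrite /ball /= sub0r normrN => td; rewrite in_itv/= andbT => t0.
  suff : `|e 0 - e t| <= b by [].
  rewrite e00 sub0r normrN ger0_norm ?e_ge0//; apply: (le_trans (Hc t t0)).
  by move: td; rewrite ger0_norm// ltr_pdivlMr// => ?; lra.
exists (Num.min (s / 2) (b * s / (2 * K))).
  by rewrite /= lt_min !divr_gt0 ?mulr_gt0.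
move=> t; rewrite /ball /= lt_min => /andP[t1 t2]; rewrite in_itv/= andbT => t0.
have fin u w : s / 2 <= u -> u <= w -> w - u < b * s / (2 * K) -> `|e w - e u| <= b.
  move=> su uw wu; have u0 : 0 < u by lra.
  have m : 0 <= e w - e u by rewrite subr_ge0 e_mono// ltW.
  rewrite ger0_norm//; apply: (le_trans (e_conc u w u0 uw)).
  rewrite ler_pdivrMr//; move: wu; rewrite ltr_pdivlMr ?mulr_gt0// => wu.
  have : b * (s / 2) <= b * u by rewrite ler_wpM2l// ltW.
  by move: wu; clear; lra.
suff : `|e s - e t| <= b by [].
have [st|ts] := leP s t.
  rewrite distrC; apply: fin => //; first by lra.
  by move: t2; rewrite distrC ger0_norm// subr_ge0.
move: t1 t2; rewrite gtr0_norm ?subr_gt0// => t1 t2.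
by apply: fin => //; [lra|exact: ltW].
Qed.

Lemma modulus0 : modulus (fun _ : R => 0).
Proof. by split=> //; exact: cst_continuous. Qed.

End Modulus.

(** * Smoothness classes on an interval *)

Section Smoothness.
Context {R : realType}.
Implicit Types (p q u a : R) (f g h : R -> R).

Definition has_derivs p q f f' := forall u, p <= u <= q -> has_deriv p q f u (f' u).

Definition holder_itv a p q f := exists2 C, 0 <= C & forall u v,
  p <= u <= q -> p <= v <= q -> `|f u - f v| <= C * `|u - v| `^ a.

Lemma holder_onP a p q f : holder_on a `[p, q]%classic f <-> holder_itv a p q f.
Proof.
split=> [[c H]|[c c0 H]]; last by exists c => u v /itvccP uI /itvccP vI; exact: H.
exists `|c|; rewrite ?normr_ge0// => u v /itvccP uI /itvccP vI.
by apply: le_trans (H u v uI vI) _; rewrite ler_wpM2r ?powR_ge0// ler_norm.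
Qed.

Lemma lipschitzP p q f : p <= q ->
  [lipschitz f x | x in `[p, q]%classic] <-> holder_on 1 `[p, q]%classic f.
Proof.
move=> pq; split.
  move=> [M [_ HM]]; exists (M + 1) => u v uI vI; rewrite powRr1//.
  by have /= := HM (M + 1) ltac:(by rewrite ltrDl) (u, v) (conj uI vI).
move=> [c H]; apply: (@klipschitzW _ _ _ c).
  apply: (@globally_properfilter _ _ (p, p)).
  by split; apply/itvccP; rewrite lexx pq.
by move=> [u v] /= [uI vI]; have := H u v uI vI; rewrite powRr1.
Qed.

Lemma holder_ext a p q f g : (forall u, p <= u <= q -> f u = g u) ->
  holder_itv a p q f -> holder_itv a p q g.
Proof. by move=> fg [C C0 H]; exists C => // u v uI vI; rewrite -!fg//; exact: H. Qed.

Lemma holder_sub a p q p' q' f : p <= p' -> q' <= q ->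
  holder_itv a p q f -> holder_itv a p' q' f.
Proof.
by move=> pp qq [C C0 H]; exists C => // u v /andP[? ?] /andP[? ?]; apply: H;
  apply/andP; split; lra.
Qed.

Lemma holderN a p q f : holder_itv a p q f -> holder_itv a p q (fun u => - f u).
Proof.
move=> [C C0 H]; exists C => // u v uI vI.
by rewrite -opprD normrN; exact: H.
Qed.

Lemma has_derivs_ext p q f g f' : (forall y, p <= y <= q -> f y = g y) ->
  has_derivs p q f f' -> has_derivs p q g f'.
Proof. by move=> fg H u uI; apply: (has_deriv_ext fg uI); exact: H. Qed.

Lemma has_derivs_sub p q p' q' f f' : p <= p' -> q' <= q ->
  has_derivs p q f f' -> has_derivs p' q' f f'.
Proof.
move=> pp qq H u /andP[? ?]; apply: (has_deriv_sub pp qq).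
by apply: H; apply/andP; split; lra.
Qed.

Lemma has_derivsN p q f f' : has_derivs p q f f' ->
  has_derivs p q (fun u => - f u) (fun u => - f' u).
Proof. by move=> H u uI; apply: has_derivN; exact: H. Qed.

Lemma derivable_has_derivs p q h : p < q ->
  (forall u, `[p, q]%classic u -> derivable_in `[p, q]%classic h u) ->
  has_derivs p q h (derive_in `[p, q]%classic h).
Proof. by move=> pq H u uI; apply: derive_in_deriv => //; apply/H/itvccP. Qed.

Lemma has_derivs_derivable p q h f : has_derivs p q h f ->
  forall u, `[p, q]%classic u -> derivable_in `[p, q]%classic h u.
Proof. by move=> H u /itvccP uI; apply/derivable_inP; exists (f u); exact: H. Qed.

Lemma has_derivs_derive p q h f : p < q -> has_derivs p q h f ->
  forall u, p <= u <= q -> derive_in `[p, q]%classic h u = f u.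
Proof. by move=> pq H u uI; apply: derive_inE => //; exact: H. Qed.

Lemma C1_holderP a p q h : p < q -> C1_holder a `[p, q]%classic h <->
  exists2 f, has_derivs p q h f & holder_itv a p q f.
Proof.
move=> pq; split.
  move=> [dh /holder_onP hh]; exists (derive_in `[p, q]%classic h) => //.
  exact: derivable_has_derivs.
move=> [f hf fh]; split; first exact: has_derivs_derivable hf.
by apply/holder_onP/(holder_ext _ fh) => u uI; rewrite (has_derivs_derive pq hf).
Qed.

Lemma C2_holderP a p q h : p < q -> C2_holder a `[p, q]%classic h <->
  exists f g, [/\ has_derivs p q h f, has_derivs p q f g & holder_itv a p q g].
Proof.
move=> pq; split.
  move=> [dh ddh /holder_onP hh]; exists (derive_in `[p, q]%classic h).
  exists (derive_in `[p, q]%classic (derive_in `[p, q]%classic h)).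
  by split=> //; exact: derivable_has_derivs.
move=> [f [g [hf hg gh]]].
have hg' : has_derivs p q (derive_in `[p, q]%classic h) g.
  by apply: has_derivs_ext hg => u uI; rewrite (has_derivs_derive pq hf).
split; [exact: has_derivs_derivable hf|exact: has_derivs_derivable hg'|].
by apply/holder_onP/(holder_ext _ gh) => u uI; rewrite (has_derivs_derive pq hg').
Qed.

Lemma C1_lipschitzP p q h : p < q ->
  C1_lipschitz `[p, q]%classic h <-> C1_holder 1 `[p, q]%classic h.
Proof. by move=> pq; split=> -[dh /(lipschitzP _ (ltW pq)) hh]. Qed.

Lemma C2_lipschitzP p q h : p < q ->
  C2_lipschitz `[p, q]%classic h <-> C2_holder 1 `[p, q]%classic h.
Proof. by move=> pq; split=> -[dh ddh /(lipschitzP _ (ltW pq)) hh]. Qed.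

Lemma derive_neq0P p q h f : p < q -> has_derivs p q h f ->
  derive_neq0 `[p, q]%classic h <-> forall u, p <= u <= q -> f u <> 0.
Proof.
move=> pq hf; split=> H u uI.
  by have [_] := H u (iffRL (itvccP p q u) uI); rewrite (has_derivs_derive pq hf).
have uI' := iffLR (itvccP p q u) uI.
split; first exact: has_derivs_derivable hf u uI.
by rewrite (has_derivs_derive pq hf)//; exact: H.
Qed.

Lemma derive_neq0_derivs p q h : p < q -> derive_neq0 `[p, q]%classic h ->
  has_derivs p q h (derive_in `[p, q]%classic h).
Proof. by move=> pq H; apply: derivable_has_derivs => // u /H[]. Qed.

End Smoothness.

(** * Regularity from distortion on a subdivision *)

(** The conclusions on the derivative that are reused for the second derivative. *)
Definition C1_data (R : realType) (p q : R) (h : R -> R) (a : R) (f : R -> R) (C m : R) :=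
  [/\ 0 <= C /\ 0 < m, has_derivs p q h f,
    forall s t, p <= s -> s < t -> t <= q -> forall s1 t1 u,
      s <= s1 -> s1 < t1 -> t1 <= t -> s <= u <= t ->
      `|sec h s1 t1 - f u| <= C * (t - s) `^ a,
    forall u v, p <= u <= q -> p <= v <= q -> `|f u - f v| <= C * `|u - v| `^ a &
    (forall u, p <= u <= q -> m <= f u) /\
    (forall s t, p <= s -> s < t -> t <= q -> m <= sec h s t)].

Section GridConclusions.
Context {R : realType} {B : R} {M : nat} {p q : R} {N : nat -> nat}
  {x : nat -> nat -> R} (cg : cgrid B M p q N x).
Context {h : R -> R} (hi : increasing_on p q h).

Local Notation width := (@width R x).
Local Notation node_lr := (@node_lr R x h).
Local Notation quad_cd := (@quad_cd R x h).

Let xi := cg_inc cg.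

Lemma has_deriv_ge (f : R -> R) m u l : p <= u <= q -> has_deriv p q f u l ->
  (forall s t, p <= s -> s < t -> t <= q -> m <= sec f s t) -> m <= l.
Proof.
move=> uI H hm; apply/ler_addgt0Pr => e e0; have [d d0 Hd] := H e e0.
have PF := within_proper (pq_lt cg) uI.
have : (within `[p, q]%classic u^') (fun y => [/\ p <= y <= q, y != u & `|y - u| < d]).
  by apply/near_withinP; exists d.
move=> /filter_ex[y [yI yu yd]].
have := Hd y yI yu yd; rewrite ler_norml => /andP[_ h1].
suff : m <= sec f u y by lra.
case/andP: uI => pu uq; case/andP: yI => py yq.
have [uy|yu'|E] := ltgtP u y; last by rewrite E eqxx in yu.
  exact: hm.
by rewrite sec_sym; exact: hm.
Qed.

Lemma C1_of_node_lr_all (hc : cont_on p q h) (K a : R) : 0 < a ->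
  (forall n i, (i.+2 <= N n)%N -> `|node_lr n i| <= K * width n i `^ a) ->
  exists f C m, C1_data p q h a f C m.
Proof.
move=> a0 Hr; have [sh [m m0 hm]] := secant_holder_of_lr cg hi hc a0 Hr.
have [C [f [C0 hf fs ff]]] := secant_holder_deriv a0 (pq_lt cg) sh.
exists f, C, m; split=> //; split=> // u uI.
exact: (has_deriv_ge uI (hf u uI) hm).
Qed.

(** A cell shorter than all those of the first levels belongs to a deep level. *)
Lemma cell_size_gt0 n0 : exists2 sg, 0 < sg &
  forall n i, (n < n0)%N -> (i < N n)%N -> sg <= x n i.+1 - x n i.
Proof.
have one n : exists2 sg, 0 < sg & forall i, (i < N n)%N -> sg <= x n i.+1 - x n i.
  have [K K0 HK] := finite_bound (fun i => (x n i.+1 - x n i)^-1) (N n).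
  exists (K + 1)^-1; first by rewrite invr_gt0 ltr_wpDl.
  move=> i iN; have g0 : 0 < x n i.+1 - x n i by rewrite subr_gt0 xi.
  have K1 : 0 < K + 1 by rewrite ltr_wpDl.
  rewrite -[leRHS]invrK lef_pV2 ?posrE ?invr_gt0//.
  by have := HK i iN; lra.
elim: n0 => [|n0 [s1 s10 H1]]; first by exists 1.
have [s2 s20 H2] := one n0; exists (Num.min s1 s2); first by rewrite lt_min s10.
move=> n i; rewrite ltnS leq_eqVlt => /predU1P[->|nn] iN.
  by rewrite ge_min (H2 _ iN) orbT.
by rewrite ge_min (H1 _ _ nn iN).
Qed.

Lemma three_point_bounded n0 rho p' q' d : p <= p' -> q' <= q -> 1 <= d ->
  (forall n l, (n0 <= n)%N -> (l.+2 <= N n)%N -> p' <= x n l.+1 <= q' ->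
    `|node_lr n l| <= rho) ->
  exists2 K, 0 <= K & forall s u t, p' <= s -> s < u -> u < t -> t <= q' ->
    u - s <= d * (t - u) -> t - u <= d * (u - s) -> `|lr h s u t| <= K.
Proof.
move=> pp qq d1 Hr.
have [k [K [S [nk S0 H]]]] := three_point_bound cg hi (tau := 2^-1) n0 d1
  ltac:(by rewrite lexx invr_gt0 ltr0n).
exists (2 * (K%:R * `|rho|) + 4 * 2^-1).
  by rewrite addr_ge0// ?mulr_ge0// invr_ge0.
move=> s u t ps su ut tq h1 h2.
have [n [_ Hn]] := H s u t (le_trans pp ps) su ut (le_trans tq qq) h1 h2.
have := Hn `|rho| (normr_ge0 _) _; rewrite (_ : ln _ = lr h s u t).
  apply=> l lN /andP[sx xt]; apply: le_trans (ler_norm rho).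
  by apply: Hr => //; [exact: leq_trans nk (leq_addr _ _)|apply/andP; split; lra].
have hus : 0 < h u - h s by rewrite subr_gt0 hi//; lra.
rewrite /lr /sec; congr ln; field.
by rewrite !gt_eqF// subr_gt0.
Qed.

(** The number of cells in [three_point_bound] depends on the accuracy [tau] only,
    so it can be fixed first and the ratio distortion made small afterwards. *)
Lemma three_point_small d : 1 <= d ->
  (forall eta, 0 < eta -> exists n0, forall n l, (n0 <= n)%N -> (l.+2 <= N n)%N ->
    `|node_lr n l| <= eta) ->
  forall e, 0 < e -> exists2 del, 0 < del & forall s u t,
    p <= s -> s < u -> u < t -> t <= q -> t - s < del ->
    u - s <= d * (t - u) -> t - u <= d * (u - s) -> `|lr h s u t| <= e.
Proof.
move=> d1 Hr e e0.
pose tau := Num.min 2^-1 (e / 8).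
have tau0 : 0 < tau by rewrite lt_min invr_gt0 ltr0n divr_gt0.
have tau1 : tau <= 2^-1 by rewrite ge_min lexx.
have tau2 : tau <= e / 8 by rewrite ge_min lexx orbT.
have [k [K [S [nk S0 H]]]] := three_point_bound cg hi (tau := tau) 0%N d1
  ltac:(by rewrite tau0).
have K0 : 0 < 4 * (K%:R + 1) :> R by rewrite mulr_gt0// ltr_wpDl.
have [n0 Hn0] := Hr (e / (4 * (K%:R + 1))) ltac:(by rewrite divr_gt0).
have [sg sg0 Hsg] := cell_size_gt0 n0.
exists (sg / S); first exact: divr_gt0.
move=> s u t ps su ut tq; rewrite ltr_pdivlMr// => ts h1 h2.
have [n [[i iN iS] Hn]] := H s u t ps su ut tq h1 h2.
have nn : (n0 <= n)%N.
  rewrite leqNgt; apply/negP => nn; have := Hsg n i nn iN.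
  by move: iS ts; rewrite [S * _]mulrC; lra.
have r0 : 0 <= e / (4 * (K%:R + 1)) by rewrite divr_ge0 ?ltW.
have := Hn _ r0 _; rewrite (_ : ln _ = lr h s u t).
  move=> /(_ _)/le_trans; apply.
    by move=> l lN _; apply: Hn0 => //; exact: leq_trans nn (leq_addl _ _).
  have : K%:R * (e / (4 * (K%:R + 1))) <= e / 4.
    rewrite mulrA ler_pdivrMr//.
    have -> : e / 4 * (4 * (K%:R + 1)) = K%:R * e + e by field.
    by lra.
  by lra.
have hus : 0 < h u - h s by rewrite subr_gt0 hi//; lra.
rewrite /lr /sec; congr ln; field.
by rewrite !gt_eqF// subr_gt0.
Qed.

(** In the cross-ratio of three consecutive cells, the two overlapping secants are
    averages in which the slope of the middle cell has a definite weight; hence this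
    slope is at most a constant times either of its neighbours. *)
Lemma middle_slope c n l : (l.+3 <= N n)%N -> `|quad_cd n l| <= c ->
  let s i := sec h (x n i) (x n i.+1) in
  s l.+1 <= expR c * (1 + B) ^+ 2 * s l /\ s l.+1 <= expR c * (1 + B) ^+ 2 * s l.+2.
Proof.
move=> lN Hc s.
have B0 : 0 < 1 + B by have := cg_B cg; lra.
have s0 i : (i < N n)%N -> 0 < s i by move=> iN; apply: (grid_sec_gt0 cg hi).
have avg i : (i.+2 <= N n)%N -> s i <= (1 + B) * sec h (x n i) (x n i.+2) /\
    s i.+1 <= (1 + B) * sec h (x n i) (x n i.+2).
  move=> iN; have [r1 r2] := cg_ratio cg iN.
  have g0 : 0 < x n i.+1 - x n i by rewrite subr_gt0 xi// ltnW.
  have g1 : 0 < x n i.+2 - x n i.+1 by rewrite subr_gt0 xi.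
  have sE j : (j < N n)%N -> h (x n j.+1) - h (x n j) = s j * (x n j.+1 - x n j).
    by move=> jN; rewrite /s /sec divfK// subr_eq0 gt_eqF// xi.
  have e1 := sE i (ltnW iN); have e2 := sE i.+1 iN.
  have i0 := s0 i (ltnW iN); have i1 := s0 i.+1 iN.
  have -> : sec h (x n i) (x n i.+2) =
    (s i * (x n i.+1 - x n i) + s i.+1 * (x n i.+2 - x n i.+1)) / (x n i.+2 - x n i).
    by rewrite -e1 -e2 /sec; congr (_ / _); ring.
  have w0 : 0 < x n i.+2 - x n i by lra.
  rewrite !mulrA !ler_pdivlMr//.
  have m1 := mulr_gt0 i0 g0; have m2 := mulr_gt0 i0 g1.
  have m3 := mulr_gt0 i1 g0; have m4 := mulr_gt0 i1 g1.
  have k1 := ler_wpM2l (ltW i0) r1; have k2 := ler_wpM2l (ltW i1) r2.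
  have b0 : 0 <= B by have := cg_B cg; lra.
  have k3 := mulr_ge0 b0 (ltW m1); have k4 := mulr_ge0 b0 (ltW m4).
  by move: m1 m2 m3 m4 k1 k2 k3 k4; clear; split; lra.
have [a1 a2] := avg l (ltnW lN); have [a3 a4] := avg l.+1 lN.
set P := sec h (x n l) (x n l.+2) in a1 a2 *.
set Q := sec h (x n l.+1) (x n l.+3) in a3 a4 *.
have s_l := s0 l (ltnW (ltnW lN)); have s_l1 := s0 l.+1 (ltnW lN); have s_l2 := s0 l.+2 lN.
have P0 : 0 < P by apply: (grid_sec_gt0 cg hi) => //; exact: ltnW.
have Q0 : 0 < Q by apply: (grid_sec_gt0 cg hi).
have PQ : P * Q <= expR c * (s l * s l.+2).
  have D0 : 0 < s l * s l.+2 by rewrite mulr_gt0.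
  have X0 : 0 < P * Q / (s l * s l.+2) by rewrite divr_gt0// mulr_gt0.
  have : ln (P * Q / (s l * s l.+2)) <= c by exact: le_trans (ler_norm _) Hc.
  by rewrite -ler_expR lnK ?posrE// ler_pdivrMr.
have le2 (a b a' b' : R) : 0 <= a -> 0 <= b -> a <= a' -> b <= b' -> a * b <= a' * b'.
  by move=> *; exact: ler_pM.
have h1 := le2 _ _ _ _ (ltW s_l1) (ltW s_l2) a2 a4.
have h2 := le2 _ _ _ _ (ltW s_l) (ltW s_l1) a1 a3.
have h3 : ((1 + B) * P) * ((1 + B) * Q) <= expR c * (1 + B) ^+ 2 * (s l * s l.+2).
  have -> : (1 + B) * P * ((1 + B) * Q) = (1 + B) ^+ 2 * (P * Q) by ring.
  have -> : expR c * (1 + B) ^+ 2 * (s l * s l.+2) = (1 + B) ^+ 2 * (expR c * (s l * s l.+2)).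
    by ring.
  by apply: ler_wpM2l PQ; rewrite exprn_ge0 ?(ltW B0).
split.
  rewrite -(ler_pM2r s_l2); apply: le_trans h1 _; apply: le_trans h3 _.
  by rewrite mulrA.
rewrite -(ler_pM2l s_l); apply: le_trans h2 _; apply: le_trans h3 _.
by rewrite mulrCA.
Qed.

(** Each of the two cells of the node is the middle one of a triple that contains
    the other. *)
Lemma interior_node_lr c n l : (forall i, (i.+3 <= N n)%N -> `|quad_cd n i| <= c) ->
  (l.+4 <= N n)%N -> `|node_lr n l.+1| <= ln (expR c * (1 + B) ^+ 2).
Proof.
move=> Hc lN.
have B0 : 0 < 1 + B by have := cg_B cg; lra.
have C0 : 0 < expR c * (1 + B) ^+ 2 by rewrite mulr_gt0 ?expR_gt0// exprn_gt0.
have [_ h1] := middle_slope (ltnW lN) (Hc l (ltnW lN)).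
have [h2 _] := middle_slope lN (Hc l.+1 lN).
have s0 i : (i < N n)%N -> 0 < sec h (x n i) (x n i.+1).
  by move=> iN; apply: (grid_sec_gt0 cg hi).
have s1 := s0 l.+1 (ltnW (ltnW lN)); have s2 := s0 l.+2 (ltnW lN).
rewrite /node_lr /lr ln_div ?posrE// distrC; apply/logcloseW => //.
by rewrite /logclose lnK ?posrE.
Qed.

End GridConclusions.

Section GridConclusionsShift.
Context {R : realType} {B : R} {M : nat} {p q : R} {N : nat -> nat}
  {x : nat -> nat -> R} (cg : cgrid B M p q N x).
Context {h : R -> R} (hi : increasing_on p q h) (hc : cont_on p q h).

Local Notation width := (@width R x).
Local Notation node_lr := (@node_lr R x h).
Local Notation quad_cd := (@quad_cd R x h).

Lemma C1_of_node_lr (K a : R) n0 : 0 < a ->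
  (forall n i, (n0 <= n)%N -> (i.+2 <= N n)%N -> `|node_lr n i| <= K * width n i `^ a) ->
  exists f C m, C1_data p q h a f C m.
Proof.
move=> a0 Hr; apply: (C1_of_node_lr_all (cgrid_shift cg n0) hi hc a0 (K := K)).
by move=> n i iN; apply: Hr => //; exact: leq_addl.
Qed.

Lemma C2_of_quad_cd (c a : R) : 0 < a <= 1 ->
  (forall n l, (l.+3 <= N n)%N -> `|quad_cd n l| <= c * width n l `^ (1 + a)) ->
  exists f C m, C1_data p q h 1 f C m /\ exists2 g, has_derivs p q f g & holder_itv a p q g.
Proof.
move=> a01 Hc; have /andP[a0 a1] := a01.
have [K [n0 Hr]] := node_lr_lipschitz cg hi a0 Hc.
have [K' [n1 Hu]] := node_curvature_holder cg hi a01 Hc Hr.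
have Hr1 n i : (n0 <= n)%N -> (i.+2 <= N n)%N -> `|node_lr n i| <= K * width n i `^ 1.
  by move=> nn iN; rewrite powRr1 ?(ltW (width_gt0 cg iN))//; exact: Hr.
have [f [C [m D]]] := C1_of_node_lr ltr01 Hr1.
exists f, C, m; split=> //.
have [[C0 m0] hf fs ff [fm hm]] := D.
have cg' := cgrid_shift cg (n0 + n1).
have sh : secant_holder a p q f.
  apply: (secant_holder_of_curvature cg' hi (K := K) (K' := K') (C := C) (m := m)) => //.
  - by move=> n i iN; apply: Hr => //; lia.
  - by move=> n i j ch; apply: (Hu (n + (n0 + n1))%N) => //; lia.
  - by move=> s t ps st tq s1 t1 u ss1 st1 tt1 su; have := fs s t ps st tq s1 t1 u ss1 st1 tt1 su;
      rewrite powRr1// subr_ge0 ltW.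
  - by move=> u v uI vI; have := ff u v uI vI; rewrite powRr1.
have [C' [g [C'0 fg _ gg]]] := secant_holder_deriv a0 (pq_lt cg) sh.
by exists g => //; exists C'.
Qed.

End GridConclusionsShift.

(** * Three-point conditions *)

Section ThreePointConditions.
Context {R : realType} {p q : R} {h : R -> R} (hi : increasing_on p q h).

Lemma ratioP (d d1 d2 : R) : 1 <= d -> 0 < d1 -> 0 < d2 ->
  (d^-1 <= d2 / d1 <= d) = (d1 <= d * d2) && (d2 <= d * d1).
Proof.
move=> d1' d10 d20; have d0 : 0 < d by lra.
by rewrite ler_pdivlMr// ler_pdivrMr// ler_pdivrMl.
Qed.

Lemma ratio_ltP (d d1 d2 : R) : 1 <= d -> 0 < d1 -> 0 < d2 ->
  (d^-1 < d2 / d1 < d) = (d1 < d * d2) && (d2 < d * d1).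
Proof.
move=> d1' d10 d20; have d0 : 0 < d by lra.
by rewrite ltr_pdivlMr// ltr_pdivrMr// ltr_pdivrMl.
Qed.

Lemma three_point_lr x d1 d2 : p <= x - d1 -> 0 < d1 -> 0 < d2 -> x + d2 <= q ->
  three_point_log h x d1 d2 = lr h (x - d1) x (x + d2).
Proof.
move=> px d10 d20 xq.
have h0 : 0 < h x - h (x - d1) by rewrite subr_gt0; apply: hi => //; lra.
rewrite /three_point_log /lr /sec; congr ln.
have -> : x + d2 - x = d2 by ring.
have -> : x - (x - d1) = d1 by ring.
by field; rewrite !gt_eqF.
Qed.

Definition bounded_lr p' q' := forall d, 1 <= d -> exists2 K, 0 <= K &
  forall s u t, p' <= s -> s < u -> u < t -> t <= q' ->
    u - s <= d * (t - u) -> t - u <= d * (u - s) -> `|lr h s u t| <= K.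

Definition vanishing_lr p' q' := forall d, 1 <= d -> exists2 e, modulus e &
  forall s u t, p' <= s -> s < u -> u < t -> t <= q' ->
    u - s < d * (t - u) -> t - u < d * (u - s) -> `|lr h s u t| <= e (t - s).

Lemma quasisymmetricP p' q' : p <= p' -> q' <= q ->
  quasisymmetric `[p', q']%classic h <-> bounded_lr p' q'.
Proof.
move=> pp qq; split=> H d d1.
  have [k k1 Hk] := H d d1; exists (ln k); first by rewrite ln_ge0.
  move=> s u t ps su ut tq h1 h2.
  have := Hk u (u - s) (t - u); rewrite three_point_lr ?subr_gt0//; try lra.
  rewrite subKr subrKC; apply; rewrite ?subr_gt0 ?ratioP ?subr_gt0 ?h1//;
    by apply/itvccP; apply/andP; split; lra.
have [K K0 HK] := H d d1; exists (expR K); first by have := expR_ge1Dx K; lra.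
move=> x d1' d2' /itvccP/andP[x1 _] _ /itvccP/andP[_ x2] d10 d20.
rewrite ratioP// => /andP[h1 h2]; rewrite expRK three_point_lr//; try lra.
by apply: HK => //; lra.
Qed.

Lemma uaaP p' q' : p <= p' -> q' <= q ->
  uaa `[p', q']%classic h <-> vanishing_lr p' q'.
Proof.
move=> pp qq; split=> H d d1.
  have [e em He] := H d d1; exists e => //.
  move=> s u t ps su ut tq h1 h2.
  have := He u (u - s) (t - u); rewrite three_point_lr ?subr_gt0//; try lra.
  rewrite subKr subrKC [u - s + _]addrC subrKA.
  apply; rewrite ?subr_gt0 ?ratio_ltP ?subr_gt0 ?h1//;
    by apply/itvccP; apply/andP; split; lra.
have [e em He] := H d d1; exists e => //.
move=> x d1' d2' /itvccP/andP[x1 _] _ /itvccP/andP[_ x2] d10 d20.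
rewrite ratio_ltP// => /andP[h1 h2]; rewrite three_point_lr//; try lra.
have -> : d1' + d2' = x + d2' - (x - d1') by ring.
by apply: He => //; lra.
Qed.

(** A quantity that is bounded and tends to 0 with the scale is dominated by a
    modulus of continuity ([modulus_above]). *)
Lemma vanishing_lrP : p < q -> bounded_lr p q ->
  (forall d, 1 <= d -> forall e, 0 < e -> exists2 del, 0 < del & forall s u t,
    p <= s -> s < u -> u < t -> t <= q -> t - s < del ->
    u - s <= d * (t - u) -> t - u <= d * (u - s) -> `|lr h s u t| <= e) ->
  vanishing_lr p q.
Proof.
move=> pq Hb Hs d d1; have [K K0 HK] := Hb d d1.
pose P t v := exists s u w, [/\ p <= s /\ s < u, u < w /\ w <= q,
  u - s < d * (w - u) /\ w - u < d * (u - s) & t = w - s /\ v = `|lr h s u w|].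
have [||e em He] := @modulus_above R P K.
- move=> t v [s [u [w [[ps su] [uw wq] [h1 h2] [-> ->]]]]]; split; first by lra.
  by apply: HK => //; exact: ltW.
- move=> b b0; have [del del0 Hd] := Hs d d1 b b0; exists del => //.
  move=> t v [s [u [w [[ps su] [uw wq] [h1 h2] [-> ->]]]]] tdel.
  by apply: Hd => //; exact: ltW.
exists e => // s u t ps su ut tq h1 h2.
by apply: He; exists s, u, t.
Qed.

End ThreePointConditions.

Lemma interior_subitv {R : realType} (p q : R) (K : set R) : closed_itv K ->
  K `<=` `[p, q]%classic^° -> exists u v, [/\ u < v, K = `[u, v]%classic, p < u & v < q].
Proof.
move=> [u [v [uv ->]]] KI; exists u, v.
have inU : `[u, v]%classic u by apply/itvccP; rewrite lexx ltW.
have inV : `[u, v]%classic v by apply/itvccP; rewrite lexx ltW.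
have := KI u inU; have := KI v inV; rewrite interior_itv_bnd /= !in_itv/=.
by move=> /andP[_ vq] /andP[pu _].
Qed.

Lemma le_O_ext {R : realType} (D : nat -> nat -> Prop) (phi psi psi' : nat -> nat -> R) :
  (forall n b, D n b -> psi n b = psi' n b) -> le_O D phi psi -> le_O D phi psi'.
Proof. by move=> E [c H]; exists c => n b Db; rewrite -E//; exact: H. Qed.

(** The scales [w1] and [w2] of the data need only be comparable to [psi]: the
    factor [C] is absorbed by passing to another modulus of continuity. *)
Lemma le_o_div_of_modulus {R : realType} (D : nat -> nat -> Prop)
    (phi psi : nat -> nat -> R) (e : R -> R) (C W : R) :
  modulus e -> 0 < C ->
  (forall n b, D n b -> exists w1 w2, [/\ 0 <= w1 <= W, 0 <= w2 <= W,
    w1 <= C * `|psi n b|, w2 <= C * `|psi n b| & `|phi n b| <= e w1 + e w2]) ->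
  le_o_div D phi psi.
Proof.
move=> em C0 H; have [K K0 HK] := modulus_bounded W em.
pose P t v := exists n b, [/\ D n b, t = `|psi n b| & v = `|phi n b|].
have [||e' e'm He'] := @modulus_above R P (K + K).
- move=> _ _ [n [b [Db -> ->]]]; split=> //.
  have [w1 [w2 [/andP[w10 w1W] /andP[w20 w2W] _ _ h]]] := H n b Db.
  by apply: (le_trans h); apply: lerD; exact: HK.
- move=> c c0; have [d d0 Hd] := modulus_small em (b := c / 2) ltac:(lra).
  exists (d / C); first exact: divr_gt0.
  move=> _ _ [n [b [Db -> ->]]]; rewrite ltr_pdivlMr// mulrC => td.
  have [w1 [w2 [/andP[w10 w1W] /andP[w20 w2W] k1 k2 h]]] := H n b Db.
  apply: (le_trans h); rewrite [leRHS]splitr; apply: lerD; apply: Hd => //.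
    exact: le_lt_trans k1 td.
  exact: le_lt_trans k2 td.
by exists e' => // n b Db; apply: He'; exists n, b.
Qed.

(** * Increasing maps on a grid *)

Section IncreasingDirect.
Context {R : realType} {B M p q : R} {Omega : nat -> nat} {G : nat -> nat -> set R}.
Context (pq : p < q) (B1 : 1 <= B) (bm : BM_grid B M `[p, q]%classic Omega G).
Context {y : nat -> nat -> R} {ori : nat -> bool}.
Context (gp : forall n, (1 <= n)%N ->
  @level_points_of R p q Omega G n (y n) (ori n)).
Context {h : R -> R} (hi : increasing_on p q h).

Local Notation lrd_ := (grid_lrd h G).
Local Notation crd_ := (grid_crd h G).

Lemma node_points n i : (1 <= n)%N -> (i.+2 <= Omega n)%N ->
  [/\ p <= y n i, y n i < y n i.+1, y n i.+1 < y n i.+2, y n i.+2 <= q &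
    y n i.+1 - y n i <= B * (y n i.+2 - y n i.+1) /\
    y n i.+2 - y n i.+1 <= B * (y n i.+1 - y n i)].
Proof.
move=> n1 iN; have [r1 r2] := y_ratio B1 bm gp n1 iN.
have /andP[y0 _] := y_in gp n1 (ltnW (ltnW iN)); have /andP[_ y2] := y_in gp n1 iN.
by split=> //; apply: (y_inc gp) => //; exact: ltnW.
Qed.

Lemma grid_len_gt0 n b : pairs Omega n b -> 0 < grid_len G n b.
Proof. by move=> /(pair_node B1 bm gp hi)[i []]. Qed.

Lemma pairs_of_triples n b : triples Omega n b -> pairs Omega n b.
Proof. by move=> [n1 [b1 bN]]; split=> //; rewrite b1 ltnW. Qed.

Lemma pairs_le_O K a : 0 <= K -> 0 <= a ->
  (forall s u t, p <= s -> s < u -> u < t -> t <= q ->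
    u - s <= B * (t - u) -> t - u <= B * (u - s) -> `|lr h s u t| <= K * (t - s) `^ a) ->
  le_O (pairs Omega) lrd_ (fun n b => grid_len G n b `^ a).
Proof.
move=> K0 a0 H; exists (K * (1 + B) `^ a) => n b Db.
have [i [iN -> l0 /andP[_ w]]] := pair_node B1 bm gp hi Db.
have [h1 h2 h3 h4 [h5 h6]] := node_points Db.1 iN.
apply: le_trans (H _ _ _ h1 h2 h3 h4 h5 h6) _.
rewrite ger0_norm ?powR_ge0// -mulrA -powRM ?(ltW l0)//; last by have := B1; lra.
apply: ler_wpM2l => //; apply: (ge0_ler_powR a0) => //; rewrite nnegrE; lra.
Qed.

Lemma triples_le_O K a : 0 <= K -> 0 <= a ->
  (forall s u v t, p <= s -> s < u -> u < v -> v < t -> t <= q ->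
    u - s <= B * (v - u) -> v - u <= B * (u - s) ->
    v - u <= B * (t - v) -> t - v <= B * (v - u) -> `|cd h s u v t| <= K * (t - s) `^ a) ->
  le_O (triples Omega) crd_ (fun n b => grid_len G n b `^ a).
Proof.
move=> K0 a0 H; exists (K * (1 + B + B ^+ 2) `^ a) => n b Db.
have [i iN [-> l0 _ w]] := triple_quad B1 bm gp hi Db.
have [h1 h2 h3 h4 [h5 h6]] := node_points Db.1 (ltnW iN).
have [g1 g2 g3 g4 [g5 g6]] := node_points Db.1 iN.
apply: le_trans (H _ _ _ _ h1 h2 h3 g3 g4 h5 h6 g5 g6) _.
have BB : 0 <= B ^+ 2 by exact: sqr_ge0.
rewrite ger0_norm ?powR_ge0// -mulrA -powRM ?(ltW l0)//; last by have := B1; lra.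
apply: ler_wpM2l => //; apply: (ge0_ler_powR a0) => //; rewrite nnegrE; lra.
Qed.

Lemma triples_le_O_lr K a : 0 <= K -> 0 <= a ->
  (forall s u t, p <= s -> s < u -> u < t -> t <= q ->
    u - s <= B * (t - u) -> t - u <= B * (u - s) -> `|lr h s u t| <= K * (t - s) `^ a) ->
  le_O (triples Omega) crd_ (fun n b => grid_len G n b `^ a).
Proof.
move=> K0 a0 H; apply: (triples_le_O (K := K + K)) => //; first by rewrite addr_ge0.
move=> s u v t ps su uv vt tq h1 h2 h3 h4.
apply: le_trans (cd_le_lr hi ps su uv vt tq) _; rewrite mulrDl.
have mono w : 0 <= w -> w <= t - s -> K * w `^ a <= K * (t - s) `^ a.
  move=> w0 ws; apply: ler_wpM2l => //; apply: (ge0_ler_powR a0) => //.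
  by rewrite nnegrE; lra.
apply: lerD.
  by apply: le_trans (H s u v ps su uv _ h1 h2) (mono _ _ _); lra.
by apply: le_trans (H u v t _ uv vt tq h3 h4) (mono _ _ _); lra.
Qed.

Lemma quasisymmetric_bound : quasisymmetric `[p, q]%classic h ->
  le_O (pairs Omega) lrd_ (fun _ _ => 1) /\ le_O (triples Omega) crd_ (fun _ _ => 1).
Proof.
move=> /(quasisymmetricP hi (lexx _) (lexx _))/(_ B B1)[K K0 H].
have H0 s u t : p <= s -> s < u -> u < t -> t <= q ->
    u - s <= B * (t - u) -> t - u <= B * (u - s) -> `|lr h s u t| <= K * (t - s) `^ 0.
  by move=> *; rewrite powRr0 mulr1; exact: H.
split.
  by apply: le_O_ext (pairs_le_O K0 (lexx 0) H0) => n b _; rewrite powRr0.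
by apply: le_O_ext (triples_le_O_lr K0 (lexx 0) H0) => n b _; rewrite powRr0.
Qed.

(** The definition of (uaa) has strict inequalities, whence the ratio [B + 1]. *)
Lemma uaa_bound : uaa `[p, q]%classic h ->
  le_o_div (pairs Omega) lrd_ (grid_len G) /\ le_o_div (triples Omega) crd_ (grid_len G).
Proof.
have B2 : 1 <= B + 1 by have := B1; lra.
move=> /(uaaP hi (lexx _) (lexx _))/(_ (B + 1) B2)[e em H].
have strict a b : 0 < b -> a <= B * b -> a < (B + 1) * b by move=> *; rewrite mulrDl mul1r; lra.
have C0 : 0 < 1 + B + B ^+ 2 by have := B1; have := sqr_ge0 B; lra.
have Hn n i : (1 <= n)%N -> (i.+2 <= Omega n)%N ->
    `|lr h (y n i) (y n i.+1) (y n i.+2)| <= e (y n i.+2 - y n i).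
  move=> n1 iN; have [h1 h2 h3 h4 [h5 h6]] := node_points n1 iN.
  by apply: H => //; apply: strict => //; lra.
split; apply: (le_o_div_of_modulus (W := q - p) em C0).
- move=> n b Db; have [i [iN -> l0 /andP[_ w]]] := pair_node B1 bm gp hi Db.
  have [h1 h2 h3 h4 _] := node_points Db.1 iN.
  exists (y n i.+2 - y n i), (y n i.+2 - y n i); rewrite gtr0_norm//.
  have s2 : 0 <= B ^+ 2 * grid_len G n b by rewrite mulr_ge0 ?sqr_ge0// ltW.
  split; try (by apply/andP; split; lra); try (by rewrite mulrDl; lra).
  have [_ ege0 _] := em.
  by apply: le_trans (Hn n i Db.1 iN) _; rewrite lerDl ege0//; lra.
- move=> n b Db; have [i iN [-> l0 _ w]] := triple_quad B1 bm gp hi Db.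
  have [h1 h2 h3 h4 _] := node_points Db.1 (ltnW iN).
  have [g1 g2 g3 g4 _] := node_points Db.1 iN.
  exists (y n i.+2 - y n i), (y n i.+3 - y n i.+1); rewrite gtr0_norm//.
  split; try (by apply/andP; split; lra); try by lra.
  apply: le_trans (cd_le_lr hi h1 h2 h3 g3 g4) _; apply: lerD; apply: Hn => //.
  - exact: Db.1.
  - exact: ltnW.
  - exact: Db.1.
Qed.

Lemma C1_bound a : 0 < a -> C1_holder a `[p, q]%classic h ->
  derive_neq0 `[p, q]%classic h ->
  le_O (pairs Omega) lrd_ (fun n b => grid_len G n b `^ a) /\
  le_O (triples Omega) crd_ (fun n b => grid_len G n b `^ a).
Proof.
move=> a0 /(C1_holderP a h pq)[f hf [C C0 ff]] /(derive_neq0P pq hf) fn0.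
have [K K0 H] := lr_of_holder pq hi a0 C0 hf ff fn0.
split; [apply: pairs_le_O K0 (ltW a0) _|apply: triples_le_O_lr K0 (ltW a0) _];
  by move=> *; exact: H.
Qed.

Lemma C2_bound a : 0 < a <= 1 -> C2_holder a `[p, q]%classic h ->
  derive_neq0 `[p, q]%classic h ->
  le_O (triples Omega) crd_ (fun n b => grid_len G n b `^ (1 + a)).
Proof.
move=> a01 /(C2_holderP a h pq)[f [g [hf fg [C C0 gg]]]] /(derive_neq0P pq hf) fn0.
have [K K0 H] := cd_of_C2 pq hi a01 C0 hf fg gg fn0.
have /andP[a0 _] := a01.
apply: triples_le_O K0 _ _; first by lra.
by move=> *; exact: H.
Qed.

Lemma affine_bound : affine_on `[p, q]%classic h ->
  le_o (pairs Omega) lrd_ (grid_len G).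
Proof.
move=> [P [Q H]]; exists (fun=> 0); first exact: modulus0.
move=> n b Db; have [i [iN -> l0 _]] := pair_node B1 bm gp hi Db.
have [h1 h2 h3 h4 _] := node_points Db.1 iN.
have sE s t : p <= s -> s < t -> t <= q -> sec h s t = P.
  move=> ps st tq; rewrite /sec !H; try (by apply/itvccP; apply/andP; split; lra).
  by field; rewrite subr_eq0 gt_eqF.
have P0 : 0 < P by rewrite -(sE p q)//; exact: sec_gt0 hi _ _ _.
rewrite /lr !sE//; try lra.
by rewrite divff ?gt_eqF// ln1 normr0 mul0r.
Qed.

End IncreasingDirect.

Section IncreasingConverse.
Context {R : realType} {B M p q : R} {Omega : nat -> nat} {G : nat -> nat -> set R}.
Context (pq : p < q) (B1 : 1 <= B) (bm : BM_grid B M `[p, q]%classic Omega G).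
Context {y : nat -> nat -> R} {ori : nat -> bool}.
Context (gp : forall n, (1 <= n)%N ->
  @level_points_of R p q Omega G n (y n) (ori n)).
Context {h : R -> R} (hi : increasing_on p q h) (hc : cont_on p q h).

Local Notation lrd_ := (grid_lrd h G).
Local Notation crd_ := (grid_crd h G).

(* The first level is skipped, as it may consist of a single interval. *)
Let N n := Omega n.+2.
Let x n := y n.+2.
Local Notation node_lr := (@node_lr R x h).
Local Notation quad_cd := (@quad_cd R x h).
Local Notation width := (@width R x).

Context {M' : nat} (cg : cgrid B M' p q N x).

Lemma node_of_pairs a : 0 <= a ->
  le_O (pairs Omega) lrd_ (fun n b => grid_len G n b `^ a) ->
  exists K, forall n i, (i.+2 <= N n)%N -> `|node_lr n i| <= K * width n i `^ a.
Proof.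
move=> a0 [c Hc]; exists `|c| => n i iN.
have [b [Db E l0 /andP[w _]]] := node_pair B1 bm gp hi (ltn0Sn n.+1) iN.
have := Hc n.+2 b Db; rewrite E => /le_trans; apply.
rewrite ger0_norm ?powR_ge0//; apply: (@le_trans _ _ (`|c| * grid_len G n.+2 b `^ a)).
  by rewrite ler_wpM2r ?powR_ge0// ler_norm.
apply: ler_wpM2l => //; apply: (ge0_ler_powR a0) => //; rewrite nnegrE; first exact: ltW.
exact: le_trans (ltW l0) w.
Qed.

Lemma quad_of_triples a : 0 <= a ->
  le_O (triples Omega) crd_ (fun n b => grid_len G n b `^ a) ->
  exists c, forall n l, (l.+3 <= N n)%N -> `|quad_cd n l| <= c * width n l `^ a.
Proof.
move=> a0 [c Hc]; exists (`|c| * (1 + B) `^ a) => n i iN.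
have [b Db [E l0 w _]] := quad_triple B1 bm gp hi (ltn0Sn n.+1) iN.
have w0 : 0 < width n i := width_gt0 cg (ltnW iN).
have := Hc n.+2 b Db; rewrite E => /le_trans; apply.
rewrite ger0_norm ?powR_ge0//; apply: (@le_trans _ _ (`|c| * grid_len G n.+2 b `^ a)).
  by rewrite ler_wpM2r ?powR_ge0// ler_norm.
rewrite -mulrA -powRM ?(ltW w0)//; last by have := B1; lra.
apply: ler_wpM2l => //; apply: (ge0_ler_powR a0) => //; rewrite nnegrE; first exact: ltW.
exact: le_trans (ltW l0) w.
Qed.

Lemma width_small e : 0 < e -> exists n0, forall n i, (n0 <= n)%N -> (i.+2 <= N n)%N ->
  width n i < e.
Proof.
move=> e0; have [n0 H] := width_pow_small cg ltr01 (e := e / 2) ltac:(lra).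
exists n0 => n i nn iN; have := H n i nn iN.
by rewrite powRr1 ?(ltW (width_gt0 cg iN))//; lra.
Qed.

Lemma node_small_of_pairs : le_o_div (pairs Omega) lrd_ (grid_len G) ->
  forall eta, 0 < eta -> exists n0, forall n i, (n0 <= n)%N -> (i.+2 <= N n)%N ->
    `|node_lr n i| <= eta.
Proof.
move=> [e em He] eta eta0; have [d d0 Hd] := modulus_small em eta0.
have [n0 Hn] := width_small d0; exists n0 => n i nn iN.
have [b [Db E l0 /andP[w _]]] := node_pair B1 bm gp hi (ltn0Sn n.+1) iN.
have := He n.+2 b Db; rewrite E => /le_trans; apply.
rewrite gtr0_norm//; apply: Hd; first exact: ltW.
exact: le_lt_trans w (Hn n i nn iN).
Qed.

Lemma quad_small_of_triples : le_o_div (triples Omega) crd_ (grid_len G) ->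
  forall eta, 0 < eta -> exists n0, forall n l, (n0 <= n)%N -> (l.+3 <= N n)%N ->
    `|quad_cd n l| <= eta.
Proof.
move=> [e em He] eta eta0; have [d d0 Hd] := modulus_small em eta0.
have B0 : 0 < 1 + B by have := B1; lra.
have [n0 Hn] := width_small (divr_gt0 d0 B0); exists n0 => n i nn iN.
have [b Db [E l0 w _]] := quad_triple B1 bm gp hi (ltn0Sn n.+1) iN.
have := He n.+2 b Db; rewrite E => /le_trans; apply.
rewrite gtr0_norm//; apply: Hd; first exact: ltW.
apply: (le_lt_trans w); rewrite mulrC -ltr_pdivlMr//.
exact: Hn n i nn (ltnW iN).
Qed.

Lemma quasisymmetric_of_pairs : le_O (pairs Omega) lrd_ (fun _ _ => 1) ->
  quasisymmetric `[p, q]%classic h.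
Proof.
move=> H; apply/(quasisymmetricP hi (lexx _) (lexx _)) => d d1.
have [K HK] : exists K, forall n i, (i.+2 <= N n)%N -> `|node_lr n i| <= K * width n i `^ 0.
  by apply: node_of_pairs => //; apply: le_O_ext H => n b _; rewrite powRr0.
apply: (three_point_bounded cg hi (n0 := 0%N) (rho := K)) => // n l _ lN _.
by have := HK n l lN; rewrite powRr0 mulr1.
Qed.

Lemma uaa_of_node_lr :
  (forall eta, 0 < eta -> exists n0, forall n i, (n0 <= n)%N -> (i.+2 <= N n)%N ->
    `|node_lr n i| <= eta) -> uaa `[p, q]%classic h.
Proof.
move=> H; apply/(uaaP hi (lexx _) (lexx _)); apply: vanishing_lrP => //.
  move=> d d1; have [n0 Hn] := H 1 ltr01.
  apply: (three_point_bounded cg hi (n0 := n0) (rho := 1)) => // n l nn lN _.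
  exact: Hn.
by move=> d d1; exact: (three_point_small cg hi d1 H).
Qed.

Lemma C1_of_data a f C m : C1_data p q h a f C m ->
  C1_holder a `[p, q]%classic h /\ derive_neq0 `[p, q]%classic h.
Proof.
move=> [[C0 m0] hf _ ff [fm _]]; split.
  by apply/(C1_holderP a h pq); exists f => //; exists C.
apply/(derive_neq0P pq hf) => u uI; apply/eqP; rewrite gt_eqF//.
exact: lt_le_trans m0 (fm u uI).
Qed.

Lemma C1_of_pairs a : 0 < a ->
  le_O (pairs Omega) lrd_ (fun n b => grid_len G n b `^ a) ->
  C1_holder a `[p, q]%classic h /\ derive_neq0 `[p, q]%classic h.
Proof.
move=> a0 H; have [K HK] := node_of_pairs (ltW a0) H.
have [f [C [m D]]] := C1_of_node_lr cg hi hc a0 (n0 := 0%N) (fun n i _ => HK n i).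
exact: C1_of_data D.
Qed.

Lemma affine_of_pairs : le_o (pairs Omega) lrd_ (grid_len G) ->
  affine_on `[p, q]%classic h /\ derive_neq0 `[p, q]%classic h.
Proof.
move=> [e em He].
have E : forall u, p <= u <= q -> h u = h p + sec h p q * (u - p).
  apply: (affine_of_lr cg hi hc) => eta eta0.
  have [d d0 Hd] := modulus_small em eta0.
  have [n0 Hn] := width_small d0; exists n0 => n i nn iN.
  have [b [Db E l0 /andP[w _]]] := node_pair B1 bm gp hi (ltn0Sn n.+1) iN.
  have := He n.+2 b Db; rewrite E => /le_trans; apply; rewrite gtr0_norm//.
  apply: ler_pM => //; [by have [_ + _] := em; apply; exact: ltW|exact: ltW|].
  by apply: Hd; [exact: ltW|exact: le_lt_trans w (Hn n i nn iN)].
split.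
  exists (sec h p q), (h p - sec h p q * p) => u /itvccP uI.
  by rewrite E//; ring.
have hf : has_derivs p q h (fun=> sec h p q).
  move=> u uI eta eta0; exists 1 => // v vI vu _.
  rewrite {1}/sec (E u uI) (E v vI) [X in `|X|](_ : _ = 0) ?normr0 ?(ltW eta0)//.
  by field; rewrite subr_eq0.
apply/(derive_neq0P pq hf) => u _; apply/eqP; rewrite gt_eqF//.
exact: sec_gt0 hi _ _ _.
Qed.

Lemma quasisymmetric_of_triples : le_O (triples Omega) crd_ (fun _ _ => 1) ->
  forall p' q', p < p' -> q' < q -> quasisymmetric `[p', q']%classic h.
Proof.
move=> H p' q' pp qq.
apply/(quasisymmetricP hi (ltW pp) (ltW qq)) => d d1.
have [c Hc] : exists c, forall n l, (l.+3 <= N n)%N -> `|quad_cd n l| <= c * width n l `^ 0.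
  by apply: quad_of_triples => //; apply: le_O_ext H => n b _; rewrite powRr0.
have s0 : 0 < Num.min (p' - p) (q - q') by rewrite lt_min !subr_gt0 pp.
have [n0 Hn] := width_small s0.
apply: (three_point_bounded cg hi (n0 := n0) (rho := ln (expR c * (1 + B) ^+ 2)) (ltW pp) (ltW qq)) => //.
move=> n l nn lN /andP[l1 l2].
have := Hn n l nn lN; rewrite lt_min /width => /andP[w1 w2].
have x1 : x n l < x n l.+1 by apply: (cg_inc cg) => //; exact: ltnW.
have x2 : x n l.+1 < x n l.+2 by apply: (cg_inc cg).
have l0 : (0 < l)%N.
  by case: l lN l1 l2 w1 w2 x1 x2 => // lN l1 l2 w1 w2 x1 x2; move: w1; rewrite (cg_p cg); lra.
have lN' : (l.+3 <= N n)%N.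
  move: lN; rewrite leq_eqVlt => /predU1P[E|//].
  by move: w2; rewrite E (cg_q cg); lra.
case: l l0 lN' {lN l1 l2 w1 w2 x1 x2} => // l _ lN.
by apply: (interior_node_lr cg hi) => // i iN; have := Hc n i iN; rewrite powRr0 mulr1.
Qed.

Lemma uaa_of_triples : le_o_div (triples Omega) crd_ (grid_len G) ->
  uaa `[p, q]%classic h.
Proof.
move=> H; apply: uaa_of_node_lr; apply: (node_lr_small cg hi).
exact: quad_small_of_triples.
Qed.

Lemma C1_of_triples a : 0 < a < 1 ->
  le_O (triples Omega) crd_ (fun n b => grid_len G n b `^ a) ->
  C1_holder a `[p, q]%classic h /\ derive_neq0 `[p, q]%classic h.
Proof.
move=> a01 H; have /andP[a0 _] := a01.
have [c Hc] := quad_of_triples (ltW a0) H.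
have [K [n0 HK]] := node_lr_holder cg hi a01 Hc.
have [f [C [m D]]] := C1_of_node_lr cg hi hc a0 HK.
exact: C1_of_data D.
Qed.

(** The exponent is first lowered below 1, the range in which the ratio distortion
    inherits it. *)
Lemma derive_neq0_of_triples a : 0 < a ->
  le_O (triples Omega) crd_ (fun n b => grid_len G n b `^ a) ->
  derive_neq0 `[p, q]%classic h.
Proof.
move=> a0 H; have [c Hc] := quad_of_triples (ltW a0) H.
pose g := Num.min a 2^-1.
have g01 : 0 < g < 1.
  rewrite lt_min a0 invr_gt0 ltr0n/= gt_min; apply/orP; right.
  by rewrite invf_lt1// ltr1n.
have ga : g <= a by rewrite ge_min lexx.
have /andP[g0 _] := g01.
have Hc' n l : (l.+3 <= N n)%N ->
    `|quad_cd n l| <= `|c| * (q - p) `^ (a - g) * width n l `^ g.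
  move=> lN; have w0 := width_gt0 cg (ltnW lN).
  apply: le_trans (Hc n l lN) _.
  have -> : width n l `^ a = width n l `^ (a - g) * width n l `^ g.
    by rewrite -powRD ?subrK// (gt_eqF w0) implybT.
  rewrite mulrA; apply: ler_wpM2r; first exact: powR_ge0.
  apply: (@le_trans _ _ (`|c| * width n l `^ (a - g))).
    by apply: ler_wpM2r; [exact: powR_ge0|exact: ler_norm].
  have ag : 0 <= a - g by rewrite subr_ge0.
  apply: ler_wpM2l => //; apply: (ge0_ler_powR ag); rewrite ?nnegrE ?(ltW w0) ?subr_ge0 ?(ltW pq)//.
  have lN2 := ltnW lN.
  have := grid_ge cg (ltnW (ltnW lN2)); have := grid_le cg lN2.
  by rewrite /width; lra.
have [K [n0 HK]] := node_lr_holder cg hi g01 Hc'.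
have [f [C [m D]]] := C1_of_node_lr cg hi hc g0 HK.
by have [] := C1_of_data D.
Qed.

Lemma C2_of_triples a : 0 < a <= 1 ->
  le_O (triples Omega) crd_ (fun n b => grid_len G n b `^ (1 + a)) ->
  C2_holder a `[p, q]%classic h /\ derive_neq0 `[p, q]%classic h.
Proof.
move=> a01 H; have /andP[a0 _] := a01.
have [c Hc] := quad_of_triples (a := 1 + a) ltac:(lra) H.
have [f [C [m [D [g fg gg]]]]] := C2_of_quad_cd cg hi hc a01 Hc.
have [_ nz] := C1_of_data D; split=> //; apply/(C2_holderP a h pq); exists f, g.
by have [_ hf _ _ _] := D.
Qed.

End IncreasingConverse.

(** * Restriction and reflection *)

Section Restriction.
Context {R : realType}.
Implicit Types (p q a : R) (h : R -> R).

Lemma uaa_sub (A A' : set R) h : A' `<=` A -> uaa A h -> uaa A' h.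
Proof.
move=> sub H d d1; have [e em He] := H d d1; exists e => // x d1' d2' x1 x2 x3.
by apply: He; exact: sub.
Qed.

Lemma C1_holder_sub a p q p' q' h : p < q -> p' < q' -> p <= p' -> q' <= q ->
  C1_holder a `[p, q]%classic h -> C1_holder a `[p', q']%classic h.
Proof.
move=> pq pq' pp qq /(C1_holderP a h pq)[f hf ff]; apply/(C1_holderP a h pq').
by exists f; [exact: has_derivs_sub hf|exact: holder_sub ff].
Qed.

Lemma C2_holder_sub a p q p' q' h : p < q -> p' < q' -> p <= p' -> q' <= q ->
  C2_holder a `[p, q]%classic h -> C2_holder a `[p', q']%classic h.
Proof.
move=> pq pq' pp qq /(C2_holderP a h pq)[f [g [hf fg gg]]]; apply/(C2_holderP a h pq').
by exists f, g; split; [exact: has_derivs_sub hf|exact: has_derivs_sub fg|exact: holder_sub gg].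
Qed.

End Restriction.

Section Reflection.
Context {R : realType}.
Implicit Types (A S : set R) (g h : R -> R) (a : R).

Local Notation opp h := (fun x => - h x).

Lemma opp_eq (P : (R -> R) -> Prop) : (forall g, P g -> P (opp g)) ->
  forall h, P (opp h) = P h.
Proof.
move=> H h; apply/propext; split=> [/H|]; last exact: H.
by congr (P _); apply/funext => x; rewrite opprK.
Qed.

(** The infimum is defined as minus the supremum of the opposite set. *)
Lemma len_opp h S : len (opp h @` S) = len (h @` S).
Proof.
have E : opp h @` S = -%R @` (h @` S) by rewrite image_comp.
have E2 : -%R @` (-%R @` (h @` S)) = h @` S.
  by rewrite image_comp (_ : _ \o _ = id) ?image_id//; apply/funext => x /=; rewrite opprK.
by rewrite /len /inf E E2 !opprK addrC.
Qed.

Lemma grid_lrd_opp h G : grid_lrd (opp h) G = grid_lrd h G.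
Proof. by apply/funext => n; apply/funext => b; rewrite /grid_lrd /lrd !len_opp. Qed.

Lemma grid_crd_opp h G : grid_crd (opp h) G = grid_crd h G.
Proof. by apply/funext => n; apply/funext => b; rewrite /grid_crd /crd /cr !len_opp. Qed.

Lemma three_point_log_opp h : three_point_log (opp h) = three_point_log h.
Proof.
apply/funext => x; apply/funext => d1; apply/funext => d2.
by rewrite /three_point_log -!opprD invrN mulrNN.
Qed.

Lemma quasisymmetric_opp A h : quasisymmetric A (opp h) = quasisymmetric A h.
Proof. by rewrite /quasisymmetric three_point_log_opp. Qed.

Lemma uaa_opp A h : uaa A (opp h) = uaa A h.
Proof. by rewrite /uaa three_point_log_opp. Qed.

Lemma C1_holder_opp a A h : closed_itv A -> C1_holder a A h -> C1_holder a A (opp h).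
Proof.
move=> [p [q [pq ->]]] /(C1_holderP a h pq)[f hf ff]; apply/(C1_holderP _ _ pq).
by exists (opp f); [exact: has_derivsN|exact: holderN].
Qed.

Lemma C2_holder_opp a A h : closed_itv A -> C2_holder a A h -> C2_holder a A (opp h).
Proof.
move=> [p [q [pq ->]]] /(C2_holderP a h pq)[f [g [hf fg gg]]]; apply/(C2_holderP _ _ pq).
by exists (opp f), (opp g); split; [exact: has_derivsN|exact: has_derivsN|exact: holderN].
Qed.

Lemma C1_lipschitz_opp A h : closed_itv A -> C1_lipschitz A h -> C1_lipschitz A (opp h).
Proof.
move=> cA; have [p [q [pq E]]] := cA; rewrite {1 2}E => /(C1_lipschitzP _ pq) H.
by apply/(C1_lipschitzP _ pq); rewrite -E in H *; exact: C1_holder_opp.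
Qed.

Lemma C2_lipschitz_opp A h : closed_itv A -> C2_lipschitz A h -> C2_lipschitz A (opp h).
Proof.
move=> cA; have [p [q [pq E]]] := cA; rewrite {1 2}E => /(C2_lipschitzP _ pq) H.
by apply/(C2_lipschitzP _ pq); rewrite -E in H *; exact: C2_holder_opp.
Qed.

Lemma derive_neq0_opp A h : closed_itv A -> derive_neq0 A h -> derive_neq0 A (opp h).
Proof.
move=> [p [q [pq ->]]] H; have hf := derive_neq0_derivs pq H.
apply/(derive_neq0P pq (has_derivsN hf)) => u uI; apply/eqP; rewrite oppr_eq0; apply/eqP.
by move: u uI; apply/(derive_neq0P pq hf).
Qed.

Lemma affine_on_opp A h : affine_on A h -> affine_on A (opp h).
Proof. by move=> [P [Q H]]; exists (- P), (- Q) => x Ax; rewrite H//; ring. Qed.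

End Reflection.

Lemma homeo_monotone {R : realType} (p q : R) (J : set R) (h : R -> R) : p < q ->
  homeo `[p, q]%classic J h ->
  increasing_on p q h \/ increasing_on p q (fun x => - h x).
Proof.
move=> pq [g [[hc _] _ gh _]].
have inj : {in `[p, q] &, injective h}.
  by move=> s t sI tI E; rewrite -(gh s sI) E (gh t tI).
have inI (s t : R) : p <= s -> s < t -> t <= q -> s \in `[p, q] /\ t \in `[p, q].
  by move=> *; rewrite !in_itv/=; split; apply/andP; split; lra.
have [mono|mono] := itv_continuous_inj_mono hc inj; [left|right] => s t ps st tq;
  have [sI tI] := inI s t ps st tq; rewrite ?ltrN2; exact: mono.
Qed.

(** * The equivalences *)

Unset Implicit Arguments.
Theorem theorem3 (R : realType) (I J : set R) (h : R -> R)
    (Omega : nat -> nat) (G : nat -> nat -> set R) (alpha : R)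
    (hI : closed_itv I) (hJ : closed_itv J) (hh : homeo I J h)
    (hG : is_grid I Omega G) (halpha : 0 < alpha <= 1) :
  (* (i) *)
  [/\ quasisymmetric I h <->
        le_O (pairs Omega) (grid_lrd h G) (fun _ _ => 1),
      uaa I h <->
        le_o_div (pairs Omega) (grid_lrd h G) (grid_len G),
      (C1_holder alpha I h /\ derive_neq0 I h) <->
        le_O (pairs Omega) (grid_lrd h G) (fun n b => grid_len G n b `^ alpha),
      (C1_lipschitz I h /\ derive_neq0 I h) <->
        le_O (pairs Omega) (grid_lrd h G) (grid_len G)
    & (affine_on I h /\ derive_neq0 I h) <->
        le_o (pairs Omega) (grid_lrd h G) (grid_len G)]
  /\
  (* (ii), direct implications *)
  [/\ quasisymmetric I h ->
        le_O (triples Omega) (grid_crd h G) (fun _ _ => 1),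
      uaa I h ->
        le_o_div (triples Omega) (grid_crd h G) (grid_len G),
      C1_holder alpha I h -> derive_neq0 I h ->
        le_O (triples Omega) (grid_crd h G)
          (fun n b => grid_len G n b `^ alpha),
      C2_holder alpha I h -> derive_neq0 I h ->
        le_O (triples Omega) (grid_crd h G)
          (fun n b => grid_len G n b `^ (1 + alpha))
    & C2_lipschitz I h -> derive_neq0 I h ->
        le_O (triples Omega) (grid_crd h G)
          (fun n b => grid_len G n b ^+ 2)]
  /\
  (* (ii), converse implications *)
  [/\ le_O (triples Omega) (grid_crd h G) (fun _ _ => 1) ->
        on_interior_itvs I (fun K => quasisymmetric K h),
      le_o_div (triples Omega) (grid_crd h G) (grid_len G) ->
        on_interior_itvs I (fun K => uaa K h),
      le_O (triples Omega) (grid_crd h G)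
          (fun n b => grid_len G n b `^ alpha) ->
        (* For alpha = 1 the bound only gives a Zygmund condition on dh. *)
        (alpha < 1 -> on_interior_itvs I (fun K => C1_holder alpha K h)) /\
        derive_neq0 I h,
      le_O (triples Omega) (grid_crd h G)
          (fun n b => grid_len G n b `^ (1 + alpha)) ->
        on_interior_itvs I (fun K => C2_holder alpha K h) /\ derive_neq0 I h
    & le_O (triples Omega) (grid_crd h G)
          (fun n b => grid_len G n b ^+ 2) ->
        on_interior_itvs I (fun K => C2_lipschitz K h) /\ derive_neq0 I h].
Proof.
have [p [q [pq IE]]] := hI; move: hI hh hG; rewrite {}IE => hI hh [B [M [B1 M1 bm]]].
have [y [ori gp]] := grid_points pq bm.
have hc : cont_on p q h by apply: within_cont_on; have [g [[]]] := hh.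
have mono := homeo_monotone pq hh.
clear J hJ hh.
wlog hi : h hc mono / increasing_on p q h.
  move=> W; case: (mono) => [|hi]; first exact: W.
  have hc' : cont_on p q (fun x => - h x).
    move=> u uI e e0; have [d d0 Hd] := hc u uI e e0; exists d => // v vI vu.
    by rewrite -opprD normrN; exact: Hd.
  have := W _ hc' (or_introl hi) hi.
  rewrite grid_lrd_opp grid_crd_opp quasisymmetric_opp uaa_opp.
  rewrite (opp_eq (P := C1_holder alpha `[p, q]%classic) (fun g => C1_holder_opp hI)).
  rewrite (opp_eq (P := C2_holder alpha `[p, q]%classic) (fun g => C2_holder_opp hI)).
  rewrite (opp_eq (P := C1_lipschitz `[p, q]%classic) (fun g => C1_lipschitz_opp hI)).
  rewrite (opp_eq (P := C2_lipschitz `[p, q]%classic) (fun g => C2_lipschitz_opp hI)).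
  rewrite (opp_eq (P := derive_neq0 `[p, q]%classic) (fun g => derive_neq0_opp hI)).
  rewrite (opp_eq (P := affine_on `[p, q]%classic) (@affine_on_opp _ _)).
  move=> [P1 [P2 [Q1 Q2 Q3 Q4 Q5]]]; split; [exact: P1|split; [exact: P2|split]].
  - by move=> /Q1 H K cK KI; have := H K cK KI; rewrite quasisymmetric_opp.
  - by move=> /Q2 H K cK KI; have := H K cK KI; rewrite uaa_opp.
  - move=> /Q3[H nz]; split; last exact: nz.
    move=> a1 K cK KI; have := H a1 K cK KI.
    by rewrite (opp_eq (P := C1_holder alpha K) (fun g => C1_holder_opp cK)).
  - move=> /Q4[H nz]; split; last exact: nz.
    move=> K cK KI; have := H K cK KI.
    by rewrite (opp_eq (P := C2_holder alpha K) (fun g => C2_holder_opp cK)).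
  - move=> /Q5[H nz]; split; last exact: nz.
    move=> K cK KI; have := H K cK KI.
    by rewrite (opp_eq (P := C2_lipschitz K) (fun g => C2_lipschitz_opp cK)).
have [M' MM] : exists M' : nat, M <= M'%:R.
  by exists (Num.bound M); apply/ltW/archi_boundP; lra.
have cg := cgrid_of_grid B1 bm gp MM.
have /andP[a0 a1] := halpha.
have a01 : 0 < (1 : R) <= 1 by rewrite ltr01 lexx.
have len1 D : (forall n b, D n b -> pairs Omega n b) -> forall n b, D n b ->
    grid_len G n b `^ 1 = grid_len G n b.
  by move=> HD n b /HD Db; rewrite powRr1// ltW// (grid_len_gt0 B1 bm gp hi Db).
have len2 n b : triples Omega n b -> grid_len G n b `^ (1 + 1) = grid_len G n b ^+ 2.
  move=> /pairs_of_triples Db.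
  by rewrite (_ : 1 + 1 = 2%:R)// powR_mulrn// ltW// (grid_len_gt0 B1 bm gp hi Db).
have onK (P : set R -> Prop) : (forall u v, u < v -> p < u -> v < q -> P `[u, v]%classic) ->
    on_interior_itvs `[p, q]%classic P.
  by move=> H K cK KI; have [u [v [uv -> pu vq]]] := interior_subitv cK KI; exact: H.
split; [|split].
- split; split.
  + by move=> /(quasisymmetric_bound B1 bm gp hi)[].
  + exact: (quasisymmetric_of_pairs B1 bm gp hi cg).
  + by move=> /(uaa_bound B1 bm gp hi)[].
  + by move=> H; apply: (uaa_of_node_lr pq hi cg); exact: (node_small_of_pairs B1 bm gp hi cg).
  + by move=> [H1 H2]; have [] := C1_bound pq B1 bm gp hi a0 H1 H2.
  + exact: (C1_of_pairs pq B1 bm gp hi hc cg a0).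
  + move=> [/(C1_lipschitzP _ pq) H1 H2]; have [H _] := C1_bound pq B1 bm gp hi ltr01 H1 H2.
    by apply: le_O_ext H; exact: len1.
  + move=> H; have [] : C1_holder 1 `[p, q]%classic h /\ derive_neq0 `[p, q]%classic h.
      apply: (C1_of_pairs pq B1 bm gp hi hc cg ltr01).
      by apply: le_O_ext H => n b Db; rewrite (len1 (pairs Omega)).
    by move=> /(C1_lipschitzP _ pq).
  + by move=> [/(affine_bound pq B1 bm gp hi)].
  + exact: (affine_of_pairs pq B1 bm gp hi hc cg).
- split.
  + by move=> /(quasisymmetric_bound B1 bm gp hi)[].
  + by move=> /(uaa_bound B1 bm gp hi)[].
  + by move=> H1 H2; have [] := C1_bound pq B1 bm gp hi a0 H1 H2.
  + exact: (C2_bound pq B1 bm gp hi halpha).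
  + move=> /(C2_lipschitzP _ pq) H1 H2; apply: le_O_ext (C2_bound pq B1 bm gp hi a01 H1 H2).
    exact: len2.
- split.
  + move=> H; apply: onK => u v uv pu vq.
    exact: (quasisymmetric_of_triples B1 bm gp hi cg H).
  + move=> H K cK KI; apply: uaa_sub (uaa_of_triples pq B1 bm gp hi cg H).
    by apply: subset_trans KI _; exact: interior_subset.
  + move=> H; split; last exact: (derive_neq0_of_triples pq B1 bm gp hi hc cg a0 H).
    move=> a1'; apply: onK => u v uv pu vq.
    have [H1 _] := C1_of_triples pq B1 bm gp hi hc cg (a := alpha) ltac:(by rewrite a0) H.
    exact: (C1_holder_sub pq uv (ltW pu) (ltW vq) H1).
  + move=> H; have [H1 H2] := C2_of_triples pq B1 bm gp hi hc cg halpha H.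
    by split=> //; apply: onK => u v uv pu vq; exact: (C2_holder_sub pq uv (ltW pu) (ltW vq) H1).
  + move=> H; have [H1 H2] : C2_holder 1 `[p, q]%classic h /\ derive_neq0 `[p, q]%classic h.
      apply: (C2_of_triples pq B1 bm gp hi hc cg a01).
      by apply: le_O_ext H => n b Db; rewrite len2.
    split=> //; apply: onK => u v uv pu vq; apply/(C2_lipschitzP _ uv).
    by exact: (C2_holder_sub pq uv (ltW pu) (ltW vq) H1).
Qed.
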